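(* For every pair of positive numbers $a<b$ there exists a real entire function $f\not\equiv 0$ of exponential type, satisfying $$\int_{-\infty}^\infty|f(x)|e^{-\lambda|x|}\,dx<\infty\quad\text{for all }\lambda>0,$$ whose spectrum is contained in $[-b,-a]\cup[a,b]$, and such that $$\liminf_{r\to\infty}\frac{s(r,f)}{r}<\frac{a}{\pi}.$$
   Context: A real entire function is one taking real values on $\mathbf{R}$. $s(r,f)$ denotes the number of sign changes of $f$ on the interval $[0,r]$. Spectrum: for a locally integrable $f$ with $\int|f(x)|e^{-\lambda|x|}dx<\infty$ for all $\lambda>0$, put $F^+(z)=\int_{-\infty}^0 f(t)e^{-itz}dt$ for $\operatorname{Im}z>0$ and $F^-(z)=-\int_0^\infty f(t)e^{-itz}dt$ for $\operatorname{Im}z<0$. These are analytic in the upper and lower half-planes, respectively. The spectrum of $f$ is the complement in $\mathbf{R}$ of the maximal open set $W\subset\mathbf{R}$ such that $F^+$ and $F^-$ are analytic continuations of each other through $W$. *)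

(* Defs.v *)
From mathcomp Require Import all_boot all_order all_algebra.
From mathcomp Require Import all_classical all_reals all_analysis.
From mathcomp Require Export complex.

Set Implicit Arguments.
Unset Strict Implicit.
Unset Printing Implicit Defensive.

Import Order.TTheory GRing.Theory Num.Theory.
Import numFieldNormedType.Exports.

Local Open Scope classical_set_scope.
Local Open Scope ring_scope.
Local Open Scope complex_scope.

(* The norm of R[i] as a numFieldType takes its values in R[i]; [normc] is the
   R-valued modulus. *)
Notation normc := ComplexField.Normc.normc.

Definition expC (R : realType) (z : R[i]) : R[i] :=
  (expR (complex.Re z))%:C * (cos (complex.Im z) +i* sin (complex.Im z)).

(* The topology of C is carried by the regular module R[i]^o. *)
Definition C_derivable (R : realType) (f : R[i] -> R[i]) (z : R[i]) : Prop :=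
  derivable (f : R[i]^o -> R[i]^o) (z : R[i]^o) 1.

Definition entire (R : realType) (f : R[i] -> R[i]) : Prop :=
  forall z, C_derivable f z.

Definition real_on_R (R : realType) (f : R[i] -> R[i]) : Prop :=
  forall x : R, complex.Im (f x%:C) = 0.

Definition exponential_type (R : realType) (f : R[i] -> R[i]) : Prop :=
  exists A B : R, forall z, normc (f z) <= A * expR (B * normc z).

Definition C_integral (R : realType) (D : set R) (g : R -> R[i]) : R[i] :=
  (\int[lebesgue_measure]_(t in D) complex.Re (g t)) +i*
  (\int[lebesgue_measure]_(t in D) complex.Im (g t)).

(* The imaginary unit is spelled out because ['i] parses as the numClosedField one. *)
Definition Fplus (R : realType) (f : R -> R[i]) (z : R[i]) : R[i] :=
  C_integral `]-oo, 0] (fun t => f t * expC (- ((0 +i* 1) * t%:C * z))).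

Definition Fminus (R : realType) (f : R -> R[i]) (z : R[i]) : R[i] :=
  - C_integral `[0, +oo[ (fun t => f t * expC (- ((0 +i* 1) * t%:C * z))).

(* For W open in R, the set {Im z <> 0} \cup W is open in C, so that being
   differentiable at each of its points means being analytic there. *)
Definition continues_through (R : realType) (f : R -> R[i]) (W : set R) : Prop :=
  exists G : R[i] -> R[i],
    [/\ forall z, complex.Im z != 0 \/ W (complex.Re z) -> C_derivable G z,
        forall z, 0 < complex.Im z -> G z = Fplus f z
      & forall z, complex.Im z < 0 -> G z = Fminus f z].

(* The largest open W with [continues_through f W]; see
   [continues_through_regular_set]. *)
Definition regular_set (R : realType) (f : R -> R[i]) : set R :=
  \bigcup_(W in [set W : set R | open W /\ continues_through f W]) W.

Definition spectrum (R : realType) (f : R -> R[i]) : set R :=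
  ~` regular_set f.

(* The supremum of the n such that g takes values of alternating signs at some
   n.+1 increasing points of [0, r]. *)
Definition sign_changes (R : realType) (g : R -> R) (r : R) : \bar R :=
  ereal_sup [set (n%:R)%:E | n in [set n : nat |
    exists x : nat -> R,
      [/\ 0 <= x 0%N, x n <= r
        & forall k, (k < n)%N -> x k < x k.+1 /\ g (x k) * g (x k.+1) < 0]]].

Lemma open_regular_set (R : realType) (f : R -> R[i]) : open (regular_set f).
Proof. by apply: bigcup_open => W []. Qed.

Lemma continuous_Re (R : realType) : continuous (@complex.Re R : R[i]^o -> R).
Proof.
move=> z; apply/(@cvgrPdist_lt _ R _ (nbhs (z : R[i]^o)) (nbhs_filter (z : R[i]^o))) => e e0.
have e0' : 0 < (e%:C : R[i]) by rewrite ltcR.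
apply: (@filterS R[i]^o (nbhs (z : R[i]^o)) _ _ _ _ (@nbhsx_ballx _ R[i]^o (z : R[i]^o) _ e0')) => w.
rewrite -ball_normE /= => zw; rewrite -ltcR.
by apply: le_lt_trans zw; rewrite -raddfB; exact: normc_ge_Re.
Qed.

Lemma continuous_Im (R : realType) : continuous (@complex.Im R : R[i]^o -> R).
Proof.
move=> z; apply/(@cvgrPdist_lt _ R _ (nbhs (z : R[i]^o)) (nbhs_filter (z : R[i]^o))) => e e0.
have e0' : 0 < (e%:C : R[i]) by rewrite ltcR.
apply: (@filterS R[i]^o (nbhs (z : R[i]^o)) _ _ _ _ (@nbhsx_ballx _ R[i]^o (z : R[i]^o) _ e0')) => w.
rewrite -ball_normE /= => zw; rewrite -ltcR.
apply: le_lt_trans zw; rewrite -raddfB.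
have := normc_ge_Re ((z - w) * (0 +i* 1)); rewrite normrM normc_def.
case: (z - w) => p q /=.
by rewrite mulr0 mulr1 sub0r normrN normc_def /= expr0n /= expr1n add0r sqrtr1 mulr1.
Qed.

Lemma vertical_cvg (R : realType) (x : R) :
  (x +i* h : R[i]^o) @[h --> 0^'+] --> (x%:C : R[i]^o).
Proof.
apply/cvgrPdist_lt => e; rewrite ltcE /= => /andP[/eqP eI e0].
near=> h.
have -> : (x%:C : R[i]^o) - (x +i* h) = (0 -i* h : R[i]).
  by apply/eqP; rewrite eq_complex /= subrr sub0r !eqxx.
rewrite normc_def /= expr0n /= add0r sqrrN sqrtr_sqr ltcE /= -eI eqxx /=.
rewrite gtr0_norm; last by near: h; exact: nbhs_right_gt.
by near: h; exact: nbhs_right_lt.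
Unshelve. all: by end_near. Qed.

Lemma continues_through_agree (R : realType) (G H : R[i] -> R[i]) (x : R) :
    C_derivable G x%:C -> C_derivable H x%:C ->
    (forall z, 0 < complex.Im z -> G z = H z) ->
  G x%:C = H x%:C.
Proof.
move=> dG dH GH.
have lim (F : R[i] -> R[i]) : C_derivable F x%:C ->
    (F (x +i* h) : R[i]^o) @[h --> 0^'+] --> (F x%:C : R[i]^o).
  move=> /derivable1_diffP /differentiable_continuous cF.
  exact: (cvg_comp _ _ (@vertical_cvg _ x) cF).
have limG : (H (x +i* h) : R[i]^o) @[h --> 0^'+] --> (G x%:C : R[i]^o).
  apply: cvg_trans (lim _ dG); apply: near_eq_cvg; near=> h.
  by rewrite GH //=; near: h; exact: nbhs_right_gt.
exact: (@cvg_unique R[i]^o (@norm_hausdorff _ R[i]^o) _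
  (fmap_proper_filter _ (at_right_proper_filter (0 : R))) _ _ limG (lim _ dH)).
Unshelve. all: by end_near. Qed.

Lemma continues_through_regular_set (R : realType) (f : R -> R[i]) :
  (exists W, open W /\ continues_through f W) ->
  continues_through f (regular_set f).
Proof.
move=> [W0 [oW0 cW0]].
pose good x (G : R[i] -> R[i]) := exists W : set R,
  [/\ open W, W x, forall z, complex.Im z != 0 \/ W (complex.Re z) -> C_derivable G z,
    forall z, 0 < complex.Im z -> G z = Fplus f z
  & forall z, complex.Im z < 0 -> G z = Fminus f z].
pose G z := if 0 < complex.Im z then Fplus f z
  else if complex.Im z < 0 then Fminus f z
  else xget (fun=> 0) [set H | good (complex.Re z) H] z.
have GE W H : open W ->
    (forall z, complex.Im z != 0 \/ W (complex.Re z) -> C_derivable H z) ->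
    (forall z, 0 < complex.Im z -> H z = Fplus f z) ->
    (forall z, complex.Im z < 0 -> H z = Fminus f z) ->
  forall z, complex.Im z != 0 \/ W (complex.Re z) -> G z = H z.
  move=> oW dH Hp Hm [x y] /= zW; rewrite /G /=.
  case: ltgtP => y0; [by rewrite Hp|by rewrite Hm|].
  have {}zW : W x by case: zW => //; rewrite -y0 eqxx.
  have : good x (xget (fun=> 0) [set H | good x H]).
    by apply: (@xgetPex _ (fun=> 0) [set H | good x H]); exists H, W.
  rewrite -y0; move: (xget _ _) => K [W' [oW' W'x dK Kp Km]].
  apply: (@continues_through_agree R K H x); first by apply: dK; right.
    by apply: dH; right.
  by move=> z z0; rewrite Kp // Hp.
have oU W : open W ->
    open [set z : R[i]^o | complex.Im z != 0 \/ W (complex.Re z)].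
  move=> oW.
  have -> : [set z : R[i]^o | complex.Im z != 0 \/ W (complex.Re z)] =
    (@complex.Im R : R[i]^o -> R) @^-1` [set~ 0] `|`
    (@complex.Re R : R[i]^o -> R) @^-1` W.
    apply/seteqP; split => z /= [z0|]; [left|by right|left|by right].
      by apply/eqP.
    by apply/eqP.
  apply: openU; apply: open_comp => //.
  - by move=> z _; exact: continuous_Im.
  - by apply: closed_openC; exact: accessible_closed_set1 (hausdorff_accessible (@norm_hausdorff _ R)) _.
  - by move=> z _; exact: continuous_Re.
have dG W z : open W -> continues_through f W ->
    complex.Im z != 0 \/ W (complex.Re z) -> C_derivable G z.
  move=> oW [H [dH Hp Hm]] zW.
  apply: near_eq_derivable (dH z zW).
  have := open_nbhs_nbhs (conj (oU W oW) zW).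
  by apply: filterS => w wW; rewrite (GE W H).
exists G; split.
- move=> z [z0|[W [oW cW] Wz]]; first by apply: (dG W0) => //; left.
  by apply: (dG W) => //; right.
- by move=> z z0; rewrite /G z0.
- by move=> z z0; rewrite /G z0 ltNge (ltW z0).
Qed.

(* Main.v *)
Require Import Defs.
From mathcomp Require Import all_boot all_order all_algebra.
From mathcomp Require Import all_classical all_reals all_analysis.
From mathcomp Require Import ring lra zify.

(* Let d = b - a. We take f(z) = F(z) + conj(F(conj z)) with F(z) = e^{iaz} h(z),
   where h is a limit of polynomials h_k, h_k(0) = 1, such that
     |h(z) - h_k(z)| <= 2^{-k-2} exp(|z|/(k+1) + d max(0, - Im z)).
   The integrals of p(s) e^{-sw} ds along the rays R_+, R_-, i R_+, -i R_+ all equal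
   the sum of p_n n! / w^{n+1} for a polynomial p, and this coincidence passes to
   the limit h, within the half-planes allowed by the weight; so the spectrum of F
   lies in [a, a + d] and that of f in [-b, -a] u [a, b].

   To get h_{k+1} from h_k, approximate h_k(z) by e^{i beta d z} p(z), moving the
   frequency in small steps (e^{iwz} P(z) is close to
   e^{iw'z} P(z) (1 + i(w - w')z/M)^M); then replace e^{i beta d z} by
   circ(z/N)^N, circ(z) = 1 - beta + beta e^{idz}, with N large; then expand and
   move all frequencies, which lie in [0, d], back to 0. For real x between a
   constant and r = 3 pi N / (2 d), the argument of e^{iax} h_{k+1}(x) is
   a x + N arg circ(x/N) up to a small Lipschitz error. It is increasing as beta
   is small, and arg circ(3 pi / (2 d)) < 0, so that Re F has at most
   (a - c) r / pi sign changes on [0, r], with c > 0 independent of k. *)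

Import Order.TTheory GRing.Theory Num.Theory.
Import numFieldNormedType.Exports.

Local Open Scope classical_set_scope.
Local Open Scope ring_scope.
Local Open Scope complex_scope.

Set Implicit Arguments.
Unset Strict Implicit.
Unset Printing Implicit Defensive.

(** A pure frequency in [a, b] gives at least a / pi sign changes per unit length, so the deficit
    has to come from a phase that lags behind. On the real axis [circ] runs through a circle of
    radius beta around 1 - beta that leaves 0 outside: its argument is periodic, without net
    winding, and takes negative values. Passing to circ(z/N)^N turns a fixed negative argument into
    a lag of the same order as the radius, while near 0 the power still looks like an exponential
    with the mean frequency beta d. This is why the polynomial is first moved to that frequency:
    only then is the insertion of [circ] a small change. Where the polynomial is not yet close to
    its leading term, sign changes are counted by a bound that does not involve N and is therefore
    negligible for large N. For a fixed N the lag is bounded, hence useless at much larger radii, so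
    infinitely many N are needed. Returning to a polynomial after each of them makes the step
    repeatable, and each later error is chosen small at the radius already reached, so that its
    count survives in the limit. *)

(** * The real-valued modulus on the complex numbers *)

Section NormC.
Context {R : realType}.
Implicit Types (x y z w : R[i]) (r : R).

Lemma nc_ge0 z : 0 <= normc z.
Proof. by case: z => x y; exact: sqrtr_ge0. Qed.

Lemma ncM x y : normc (x * y) = normc x * normc y.
Proof. exact: ComplexField.Normc.normcM. Qed.

Lemma ncD x y : normc (x + y) <= normc x + normc y.
Proof. exact: le_normcD. Qed.

Lemma ncN x : normc (- x) = normc x.
Proof. exact: normcN. Qed.

Lemma ncB x y : normc (x - y) <= normc x + normc y.
Proof. by rewrite -(ncN y); exact: ncD. Qed.

Lemma ncBC x y : normc (x - y) = normc (y - x).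
Proof. by rewrite -ncN opprB. Qed.

Lemma nc0 : normc (0 : R[i]) = 0.
Proof. exact: ComplexField.Normc.normc0. Qed.

Lemma nc1 : normc (1 : R[i]) = 1.
Proof. exact: ComplexField.Normc.normc1. Qed.

Lemma nc_eq0 z : normc z = 0 -> z = 0.
Proof. exact: ComplexField.Normc.eq0_normc. Qed.

Lemma nc_gt0 z : z != 0 -> 0 < normc z.
Proof.
move=> z0; rewrite lt_neqAle nc_ge0 andbT eq_sym.
by apply: contra z0 => /eqP/nc_eq0 ->.
Qed.

Lemma ncV z : normc z^-1 = (normc z)^-1.
Proof. exact: ComplexField.Normc.normcV. Qed.

Lemma ncX z n : normc (z ^+ n) = normc z ^+ n.
Proof. by elim: n => [|n IH]; rewrite ?expr0 ?nc1 // !exprS ncM IH. Qed.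

Lemma nc_real r : normc r%:C = `|r|.
Proof. by rewrite /= expr0n /= addr0 sqrtr_sqr. Qed.

Lemma nc_nat n : normc (n%:R : R[i]) = n%:R.
Proof. by rewrite -(rmorph_nat (real_complex R)) nc_real ger0_norm. Qed.

Lemma nc_conj z : normc z^*%C = normc z.
Proof. by case: z => x y /=; rewrite sqrrN. Qed.

Lemma le_nc_distD z x y : normc (x - y) <= normc (x - z) + normc (z - y).
Proof. by apply: le_trans (ncD _ _); rewrite addrA subrK. Qed.

Lemma ncDl x y : normc x - normc y <= normc (x + y).
Proof. by rewrite lerBlDr -{1}(addrK y x); exact: ncB. Qed.

Lemma Re_le_nc z : `|complex.Re z| <= normc z.
Proof.
case: z => x y /=; rewrite -sqrtr_sqr ler_wsqrtr// lerDl; exact: sqr_ge0.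
Qed.

Lemma Im_le_nc z : `|complex.Im z| <= normc z.
Proof.
case: z => x y /=; rewrite -sqrtr_sqr ler_wsqrtr// lerDr; exact: sqr_ge0.
Qed.

Lemma nc_leD z : normc z <= `|complex.Re z| + `|complex.Im z|.
Proof.
case: z => x y /=; rewrite -[leRHS]ger0_norm ?addr_ge0// -sqrtr_sqr.
apply: ler_wsqrtr; rewrite sqrrD !real_normK ?num_real//.
by rewrite -addrA [_ *+ 2 + _]addrC addrA lerDl mulrn_wge0 ?mulr_ge0.
Qed.

Lemma cReM x y : complex.Re (x * y)
  = complex.Re x * complex.Re y - complex.Im x * complex.Im y.
Proof. by case: x => ? ?; case: y. Qed.

Lemma cImM x y : complex.Im (x * y)
  = complex.Re x * complex.Im y + complex.Im x * complex.Re y.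
Proof. by case: x => ? ?; case: y. Qed.

Lemma cReD x y : complex.Re (x + y) = complex.Re x + complex.Re y.
Proof. exact: raddfD. Qed.
Lemma cImD x y : complex.Im (x + y) = complex.Im x + complex.Im y.
Proof. exact: raddfD. Qed.
Lemma cReB x y : complex.Re (x - y) = complex.Re x - complex.Re y.
Proof. exact: raddfB. Qed.
Lemma cImB x y : complex.Im (x - y) = complex.Im x - complex.Im y.
Proof. exact: raddfB. Qed.
Lemma cReN x : complex.Re (- x) = - complex.Re x.
Proof. exact: raddfN. Qed.
Lemma complexE z : z = complex.Re z +i* complex.Im z.
Proof. by case: z. Qed.

(** Induction on x^(n+1) - y^(n+1) = x (x^n - y^n) + (x - y) y^n. An error of order 1/n^2 in the
    base thus becomes an error of order 1/n in the n-th power, which drives both limits of powers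
    below. *)
Lemma exprB_nc_le x y (m : R) n : normc x <= m -> normc y <= m ->
  normc (x ^+ n - y ^+ n) <= n%:R * normc (x - y) * m ^+ n.-1.
Proof.
move=> xm ym; have m0 : 0 <= m by exact: le_trans (nc_ge0 _) xm.
elim: n => [|n IH]; first by rewrite !expr0 subrr nc0 !mul0r.
have -> : x ^+ n.+1 - y ^+ n.+1 = x * (x ^+ n - y ^+ n) + (x - y) * y ^+ n.
  by rewrite !exprS; ring.
apply: (le_trans (ncD _ _)); rewrite !ncM ncX -[in leRHS]natr1 mulrDl mul1r mulrDl.
apply: lerD; last by rewrite /= ler_wpM2l ?nc_ge0// lerXn2r ?nnegrE ?nc_ge0.
case: n IH => [|n] IH; first by rewrite !expr0 subrr nc0 mulr0 !mul0r.
apply: (le_trans (ler_pM _ _ xm IH)); rewrite ?nc_ge0//.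
by rewrite /= exprS mulrCA.
Qed.

End NormC.

(** * Elementary estimates for sin, cos, atan and exp *)

Section RealEstimates.
Context {R : realType}.
Implicit Types x y : R.

Lemma lip_of_derive (f df : R -> R) (K : R) :
  (forall x, is_derive x 1 f (df x)) -> (forall x, `|df x| <= K) ->
  forall x y, `|f x - f y| <= K * `|x - y|.
Proof.
move=> fd fK; suff H x y : x < y -> `|f x - f y| <= K * `|x - y|.
  move=> x y; have [|xy|->] := ltgtP x y; [exact: H| |by rewrite !subrr normr0 mulr0].
  by rewrite distrC [`|x - y|]distrC; exact: H.
move=> xy; have cf : {within `[x, y], continuous f}.
  apply: continuous_subspaceT => z; apply: differentiable_continuous.
  by apply/derivable1_diffP; exact: (@ex_derive _ _ _ _ _ _ _ (fd z)).
have [c _ E] := MVT xy (fun z _ => fd z) cf.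
by rewrite distrC E normrM [`|x - y|]distrC ler_wpM2r.
Qed.

Lemma sin_lip x y : `|sin x - sin y| <= `|x - y|.
Proof.
rewrite -[leRHS]mul1r; apply: (@lip_of_derive _ (cos) 1) => *.
exact: cos_max.
Qed.

Lemma cos_lip x y : `|cos x - cos y| <= `|x - y|.
Proof.
rewrite -[leRHS]mul1r; apply: (@lip_of_derive _ (fun t => - sin t) 1) => *.
by rewrite normrN sin_max.
Qed.

Lemma atan_lip x y : `|atan x - atan y| <= `|x - y|.
Proof.
rewrite -[leRHS]mul1r.
apply: (@lip_of_derive _ (fun t => (1 + t ^+ 2)^-1) 1) => z.
have z0 := sqr_ge0 z.
by rewrite ger0_norm ?invr_ge0 ?invf_le1; lra.
Qed.

Lemma sin_le_abs x : `|sin x| <= `|x|.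
Proof. by have := sin_lip x 0; rewrite sin0 !subr0. Qed.

Lemma one_sub_cos x : 1 - cos x = 2 * sin (x / 2) ^+ 2.
Proof.
have {1}-> : x = (x / 2) *+ 2 by rewrite -mulr_natr mulfVK.
by rewrite cos_mulr2n cos2sin2; lra.
Qed.

Lemma one_sub_cos_le_sqr x : `|1 - cos x| <= x ^+ 2.
Proof.
rewrite one_sub_cos normrM normrX ger0_norm//.
have := sin_le_abs (x / 2); rewrite normrM [`|2^-1|]ger0_norm//.
have x0 := normr_ge0 x; have s0 := normr_ge0 (sin (x/2)).
rewrite -[x ^+ 2]real_normK ?num_real// => H.
have : `|sin (x / 2)| ^+ 2 <= (`|x| / 2) ^+ 2 by rewrite lerXn2r ?nnegrE// divr_ge0.
by rewrite expr_div_n; nra.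
Qed.

Lemma one_sub_cos_le_abs x : `|1 - cos x| <= `|x|.
Proof. by have := cos_lip 0 x; rewrite cos0 sub0r normrN. Qed.

Lemma sin_sub_le_sqr x : `|sin x - x| <= x ^+ 2.
Proof.
wlog x0 : x / 0 < x => [H|].
  have [x0|x0|->] := ltgtP x 0; last 2 first.
  - exact: H.
  - by rewrite sin0 subrr normr0 expr0n.
  by have := H (- x); rewrite sinN sqrrN -opprD normrN; apply; rewrite oppr_gt0.
have fd t : is_derive (t : R) 1 (fun t => sin t - t) (cos t - 1) by apply: is_deriveB.
have cf : {within `[0, x], continuous (fun t : R => sin t - t)}.
  apply: continuous_subspaceT => t; apply: differentiable_continuous.
  by apply/derivable1_diffP; exact: (@ex_derive _ _ _ _ _ _ _ (fd t)).
have [c + E] := MVT x0 (fun t _ => fd t) cf.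
move=> /andP[]; rewrite !bnd_simp => c0 cx.
move: E; rewrite sin0 !subr0 => ->.
have := one_sub_cos_le_abs c; rewrite distrC => H.
rewrite normrM (gtr0_norm x0) expr2 ler_wpM2r ?(ltW x0)//.
by apply: (le_trans H); rewrite gtr0_norm// ltW.
Qed.

(** Everything comes from 1 + t <= e^t at t = x and t = -x; the second, multiplied by e^x, is e^x -
    1 <= x e^x. *)
Lemma expR_sub1_le x : `|expR x - 1| <= `|x| * expR `|x|.
Proof.
have h1 := expR_ge1Dx x; have h2 := expR_ge1Dx (- x).
have e0 := expR_gt0 x; have E : expR x * expR (- x) = 1 by rewrite -expRD subrr expR0.
have h3 : expR x - 1 <= x * expR x by nra.
have [x0|x0] := leP 0 x.
  by rewrite !ger0_norm//; lra.
rewrite ltr0_norm ?subr_lt0 ?expR_lt1// (ltr0_norm x0).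
have h4 : 0 <= (- x) * (expR (- x) - 1) by apply: mulr_ge0; lra.
lra.
Qed.

Lemma expR_sub1D_le x : `|expR x - 1 - x| <= x ^+ 2 * expR `|x|.
Proof.
have h1 := expR_ge1Dx x; have h2 := expR_ge1Dx (- x).
have e0 := expR_gt0 x; have E : expR x * expR (- x) = 1 by rewrite -expRD subrr expR0.
have h3 : expR x - 1 <= x * expR x by nra.
rewrite ger0_norm; last by lra.
have [x0|x0] := leP 0 x.
  have h4 : 0 <= x * (1 + x * expR x - expR x) by apply: mulr_ge0; lra.
  by rewrite ?(ger0_norm x0); lra.
rewrite (ltr0_norm x0).
have h4 : 0 <= (- x) * (expR x - 1 - x) by apply: mulr_ge0; lra.
have h5 : 0 <= x ^+ 2 * (expR (- x) - 1) by apply: mulr_ge0; rewrite ?sqr_ge0//; lra.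
lra.
Qed.

End RealEstimates.

(** * The complex exponential and its second-order remainder *)

Section ExpC.
Context {R : realType}.
Implicit Types (z w : R[i]).

Lemma expCD z w : expC (z + w) = expC z * expC w.
Proof.
case: z => a b; case: w => c d; rewrite /expC /= expRD cosD sinD.
by apply/eqP; rewrite eq_complex /=; apply/andP; split; apply/eqP; ring.
Qed.

Lemma expC0 : expC (0 : R[i]) = 1.
Proof. by rewrite /expC /= expR0 cos0 sin0 mul1r. Qed.

Lemma expCMn n z : expC (n%:R * z) = expC z ^+ n.
Proof.
elim: n => [|n IH]; first by rewrite mul0r expC0 expr0.
by rewrite -natr1 mulrDl mul1r expCD IH exprSr.
Qed.

Lemma nc_expC z : normc (expC z) = expR (complex.Re z).
Proof.
rewrite /expC ncM nc_real ger0_norm ?expR_ge0//= cos2Dsin2 sqrtr1 mulr1 //.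
Qed.

Lemma nc_expC_le z : normc (expC z) <= expR (normc z).
Proof. by rewrite nc_expC ler_expR (le_trans (ler_norm _) (Re_le_nc _)). Qed.

Lemma expC_conj z : (expC z)^*%C = expC z^*%C.
Proof.
case: z => a b; rewrite /expC /= cosN sinN.
by apply/eqP; rewrite eq_complex /=; apply/andP; split; apply/eqP; ring.
Qed.

(** Real and imaginary parts are expanded separately. With n = |w|, the real part costs (x^2 + y^2)
    e^n = n^2 e^n and the imaginary part at most 2 n^2 e^n, whence the constant 3. *)
Lemma expC_sub1D_le w :
  normc (expC w - 1 - w) <= 3 * normc w ^+ 2 * expR (normc w).
Proof.
apply: (le_trans (nc_leD _)).
have x1 : `|complex.Re w| <= normc w := Re_le_nc w.
have y1 : `|complex.Im w| <= normc w := Im_le_nc w.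
set n := normc w in x1 y1 *.
have n0 : 0 <= n by exact: nc_ge0.
have e1 : expR `|complex.Re w| <= expR n by rewrite ler_expR.
have e2 : 1 <= expR n by rewrite -expR0 ler_expR.
have e3 : expR (complex.Re w) <= expR n.
  by rewrite ler_expR (le_trans (ler_norm _)).
rewrite !cReB !cImB; case: w @n x1 y1 n0 e1 e2 e3 => x y n /= x1 y1 n0 e1 e2 e3.
rewrite !mul0r !subr0 addr0.
have sq t : `|t| <= n -> t ^+ 2 <= n ^+ 2.
  by move=> H; rewrite -real_normK ?num_real// lerXn2r ?nnegrE.
have A : `|expR x * cos y - 1 - x| <= x ^+ 2 * expR n + expR n * y ^+ 2.
  have -> : expR x * cos y - 1 - x = (expR x - 1 - x) - expR x * (1 - cos y) by ring.
  apply: (le_trans (ler_normB _ _)); apply: lerD.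
    by apply: (le_trans (expR_sub1D_le _)); rewrite ler_wpM2l ?sqr_ge0.
  by rewrite normrM ger0_norm ?expR_ge0// ler_pM ?expR_ge0// one_sub_cos_le_sqr.
have B : `|expR x * sin y - 0 - y| <= n ^+ 2 * expR n + y ^+ 2.
  have -> : expR x * sin y - 0 - y = (expR x - 1) * sin y + (sin y - y) by ring.
  apply: (le_trans (ler_normD _ _)); apply: lerD; last exact: sin_sub_le_sqr.
  rewrite normrM expr2 mulrAC; apply: ler_pM => //; last exact: le_trans (sin_le_abs _) y1.
  apply: (le_trans (expR_sub1_le _)); rewrite ler_pM ?expR_ge0 //.
have C2 : n ^+ 2 = x ^+ 2 + y ^+ 2 by rewrite /n sqr_sqrtr ?addr_ge0 ?sqr_ge0.
have y2 := sqr_ge0 y; have x2 := sqr_ge0 x.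
rewrite subr0 in B; rewrite -/n; move: A B; rewrite C2 => A B; nra.
Qed.

End ExpC.

(** * Limits of sequences with geometrically decreasing steps *)

Section Limits.
Context {R : realType}.

(** The intervals with centre u n and radius t n, the sum of the bounds on all remaining steps, are
    nested; the supremum of their left ends lies in each of them, which gives the limit together
    with its rate. *)
Lemma real_geo_lim (u : nat -> R) (K : R) :
  (forall n, `|u n.+1 - u n| <= K * 2^-1 ^+ n) ->
  exists l, forall n, `|u n - l| <= 2 * K * 2^-1 ^+ n.
Proof.
move=> uK; pose t n := 2 * K * (2^-1 : R) ^+ n.
have tS n : t n = t n.+1 + K * 2^-1 ^+ n by rewrite /t exprS; field.
have K0 : 0 <= K by have := uK 0%N; rewrite expr0 mulr1; apply: le_trans.
have t0 n : 0 <= t n by rewrite /t !mulr_ge0 ?exprn_ge0.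
have lo m k : u m - t m <= u (m + k)%N - t (m + k)%N.
  elim: k => [|k IH]; first by rewrite addn0.
  apply: (le_trans IH); rewrite addnS.
  have := uK (m + k)%N; rewrite ler_norml => /andP[A _].
  have B := tS (m + k)%N; move: A B; set q := K * _; lra.
have hi m k : u (m + k)%N + t (m + k)%N <= u m + t m.
  elim: k => [|k IH]; first by rewrite addn0.
  apply: le_trans IH; rewrite addnS.
  have := uK (m + k)%N; rewrite ler_norml => /andP[_ A].
  have B := tS (m + k)%N; move: A B; set q := K * _; lra.
have lohi m n : u m - t m <= u n + t n.
  have := lo m n; have := hi n m; rewrite addnC.
  have := t0 (m + n)%N; lra.
pose A := [set u n - t n | n in [set: nat]].
have Aub n : ubound A (u n + t n) by move=> _ [m _ <-].
have A0 : A !=set0 by exists (u 0%N - t 0%N), 0%N.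
exists (sup A) => n.
have H1 : u n - t n <= sup A by apply: sup_upper_bound; [split => //; exists (u n + t n)|exists n].
have H2 : sup A <= u n + t n by apply: ge_sup.
rewrite ler_norml; move: H1 H2; rewrite /t; lra.
Qed.

Lemma complex_geo_lim (u : nat -> R[i]) (K : R) :
  (forall n, normc (u n.+1 - u n) <= K * 2^-1 ^+ n) ->
  exists l, forall n, normc (u n - l) <= 4 * K * 2^-1 ^+ n.
Proof.
move=> uK.
have [|a Ha] := @real_geo_lim (fun n => complex.Re (u n)) K.
  by move=> n; rewrite -cReB; apply: le_trans (uK n); exact: Re_le_nc.
have [|b Hb] := @real_geo_lim (fun n => complex.Im (u n)) K.
  by move=> n; rewrite -cImB; apply: le_trans (uK n); exact: Im_le_nc.
exists (a +i* b) => n; apply: (le_trans (nc_leD _)); rewrite cReB cImB /=.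
by have := Ha n; have := Hb n; lra.
Qed.

Lemma exists_half_pow (K e : R) : 0 < e -> exists n, K * 2^-1 ^+ n <= e.
Proof.
move=> e0; have [n nK] : exists n : nat, `|K| / e <= n%:R.
  exists (Num.truncn (`|K| / e)).+1; apply: ltW; exact: truncnS_gt.
exists n; have : n%:R <= 2 ^+ n :> R by rewrite -natrX ler_nat ltnW// ltn_expl.
move=> nn; rewrite exprVn ler_pdivrMr ?exprn_gt0//.
move: nK; rewrite ler_pdivrMr// => nK.
apply: (le_trans (ler_norm _)); apply: (le_trans nK).
by rewrite mulrC ler_wpM2l// ltW.
Qed.

Lemma ler_small (x y K : R) : 0 <= K ->
  (forall e, 0 < e -> e <= 1 -> x <= y + K * e) -> x <= y.
Proof.
move=> K0 H; apply/ler_addgt0Pr => e e0.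
pose d := Num.min 1 (e / (K + 1)).
have d0 : 0 < d by rewrite lt_min ltr01 divr_gt0//; lra.
apply: (le_trans (H d d0 _)); first by rewrite ge_min lexx.
rewrite lerD2l; have : d <= e / (K + 1) by rewrite ge_min lexx orbT.
rewrite ler_pdivlMr; [nra|lra].
Qed.

End Limits.

(** * A coefficient norm for polynomials and Taylor estimates *)

Section PolyNorm.
Context {R : realType}.
Implicit Types (p q : {poly R[i]}) (z w t : R[i]) (r : R).

(** The l^1 norm of the coefficients of p(r z). It dominates the supremum of p on |z| <= r and,
    unlike that supremum, is controlled by pure algebra when a linear factor is divided out. *)
Definition pnorm r p : R := \sum_(i < size p) normc p`_i * r ^+ i.

Lemma pnormE r n p : (size p <= n)%N -> pnorm r p = \sum_(i < n) normc p`_i * r ^+ i.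
Proof.
move=> pn; rewrite /pnorm !(big_ord_widen n (fun i => normc p`_i * r ^+ i) pn).
rewrite big_mkcond; apply: eq_bigr => i _; case: ltnP => // H.
by rewrite nth_default// nc0 mul0r.
Qed.

Lemma pnorm_ge0 r p : 0 <= r -> 0 <= pnorm r p.
Proof. by move=> r0; apply: sumr_ge0 => i _; rewrite mulr_ge0 ?nc_ge0 ?exprn_ge0. Qed.

Lemma pnormD r p q : 0 <= r -> pnorm r (p + q) <= pnorm r p + pnorm r q.
Proof.
move=> r0; pose n := maxn (size p) (size q).
rewrite !(@pnormE r n) ?leq_maxl ?leq_maxr ?size_polyD//.
rewrite -big_split /=; apply: ler_sum => i _.
by rewrite coefD -mulrDl ler_wpM2r ?exprn_ge0 ?ncD.
Qed.

Lemma pnormCM r t p : pnorm r (t%:P * p) = normc t * pnorm r p.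
Proof.
rewrite !(@pnormE r (size p)) ?mulr_sumr//.
  by apply: eq_bigr => i _; rewrite coefCM ncM mulrA.
by rewrite mul_polyC size_scale_leq.
Qed.

Lemma pnormMX r p : pnorm r ('X * p) = r * pnorm r p.
Proof.
rewrite (@pnormE r (size p).+1); last first.
  by apply: leq_trans (size_polyMleq _ _) _; rewrite size_polyX.
rewrite big_ord_recl coefXM eqxx nc0 mul0r add0r /pnorm mulr_sumr.
by apply: eq_bigr => i _; rewrite coefXM /= exprS mulrCA.
Qed.

Lemma pnormC r t : pnorm r t%:P = normc t.
Proof.
rewrite (@pnormE r 1) ?size_polyC ?leq_b1//.
by rewrite big_ord1 coefC /= expr0 mulr1.
Qed.

Lemma horner_pnorm r p z : normc z <= r -> normc p.[z] <= pnorm r p.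
Proof.
move=> zr; have r0 : 0 <= r by apply: le_trans zr; exact: nc_ge0.
elim/poly_ind: p => [|p c IH]; first by rewrite horner0 nc0 pnorm_ge0.
rewrite hornerMXaddC.
rewrite (@pnormE r (size p).+1); last first.
  by rewrite size_MXaddC; case: ifP.
rewrite big_ord_recl coefD coefMX coefC /= add0r expr0 mulr1 addrC.
apply: (le_trans (ncD _ _)); rewrite lerD2l ncM.
have -> : \sum_(i < size p) normc (p * 'X + c%:P)`_(lift ord0 i) * r ^+ lift ord0 i
   = pnorm r p * r.
  rewrite /pnorm mulr_suml; apply: eq_bigr => i _.
  by rewrite coefD coefMX coefC /= addr0 exprSr mulrA.
by rewrite ler_pM ?nc_ge0.
Qed.

(** Multiplication by X multiplies the norm by exactly r, so X q = p + t q gives r |q| <= |p| + |t|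
    |q|. *)
Lemma pnorm_factor r p q t : 0 <= r -> p = ('X - t%:P) * q ->
  (r - normc t) * pnorm r q <= pnorm r p.
Proof.
move=> r0 E; have E2 : 'X * q = p + t%:P * q by rewrite E; ring.
have := pnormD p (t%:P * q) r0; rewrite -E2 pnormMX pnormCM; lra.
Qed.

(** The quotient q is the divided difference of p at w. Subtracting p(w) at most doubles the norm,
    and dividing by X - w costs at most 2 / r because |w| <= r / 2; hence 4 / r. *)
Lemma poly_taylor1 r p w : 0 < r -> normc w <= r / 2 -> exists q : {poly R[i]},
  [/\ p = p.[w]%:P + ('X - w%:P) * q, q.[w] = p^`().[w] &
      pnorm r q <= 4 / r * pnorm r p].
Proof.
move=> r0 wr.
have : root (p - p.[w]%:P) w by rewrite rootE !hornerE subrr.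
move=> /factor_theorem[q E]; rewrite mulrC in E; exists q.
have E2 : p = p.[w]%:P + ('X - w%:P) * q by rewrite -E addrC subrK.
split => //.
  by rewrite {1}E2 derivD derivC derivM derivXsubC !hornerE subrr mul0r addr0.
have H := pnorm_factor (ltW r0) E.
have H2 : pnorm r (p - p.[w]%:P) <= 2 * pnorm r p.
  rewrite -polyCN; apply: (le_trans (pnormD _ _ (ltW r0))); rewrite pnormC ncN.
  have : normc p.[w] <= pnorm r p by apply: horner_pnorm; apply: (le_trans wr); lra.
  lra.
have q0 := pnorm_ge0 q (ltW r0).
rewrite mulrAC ler_pdivlMr//.
have : (r / 2) * pnorm r q <= (r - normc w) * pnorm r q by rewrite ler_wpM2r//; lra.
lra.
Qed.

Lemma poly_lip r p z w : 0 < r -> normc z <= r / 2 -> normc w <= r / 2 ->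
  normc (p.[z] - p.[w]) <= 4 / r * pnorm r p * normc (z - w).
Proof.
move=> r0 zr wr; have [q [E _ Hq]] := poly_taylor1 p r0 wr.
rewrite {1}E !hornerE addrAC subrr add0r ncM mulrC ler_wpM2r ?nc_ge0//.
by apply: le_trans Hq; apply: horner_pnorm; apply: (le_trans zr); lra.
Qed.

Lemma deriv_le r p w : 0 < r -> normc w <= r / 2 ->
  normc p^`().[w] <= 4 / r * pnorm r p.
Proof.
move=> r0 wr; have [q [_ <- Hq]] := poly_taylor1 p r0 wr.
by apply: le_trans Hq; apply: horner_pnorm; apply: (le_trans wr); lra.
Qed.

Lemma poly_taylor2 r p z w : 0 < r -> normc z <= r -> normc w <= r / 2 ->
  normc (p.[z] - p.[w] - (z - w) * p^`().[w])
    <= 16 / r ^+ 2 * pnorm r p * normc (z - w) ^+ 2.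
Proof.
move=> r0 zr wr; have [q [E <- Hq]] := poly_taylor1 p r0 wr.
have [q2 [E2 _ Hq2]] := poly_taylor1 q r0 wr.
have -> : p.[z] - p.[w] - (z - w) * q.[w] = (z - w) ^+ 2 * q2.[z].
  by rewrite {1}E {1}E2 !hornerE; ring.
rewrite ncM ncX mulrC ler_wpM2r ?sqr_ge0//.
apply: (le_trans (horner_pnorm q2 zr)); apply: (le_trans Hq2).
have -> : 16 / r ^+ 2 * pnorm r p = 4 / r * (4 / r * pnorm r p) by field; rewrite gt_eqF.
by rewrite ler_wpM2l// divr_ge0// ltW.
Qed.

End PolyNorm.

(** * Cauchy estimates by averaging over roots of unity *)

Section Cauchy.
Context {R : realType}.
Implicit Types (p q : {poly R[i]}) (z w t : R[i]) (r : R).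

Definition uroot (m : nat) : R[i] := expC (0 +i* (2 * pi / m%:R)).

Lemma urootX m k : uroot m ^+ k = expC (0 +i* (2 * pi * k%:R / m%:R)) :> R[i].
Proof.
rewrite /uroot -expCMn; congr expC.
apply/eqP; rewrite eq_complex -(rmorph_nat (real_complex R)) /=.
by apply/andP; split; apply/eqP; ring.
Qed.

Lemma uroot_prim m : (0 < m)%N -> uroot m ^+ m = 1 :> R[i].
Proof.
move=> m0; rewrite urootX mulfK ?pnatr_eq0 -?lt0n// /expC /= expR0.
by rewrite mulr_natl cos2pi sin2pi; exact: mul1r.
Qed.

Lemma uroot_neq1 m k : (0 < k < m)%N -> uroot m ^+ k != 1 :> R[i].
Proof.
move=> /andP[k0 km]; have m0 : (0 < m)%N by exact: leq_ltn_trans km.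
rewrite urootX; apply/eqP => /(congr1 (@complex.Re R)).
rewrite /expC /= expR0 mul0r subr0 mul1r => H.
have := one_sub_cos (2 * pi * k%:R / m%:R : R); rewrite H subrr.
move/esym/eqP; rewrite mulf_eq0 pnatr_eq0 /= sqrf_eq0 => /eqP.
have -> : 2 * pi * k%:R / m%:R / 2 = pi * (k%:R / m%:R) :> R by field; rewrite pnatr_eq0 -lt0n.
have q0 : 0 < k%:R / m%:R :> R by rewrite divr_gt0 ?ltr0n.
have q1 : k%:R / m%:R < 1 :> R by rewrite ltr_pdivrMr ?ltr0n// mul1r ltr_nat.
have p0 := pi_gt0 R.
have : 0 < sin (pi * (k%:R / m%:R)) :> R.
  by apply: sin_gt0_pi; rewrite mulr_gt0//= -[ltRHS]mulr1 ltr_pM2l.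
by move=> + H2; rewrite H2 ltxx.
Qed.

Lemma sum_uroot m k : (0 < k < m)%N -> \sum_(j < m) uroot m ^+ (k * j) = 0 :> R[i].
Proof.
move=> km; have m0 : (0 < m)%N by case/andP: km => *; exact: leq_ltn_trans (_ : (k < m)%N).
set x := uroot m ^+ k : R[i].
have E : (x - 1) * \sum_(j < m) x ^+ j = 0.
  by rewrite -subrX1 /x -exprM mulnC exprM uroot_prim// expr1n subrr.
move/eqP: E; rewrite mulf_eq0 subr_eq0 (negbTE (uroot_neq1 km)) /= => /eqP E.
by rewrite -[RHS]E; apply: eq_bigr => j _; rewrite exprM.
Qed.

Lemma nc_uroot m j : normc (uroot m ^+ j : R[i]) = 1.
Proof. by rewrite urootX nc_expC /= expR0. Qed.

(** A discrete Cauchy integral: the average of p over m equally spaced points of the circle,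
    weighted by powers of the root of unity, isolates the i-th coefficient exactly since deg p < m.
    The exponent m - i in [T] stands for -i. *)
Lemma cauchy_coef r S p i : 0 <= r -> (forall z, normc z = r -> normc p.[z] <= S) ->
  normc p`_i * r ^+ i <= S.
Proof.
move=> r0 pS.
have S0 : 0 <= S.
  by apply: le_trans (nc_ge0 _) (pS r%:C _); rewrite nc_real ger0_norm.
have [ip|ip] := ltnP i (size p); last by rewrite nth_default// nc0 mul0r.
set m := size p; have ip0 : (i < m)%N by []; have m0 : (0 < m)%N by exact: leq_ltn_trans ip.
pose T := \sum_(j < m) p.[r%:C * uroot m ^+ j] * uroot m ^+ ((m - i) * j).
have TE : T = m%:R * (p`_i * r%:C ^+ i).
  rewrite /T.
  under eq_bigr => j _ do rewrite horner_coef mulr_suml.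
  rewrite exchange_big /= (bigD1 (Ordinal ip)) //= [X in _ + X]big1 ?addr0.
    rewrite (eq_bigr (fun=> p`_i * r%:C ^+ i)); last first.
      move=> j _; rewrite exprMn -exprM -!mulrA -exprD.
      have -> : (j * i + (m - i) * j = m * j)%N.
        by rewrite [(j * i)%N]mulnC -mulnDl subnKC// ltnW.
      by rewrite exprM uroot_prim// expr1n mulr1.
    by rewrite sumr_const card_ord mulr_natl.
  move=> k /negP ki.
  have ki' : (k != i :> nat) by apply/negP => /eqP H; apply: ki; apply/eqP/val_inj.
  rewrite (eq_bigr (fun j : 'I_m => p`_k * r%:C ^+ k * uroot m ^+ ((k + (m - i)) * j))).
    rewrite -mulr_sumr.
    suff -> : \sum_(j < m) uroot m ^+ ((k + (m - i)) * j) = 0 :> R[i] by rewrite mulr0.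
    have [ik|ik] := ltnP i k.
      rewrite (eq_bigr (fun j : 'I_m => uroot m ^+ ((k - i) * j))).
        by rewrite sum_uroot// subn_gt0 ik /= (leq_ltn_trans (leq_subr _ _)).
      move=> j _; have -> : (k + (m - i) = m + (k - i))%N.
        by rewrite addnBA 1?ltnW// addnC -addnBA// ltnW.
      by rewrite mulnDl exprD exprM uroot_prim// expr1n mul1r.
    have {}ik : (k < i)%N by rewrite ltn_neqAle ki' ik.
    rewrite sum_uroot// addn_gt0 subn_gt0 ip orbT /=.
    move: ik ip0; clearbody m; move: (nat_of_ord k) => k'; lia.
  by move=> j _; rewrite exprMn -!mulrA -exprM [(j * k)%N]mulnC -exprD -mulnDl.
have TS : normc T <= m%:R * S.
  rewrite /T; have : forall n (F : 'I_n -> R[i]), (forall j, normc (F j) <= S) ->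
      normc (\sum_(j < n) F j) <= n%:R * S.
    elim=> [|n IH] F FS; first by rewrite big_ord0 nc0 mul0r.
    rewrite big_ord_recr /= -natr1 mulrDl mul1r; apply: (le_trans (ncD _ _)).
    by apply: lerD => //; apply: IH.
  apply => j; rewrite ncM nc_uroot mulr1; apply: pS.
  by rewrite ncM nc_uroot mulr1 nc_real ger0_norm.
move: TS; rewrite TE ncM nc_nat ler_pM2l ?ltr0n// ncM ncX nc_real.
by rewrite (ger0_norm r0).
Qed.

(** Doubling the radius makes the coefficient bounds decay like 2^-i, so the supremum on the larger
    disc bounds the whole sum. *)
Lemma cauchy_pnorm r S p : 0 <= r ->
  (forall z, normc z <= 2 * r -> normc p.[z] <= S) -> pnorm r p <= 2 * S.
Proof.
move=> r0 pS; have c i : normc p`_i * r ^+ i <= S * 2^-1 ^+ i.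
  rewrite exprVn ler_pdivlMr ?exprn_gt0// -mulrA -exprMn mulrC [r * 2]mulrC mulrC.
  by apply: cauchy_coef => [|z zr]; rewrite ?mulr_ge0//; apply: pS; rewrite zr.
have S0 : 0 <= S by apply: le_trans (nc_ge0 _) (pS 0 _); rewrite nc0 mulr_ge0.
apply: (le_trans (ler_sum _ (fun (i : 'I__) _ => c i))).
rewrite -mulr_sumr mulrC ler_wpM2r//.
have : forall n, \sum_(i < n) (2^-1 : R) ^+ i = 2 - 2 * 2^-1 ^+ n.
  elim=> [|n IH]; first by rewrite big_ord0 expr0; ring.
  by rewrite big_ord_recr /= IH exprS; field.
by move=> ->; rewrite gerBl mulr_ge0 ?exprn_ge0.
Qed.

End Cauchy.

(** * Locally uniform limits of polynomials *)

Section LocallyPolynomial.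
Context {R : realType}.
Implicit Types (p q : {poly R[i]}) (z w t : R[i]) (r : R) (E F : R[i] -> R[i]).

(** Writing e^w as the M-th power of e^{w/M}, each factor differs from 1 + w/M by O(|w|^2 / M^2),
    and both bases are bounded by e^{|w|/M}. *)
Lemma expC_pow_approx (M : nat) w : (0 < M)%N ->
  normc (expC w - (1 + w / M%:R) ^+ M) <= 3 * normc w ^+ 2 / M%:R * expR (normc w).
Proof.
move=> M0; have M0' : 0 < M%:R :> R by rewrite ltr0n.
have Mn : M%:R != 0 :> R[i] by rewrite pnatr_eq0 -lt0n.
have -> : expC w = expC (w / M%:R) ^+ M by rewrite -expCMn mulrCA divff// mulr1.
set v := w / M%:R; have nv : normc v = normc w / M%:R by rewrite ncM ncV nc_nat.
have H1 : normc (expC v) <= expR (normc v) := nc_expC_le v.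
have H2 : normc (1 + v) <= expR (normc v).
  by apply: (le_trans (ncD _ _)); rewrite nc1 expR_ge1Dx.
apply: (le_trans (exprB_nc_le M H1 H2)).
have H3 := expC_sub1D_le v; rewrite -addrA -opprD in H3.
have e0 := expR_ge0 (normc v).
apply: (@le_trans _ _ (M%:R * (3 * normc v ^+ 2 * expR (normc v)) * expR (normc v) ^+ M.-1)).
  by rewrite ler_wpM2r ?exprn_ge0// ler_wpM2l.
have -> : expR (normc w) = expR (normc v) * expR (normc v) ^+ M.-1.
  by rewrite -exprS prednK// -expRM_natl nv mulrCA divff ?mulr1// gt_eqF.
rewrite nv le_eqVlt; apply/orP; left; apply/eqP; field; exact: lt0r_neq0.
Qed.

(* Holds exactly for the entire functions; it is the notion of holomorphy used
   for the construction, since it is closed under locally uniform limits. *)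
Definition locpoly E := forall r e, 0 < e ->
  exists p, forall z, normc z <= r -> normc (E z - p.[z]) <= e.

Lemma locpoly_poly p : locpoly (fun z => p.[z]).
Proof. by move=> r e e0; exists p => z _; rewrite subrr nc0 ltW. Qed.

Lemma locpoly_bounded E r : locpoly E ->
  exists S, 0 < S /\ forall z, normc z <= r -> normc (E z) <= S.
Proof.
move=> LE; have [p Hp] := LE `|r| 1 ltr01; exists (pnorm `|r| p + 1); split.
  by rewrite ltr_pwDr// pnorm_ge0.
move=> z zr; have {}zr : normc z <= `|r| by apply: le_trans zr (ler_norm _).
have -> : E z = p.[z] + (E z - p.[z]) by rewrite addrC subrK.
by apply: (le_trans (ncD _ _)); apply: lerD; [exact: horner_pnorm|exact: Hp].
Qed.

Lemma locpoly_add E F : locpoly E -> locpoly F -> locpoly (fun z => E z + F z).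
Proof.
move=> LE LF r e e0; have e2 : 0 < e / 2 by rewrite divr_gt0.
have [p Hp] := LE r _ e2; have [q Hq] := LF r _ e2.
exists (p + q) => z zr; rewrite hornerD.
have -> : E z + F z - (p.[z] + q.[z]) = (E z - p.[z]) + (F z - q.[z]) by ring.
apply: (le_trans (ncD _ _)); have := Hp z zr; have := Hq z zr; lra.
Qed.

Lemma locpoly_mul E F : locpoly E -> locpoly F -> locpoly (fun z => E z * F z).
Proof.
move=> LE LF r e e0.
have [SE [SE0 HE]] := locpoly_bounded r LE; have [SF [SF0 HF]] := locpoly_bounded r LF.
pose d := Num.min 1 (e / (SE + SF + 1)).
have d0 : 0 < d by rewrite lt_min ltr01 divr_gt0//; lra.
have d1 : d <= 1 by rewrite ge_min lexx.
have de : d * (SE + SF + 1) <= e by rewrite -ler_pdivlMr ?ge_min ?lexx ?orbT//; lra.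
have [p Hp] := LE r _ d0; have [q Hq] := LF r _ d0.
exists (p * q) => z zr; rewrite hornerM.
have -> : E z * F z - p.[z] * q.[z]
  = E z * (F z - q.[z]) + (E z - p.[z]) * (F z - (F z - q.[z])) by ring.
have A := Hp z zr; have B := Hq z zr; have EZ := HE z zr; have FZ := HF z zr.
apply: (le_trans (ncD _ _)); rewrite !ncM.
have X1 : normc (E z) * normc (F z - q.[z]) <= SE * d by rewrite ler_pM ?nc_ge0.
have X2 : normc (E z - p.[z]) * normc (F z - (F z - q.[z])) <= d * (SF + 1).
  rewrite ler_pM ?nc_ge0//; apply: (le_trans (ncB _ _)); lra.
lra.
Qed.

Lemma locpoly_opp E : locpoly E -> locpoly (fun z => - E z).
Proof.
move=> LE r e e0; have [p Hp] := LE r e e0; exists (- p) => z zr.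
by rewrite hornerN -opprD ncN Hp.
Qed.

Lemma locpoly_exprn E n : locpoly E -> locpoly (fun z => E z ^+ n).
Proof.
move=> LE; elim: n => [|n IH].
  have -> : (fun z => E z ^+ 0) = (fun z => (1%:P : {poly R[i]}).[z]).
    by apply/funext => z; rewrite hornerC expr0.
  exact: locpoly_poly.
have -> : (fun z => E z ^+ n.+1) = (fun z => E z * E z ^+ n).
  by apply/funext => z; rewrite exprS.
exact: locpoly_mul.
Qed.

Lemma locpoly_lim E : (forall r e, 0 < e ->
    exists F, locpoly F /\ forall z, normc z <= r -> normc (E z - F z) <= e) -> locpoly E.
Proof.
move=> H r e e0; have e2 : 0 < e / 2 by rewrite divr_gt0.
have [F [LF HF]] := H r _ e2; have [p Hp] := LF r _ e2; exists p => z zr.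
have := le_nc_distD (F z) (E z) p.[z]; have := HF z zr; have := Hp z zr; lra.
Qed.

Lemma exists_nat_div (K e : R) : 0 < e -> exists2 n : nat, (0 < n)%N & K / n%:R <= e.
Proof.
move=> e0; exists (Num.truncn (`|K| / e)).+1 => //.
have /ltW := truncnS_gt (`|K| / e); rewrite ler_pdivrMr// => H.
rewrite ler_pdivrMr ?ltr0n//; apply: le_trans (ler_norm _) _.
by rewrite mulrC.
Qed.

Lemma locpoly_expC c : locpoly (fun z => expC (c * z)).
Proof.
move=> r e e0; set s := normc c * `|r|.
have [M M0 HM] := exists_nat_div (3 * s ^+ 2 * expR s) e0.
exists ((1 + (c / M%:R)%:P * 'X) ^+ M) => z zr.
have -> : ((1 + (c / M%:R)%:P * 'X) ^+ M).[z] = (1 + c * z / M%:R) ^+ M.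
  by rewrite !hornerE; congr (_ ^+ _); rewrite mulrAC.
apply: (le_trans (expC_pow_approx _ M0)); apply: le_trans HM.
have M1 : 0 <= M%:R^-1 :> R by rewrite invr_ge0.
have sz : normc (c * z) <= s.
  by rewrite ncM ler_wpM2l ?nc_ge0//; apply: le_trans zr (ler_norm _).
have n0 := nc_ge0 (c * z); have s0 : 0 <= s by exact: le_trans sz.
rewrite mulrAC ler_wpM2r// ler_pM ?expR_ge0 ?ler_expR//.
  by rewrite mulr_ge0 ?exprn_ge0.
by rewrite ler_wpM2l// lerXn2r.
Qed.

(** Cauchy's estimate applied to an approximating polynomial: its norm on radius r is at most twice
    the supremum on 2 r, and the approximation error is then sent to 0. *)
Lemma locpoly_lip E r S z w : locpoly E -> 0 < r ->
  (forall z, normc z <= 2 * r -> normc (E z) <= S) ->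
  normc z <= r / 2 -> normc w <= r / 2 ->
  normc (E z - E w) <= 8 / r * S * normc (z - w).
Proof.
move=> LE r0 ES zr wr.
have K0 : 0 <= 8 / r * normc (z - w) + 2 by rewrite addr_ge0 ?mulr_ge0 ?nc_ge0// invr_ge0 ltW.
apply: (ler_small K0) => e e0 e1; have [p Hp] := LE (2 * r) e e0.
have pS : pnorm r p <= 2 * (S + e).
  apply: cauchy_pnorm => [|t tr]; first exact: ltW.
  have -> : p.[t] = E t - (E t - p.[t]) by rewrite opprB addrC subrK.
  by apply: (le_trans (ncB _ _)); apply: lerD; [exact: ES|exact: Hp].
have H := poly_lip p r0 zr wr.
have zr2 : normc z <= 2 * r by apply: (le_trans zr); lra.
have wr2 : normc w <= 2 * r by apply: (le_trans wr); lra.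
have -> : E z - E w = (E z - p.[z]) + (p.[z] - p.[w]) - (E w - p.[w]) by ring.
apply: (le_trans (ncB _ _)).
have A := ncD (E z - p.[z]) (p.[z] - p.[w]).
have := Hp z zr2; have := Hp w wr2.
have : 4 / r * pnorm r p * normc (z - w) <= 4 / r * (2 * (S + e)) * normc (z - w).
  by rewrite ler_wpM2r ?nc_ge0// ler_wpM2l// divr_ge0// ltW.
have -> : 4 / r * (2 * (S + e)) * normc (z - w)
  = 8 / r * S * normc (z - w) + 8 / r * normc (z - w) * e by ring.
lra.
Qed.

(** Differentiability with a quadratic remainder. Stated by inequalities on [normc], it is preserved
    by products, affine substitutions and local equality by direct estimates, and it implies
    [C_derivable]. *)
Definition qderiv E w (d : R[i]) := exists K, exists r : R,
  [/\ 0 < r, 0 <= K & forall v, normc v <= r ->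
    normc (E (w + v) - E w - v * d) <= K * normc v ^+ 2].

Definition qderivable E w := exists d, qderiv E w d.

(** Polynomials approximating E within 2^-n have derivatives at w that converge geometrically, while
    their norms stay bounded; the second-order Taylor estimate therefore holds with one constant and
    passes to the limit. *)
Lemma locpoly_qderivable E w : locpoly E -> qderivable E w.
Proof.
(* This radius puts w into the half disc |z| <= r / 2 and w + v into |z| <= r for every |v| <= 1, as
   the Taylor estimate requires. *)
move=> LE; pose r := 2 * (normc w + 1); have w0 := nc_ge0 w.
have r0 : 0 < r by rewrite /r; lra.
have wr : normc w <= r / 2 by rewrite /r; lra.
have h0 n : 0 < (2^-1 : R) ^+ n by rewrite exprn_gt0.
pose P n := projT1 (cid (LE (2 * r) _ (h0 n))).
have HP n z : normc z <= 2 * r -> normc (E z - (P n).[z]) <= 2^-1 ^+ n.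
  exact: (projT2 (cid (LE (2 * r) _ (h0 n)))).
have hS n : (2^-1 : R) ^+ n = 2 * 2^-1 ^+ n.+1 by rewrite exprS mulVKf.
have [|d Hd] := @complex_geo_lim R (fun n => (P n)^`().[w]) (16 / r).
  move=> n; rewrite -hornerN -hornerD -derivN -derivD.
  apply: (le_trans (deriv_le _ r0 wr)).
  have : pnorm r (P n.+1 - P n) <= 2 * (2^-1 ^+ n + 2^-1 ^+ n).
    apply: cauchy_pnorm => [|t tr]; first exact: ltW.
    rewrite hornerD hornerN.
    apply: (le_trans (le_nc_distD (E t) _ _)); have := HP n t tr; have := HP n.+1 t tr.
    by rewrite ncBC (hS n); have := h0 n.+1; lra.
  have r4 : 0 <= 4 / r by rewrite divr_ge0// ltW.
  by move=> /(ler_wpM2l r4)/le_trans; apply; rewrite le_eqVlt; apply/orP; left; apply/eqP; field; rewrite gt_eqF.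
have [S [S0 HS]] := locpoly_bounded (2 * r) LE.
pose K := 16 / r ^+ 2 * (2 * (S + 1)).
exists d, K, 1; split => //.
  by rewrite /K !mulr_ge0 ?invr_ge0 ?sqr_ge0//; lra.
move=> v v1; have v0 := nc_ge0 v.
have c0 : 0 <= 64 / r * normc v + 2 by rewrite addr_ge0 ?mulr_ge0// invr_ge0 ltW.
apply: (ler_small c0) => e e0 e1.
have [n Hn] := exists_half_pow 1 e0; rewrite mul1r in Hn.
have pS : pnorm r (P n) <= 2 * (S + 1).
  apply: cauchy_pnorm => [|t tr]; first exact: ltW.
  have -> : (P n).[t] = E t - (E t - (P n).[t]) by rewrite opprB addrC subrK.
  apply: (le_trans (ncB _ _)); apply: lerD; first exact: HS.
  by apply: (le_trans (HP n t tr)); lra.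
have vr : normc (w + v) <= r by apply: (le_trans (ncD _ _)); rewrite /r; lra.
have H := poly_taylor2 (P n) r0 vr wr.
have -> : E (w + v) - E w - v * d = (E (w + v) - (P n).[w + v]) - (E w - (P n).[w])
   + ((P n).[w + v] - (P n).[w] - (w + v - w) * (P n)^`().[w])
   + v * ((P n)^`().[w] - d) by ring.
have A1 : normc (E (w + v) - (P n).[w + v]) <= e by apply: le_trans (HP n _ _) Hn; lra.
have A2 : normc (E w - (P n).[w]) <= e by apply: le_trans (HP n w _) Hn; lra.
have A3 : normc ((P n).[w + v] - (P n).[w] - (w + v - w) * (P n)^`().[w]) <= K * normc v ^+ 2.
  apply: (le_trans H); rewrite [w + v]addrC addrK ler_wpM2r ?sqr_ge0// /K ler_wpM2l//.
  by rewrite mulr_ge0 ?invr_ge0 ?sqr_ge0.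
have A4 : normc (v * ((P n)^`().[w] - d)) <= 64 / r * normc v * e.
  rewrite ncM mulrC -mulrA [normc v * e]mulrC mulrA ler_wpM2r//.
  apply: (le_trans (Hd n)); rewrite (_ : 4 * (16 / r) = 64 / r); last by field; rewrite gt_eqF.
  by rewrite ler_wpM2l// divr_ge0// ltW.
have B1 := ncD ((E (w + v) - (P n).[w + v]) - (E w - (P n).[w])
   + ((P n).[w + v] - (P n).[w] - (w + v - w) * (P n)^`().[w])) (v * ((P n)^`().[w] - d)).
have B2 := ncD ((E (w + v) - (P n).[w + v]) - (E w - (P n).[w]))
   ((P n).[w + v] - (P n).[w] - (w + v - w) * (P n)^`().[w]).
have B3 := ncB (E (w + v) - (P n).[w + v]) (E w - (P n).[w]).
lra.
Qed.

End LocallyPolynomial.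

(** * Counting sign alternations *)

Section Alternation.
Context {R : realType}.
Implicit Types (g : R -> R) (lo hi r : R) (n : nat).

Definition alternates g lo hi n := exists x : nat -> R,
  [/\ lo <= x 0%N, x n <= hi
    & forall k, (k < n)%N -> x k < x k.+1 /\ g (x k) * g (x k.+1) < 0].

(** Only the step that straddles mid can belong to neither half, whence the + 1. *)
Lemma alternates_split g lo mid hi n : lo <= mid -> mid <= hi -> alternates g lo hi n ->
  exists n1 n2, [/\ (n <= n1 + n2 + 1)%N, alternates g lo mid n1 & alternates g mid hi n2].
Proof.
move=> lm mh [x [x0 xn xk]].
have [x0m|mx0] := leP (x 0%N) mid; last first.
  exists 0%N, n; split; first by rewrite addn1.
    by exists (fun=> mid); split.
  by exists x; split => //; exact: ltW.
have ex : exists m, (m <= n)%N && (x m <= mid) by exists 0%N; rewrite leq0n.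
have ub m : (m <= n)%N && (x m <= mid) -> (m <= n)%N by case/andP.
case: (ex_maxnP ex ub) => m /andP[mn xm] mmax.
have [mn'|nm] := ltnP m n; last first.
  have E : m = n by apply/eqP; rewrite eqn_leq mn nm.
  exists n, 0%N; split; first by rewrite addn0 addn1.
    by exists x; split => //; rewrite -E.
  by exists (fun=> mid); split.
have xm1 : mid < x m.+1.
  by rewrite ltNge; apply/negP => H; have := mmax m.+1; rewrite mn' H => /(_ isT); rewrite ltnn.
exists m, (n - m.+1)%N; split; first by lia.
  by exists x; split => // k km; apply: xk; exact: leq_trans mn.
exists (fun k => x (m.+1 + k)%N); split.
- by rewrite addn0 ltW.
- by rewrite subnKC.
- move=> k km; have : (m.+1 + k < n)%N by rewrite -ltn_subRL.
  by move/xk; rewrite addnS.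
Qed.

(** The first sign change provides a root t <= rho. Removing X - t divides the value at 0 by t <=
    rho and costs at most 1 / (r - rho) in the norm. The remaining points lie to the right of t,
    where the factor is positive, so the quotient still alternates at them. *)
Lemma real_poly_alternation (V : {poly R}) (rho r : R) n : 0 < rho -> rho < r ->
  alternates (fun x => V.[x]) 0 rho n ->
  `|V.[0]| <= pnorm r (map_poly (real_complex R) V) * (rho / (r - rho)) ^+ n.
Proof.
move=> rho0 rr; have r0 : 0 <= r by lra.
elim: n V => [|n IH] V [x [x0 xn xk]].
  rewrite expr0 mulr1 -nc_real -(horner_map (real_complex R)) /=.
  by apply: horner_pnorm; rewrite rmorph0 nc0.
have [x01 V01] := xk 0%N isT.
have mono k : (k <= n)%N -> x 1%N <= x k.+1.
  elim: k => // k IHk kn; apply: le_trans (IHk (ltnW kn)) _.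
  by apply: ltW; case: (xk k.+1).
have [t /andP[x0t tx1] Vt] : exists2 t, x 0%N <= t <= x 1%N & root V t.
  move: V01; have [V0|V0|->] := ltgtP V.[x 0%N] 0; last by rewrite mul0r ltxx.
  - rewrite nmulr_rlt0// => V1; apply: poly_ivt; first exact: ltW.
    by rewrite (ltW V0) ltW.
  - rewrite pmulr_rlt0// => V1.
    have [|t tx] := @poly_ivt _ (- V) _ _ (ltW x01).
      by rewrite !hornerN oppr_le0 oppr_ge0 (ltW V0) ltW.
    by rewrite rootN; exists t.
have {}tx1 : t < x 1%N.
  rewrite lt_neqAle tx1 andbT; apply/eqP => E.
  by move: V01; rewrite -E (rootP Vt) mulr0 ltxx.
have t0 : 0 <= t by exact: le_trans x0t.
have trho : t <= rho by apply: (le_trans (ltW tx1)); apply: le_trans xn; exact: mono.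
have [W VW] := factor_theorem _ _ Vt.
have := IH W; set p := map_poly _ W => /(_ _)/le_trans H.
have Hp : pnorm r p <= pnorm r (map_poly (real_complex R) V) / (r - rho).
  rewrite ler_pdivlMr ?subr_gt0// mulrC.
  have E : map_poly (real_complex R) V = ('X - (t%:C)%:P) * p.
    by rewrite VW rmorphM rmorphB /= map_polyX map_polyC mulrC.
  apply: le_trans (pnorm_factor r0 E); rewrite nc_real ger0_norm//.
  by rewrite ler_wpM2r ?pnorm_ge0// lerD2l lerN2.
have -> : V.[0] = - t * W.[0] by rewrite VW hornerM hornerXsubC sub0r mulrC.
have q0 : 0 <= rho / (r - rho) by rewrite divr_ge0//; lra.
rewrite normrM normrN (ger0_norm t0).
apply: (@le_trans _ _ (rho * (pnorm r (map_poly (real_complex R) V) / (r - rho) * (rho / (r - rho)) ^+ n))).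
  apply: ler_pM => //; apply: H; last by rewrite ler_wpM2r ?exprn_ge0.
  exists (fun k => x k.+1); split => //=.
    by apply: (le_trans x0); exact: ltW.
  move=> k kn; have [xx VV] := xk k.+1 kn; split => //.
  have k1 : 0 < x k.+1 - t by have := mono k (ltnW kn); lra.
  have k2 : 0 < x k.+2 - t by lra.
  move: VV; rewrite VW !(hornerM, hornerXsubC).
  have -> : W.[x k.+1] * (x k.+1 - t) * (W.[x k.+2] * (x k.+2 - t))
    = (x k.+1 - t) * (x k.+2 - t) * (W.[x k.+1] * W.[x k.+2]) by ring.
  by rewrite pmulr_rlt0// mulr_gt0.
rewrite le_eqVlt exprS; apply/orP; left; apply/eqP; ring.
Qed.

Lemma same_sign (a b : R) : `|a - b| < `|a| -> 0 < a * b.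
Proof.
have [a0|a0|->] := ltgtP a 0; last by rewrite normr0 ltNge normr_ge0.
- rewrite (ltr0_norm a0) ltr_norml => /andP[H _]; rewrite nmulr_rgt0//; lra.
- rewrite (gtr0_norm a0) ltr_norml => /andP[_ H]; rewrite pmulr_rgt0//; lra.
Qed.

(* Jensen's bound for the number of zeros, in elementary form: each sign change
   splits off a linear factor, which costs a factor 2 in the norm on |z| <= 3 rho. *)
Lemma alternates_bound (F : R[i] -> R[i]) (S rho : R) n : locpoly F -> 0 < rho ->
  F 0 = 1 -> (forall z, normc z <= 6 * rho -> normc (F z) <= S) ->
  alternates (fun x : R => complex.Re (F x%:C)) 0 rho n -> 2 ^+ n <= 4 * (S + 1).
Proof.
move=> LF rho0 F0 FS [x [x0 xn xk]].
pose u (x : R) := complex.Re (F x%:C).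
have S1 : 1 <= S by rewrite -(@nc1 R) -F0; apply: FS; rewrite nc0; lra.
case: n xn xk => [|n] xn xk; first by rewrite expr0; lra.
have mono k m : (k + m <= n.+1)%N -> x k <= x (k + m)%N.
  elim: m => [|m IH]; first by rewrite addn0.
  rewrite addnS => km; apply: le_trans (IH (ltnW km)) _.
  by apply: ltW; case: (xk (k + m)%N).
have u0 k : (k <= n.+1)%N -> 0 < `|u (x k)|.
  rewrite normr_gt0 => kn; apply/eqP => E.
  case: k kn E => [|k] kn E.
    by have [_] := xk 0%N isT; rewrite -/(u _) E mul0r ltxx.
  by have [_] := xk k kn; rewrite -/(u (x k.+1)) E mulr0 ltxx.
(* An approximation within e keeps the sign at every sample point, since e is below all the values
   there, and e <= 1/2 keeps the value at 0 at least 1/2. *)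
have [e [e0 e1 eu]] : exists e, [/\ 0 < e, e <= 1/2 & forall k, (k <= n.+1)%N -> e < `|u (x k)|].
  have : forall m, (m <= n.+1)%N ->
     exists e, [/\ 0 < e, e <= 1/2 & forall k, (k <= m)%N -> e < `|u (x k)|].
    elim=> [|m IH] mn.
      exists (Num.min (1/2) (`|u (x 0%N)| / 2)).
      have := u0 0%N isT => U; split.
      - by rewrite lt_min; apply/andP; split; lra.
      - by rewrite ge_min lexx.
      - by move=> k; rewrite leqn0 => /eqP ->; rewrite gt_min; apply/orP; right; lra.
    have [e [e0 e1 He]] := IH (ltnW mn).
    exists (Num.min e (`|u (x m.+1)| / 2)).
    have := u0 m.+1 mn => U; split.
    - by rewrite lt_min e0 /=; lra.
    - by rewrite ge_min e1.
    - move=> k; rewrite leq_eqVlt => /orP[/eqP ->|km]; rewrite gt_min.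
        by apply/orP; right; lra.
      by apply/orP; left; apply: He.
  by move=> /(_ n.+1 (leqnn _)).
have [Q HQ] := LF (6 * rho) e e0.
(* Taking real parts of the coefficients yields a real polynomial that equals Re Q on the real axis
   and has no larger norm. *)
pose V : {poly R} := \poly_(i < size Q) complex.Re Q`_i.
have VE y : V.[y] = complex.Re Q.[y%:C].
  rewrite /V horner_poly horner_coef (raddf_sum (@complex.Re R)).
  apply: eq_bigr => i _; have -> : y%:C ^+ i = (y ^+ i)%:C by rewrite rmorphXn.
  by apply: (etrans _ (esym (cReM Q`_i (y ^+ i)%:C))); rewrite /= mulr0 subr0.
have Vn : pnorm (3 * rho) (map_poly (real_complex R) V) <= 2 * (S + 1).
  have H : pnorm (3 * rho) Q <= 2 * (S + 1).
    apply: cauchy_pnorm => [|t tr]; first by rewrite mulr_ge0// ltW.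
    have t6 : normc t <= 6 * rho by lra.
    have -> : Q.[t] = F t - (F t - Q.[t]) by rewrite opprB addrC subrK.
    have := FS t t6; have := HQ t t6; have := ncB (F t) (F t - Q.[t]); lra.
  apply: le_trans H; rewrite (@pnormE _ _ (size Q)); last first.
    by apply: leq_trans (size_poly _ _) _; exact: size_poly.
  apply: ler_sum => i _; apply: ler_wpM2r; first by rewrite exprn_ge0// mulr_ge0// ltW.
  rewrite coef_map coef_poly ltn_ord nc_real; exact: Re_le_nc.
have Vu k : (k <= n.+1)%N -> `|u (x k) - V.[x k]| < `|u (x k)|.
  move=> kn; apply: le_lt_trans (eu k kn); rewrite VE /u -cReB.
  apply: (le_trans (Re_le_nc _)); apply: HQ; rewrite nc_real.
  have a := mono 0%N k kn; rewrite add0n in a.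
  have b := mono k (n.+1 - k)%N; rewrite subnKC// in b.
  by have := b (leqnn _); rewrite ger0_norm; lra.
have := @real_poly_alternation V rho (3 * rho) n.+1 rho0.
have -> : rho < 3 * rho by lra.
have -> : rho / (3 * rho - rho) = 2^-1.
  have -> : 3 * rho - rho = 2 * rho by ring.
  by rewrite invfM mulrCA divff ?mulr1// gt_eqF.
move=> /(_ isT) H.
have {H} H : `|V.[0]| <= pnorm (3 * rho) (map_poly (real_complex R) V) * 2^-1 ^+ n.+1.
  apply: H; exists x; split => // k kn; have [xx uu] := xk k kn; split => //.
  have s1 := same_sign (Vu k (ltnW kn)); have s2 := same_sign (Vu k.+1 kn).
  rewrite -/(u (x k)) -/(u (x k.+1)) in uu.
  rewrite ltNge; apply/negP => VV.
  have : (u (x k) * V.[x k]) * (u (x k.+1) * V.[x k.+1]) <= 0.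
    have -> : (u (x k) * V.[x k]) * (u (x k.+1) * V.[x k.+1])
      = (u (x k) * u (x k.+1)) * (V.[x k] * V.[x k.+1]) by ring.
    by rewrite mulr_le0_ge0// ltW.
  by rewrite leNgt mulr_gt0.
have V0 : 1 / 2 <= `|V.[0]|.
  have : `|1 - V.[0]| <= e.
    rewrite VE; have -> : 1 - complex.Re Q.[0%:C] = complex.Re (F 0 - Q.[0]).
      by rewrite F0 cReB.
    by apply: (le_trans (Re_le_nc _)); apply: HQ; rewrite nc0; lra.
  have := ler_norm V.[0]; rewrite ler_norml => ? /andP[]; lra.
have P0 : 0 < (2 : R) ^+ n.+1 by rewrite exprn_gt0.
have : 1 / 2 <= 2 * (S + 1) * 2^-1 ^+ n.+1.
  apply: (le_trans V0); apply: (le_trans H); rewrite ler_wpM2r// exprn_ge0//.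
by rewrite exprVn ler_pdivlMr//; lra.
Qed.

(* If n >= 1 the n+1 points lie in consecutive intervals where cos has constant
   sign; these intervals have length pi. *)
Lemma alternates_cos (A Psi : R -> R) lo hi n :
  (forall x, lo <= x -> x <= hi -> 0 < A x) ->
  (forall x y, lo <= x -> x <= y -> y <= hi -> Psi x <= Psi y) ->
  alternates (fun x => A x * cos (Psi x)) lo hi n ->
  n%:R <= (Psi hi - Psi lo) / pi + 1.
Proof.
move=> A0 mono [x [x0 xn xk]].
have p0 := pi_gt0 R.
have xm k m : (k + m <= n)%N -> x k <= x (k + m)%N.
  elim: m => [|m IH]; first by rewrite addn0.
  rewrite addnS => km; apply: le_trans (IH (ltnW km)) _.
  by apply: ltW; case: (xk (k + m)%N).
have xlo k : (k <= n)%N -> lo <= x k.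
  by move=> kn; apply: (le_trans x0); have := xm 0%N k kn; rewrite add0n.
have xhi k : (k <= n)%N -> x k <= hi.
  by move=> kn; apply: le_trans xn; have := xm k (n - k)%N; rewrite subnKC// => /(_ (leqnn _)).
pose j k : int := Num.floor (Psi (x k) / pi + 2^-1).
have jk k : (j k)%:~R * pi - pi / 2 <= Psi (x k) /\ Psi (x k) < (j k)%:~R * pi + pi / 2.
  rewrite /j; have h1 := floor_le (Psi (x k) / pi + 2^-1).
  have h2 := floorD1_gt (Psi (x k) / pi + 2^-1).
  move: h1 h2; rewrite intrD; set m : R := _%:~R => h1 h2.
  have E : Psi (x k) = (Psi (x k) / pi) * pi by rewrite divfK// gt_eqF.
  move: h1 h2 E; set q := Psi (x k) / pi => h1 h2 ->; nra.
have cosE (m : int) (t : R) : cos (t + m%:~R * pi) = (-1) ^+ `|m|%N * cos t.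
  have nat_case (l : nat) s : cos (s + l%:R * pi) = (-1) ^+ l * cos s :> R.
    elim: l => [|l IH]; first by rewrite mul0r addr0 mul1r.
    by rewrite -natr1 mulrDl mul1r addrA cosDpi IH exprS; ring.
  case: m => l; first exact: nat_case.
  rewrite NegzE abszN mulrNz mulNr.
  have := nat_case l.+1 (t - l.+1%:R * pi); rewrite subrK => ->.
  by rewrite mulrA -exprMn mulrNN mulr1 expr1n mul1r.
have jmono k : (k < n)%N -> (j k < j k.+1)%R.
  move=> kn; have [xx gg] := xk k kn.
  have Pm : Psi (x k) <= Psi (x k.+1).
    by apply: mono; [exact: xlo (ltnW kn)|exact: ltW|exact: xhi].
  rewrite lt_neqAle; apply/andP; split; last first.
    by apply: le_floor; rewrite lerD2r ler_wpM2r// invr_ge0 ltW.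
  apply/eqP => E; move: gg.
  have pos k' : (j k' = j k) -> 0 <= cos (Psi (x k') - (j k)%:~R * pi).
    move=> E'; have [b1 b2] := jk k'; apply: cos_ge0_pihalf; rewrite -E'.
    by apply/andP; split; lra.
  have c1 := pos k erefl; have c2 := pos k.+1 (esym E).
  have e1 : cos (Psi (x k)) = (-1) ^+ `|j k|%N * cos (Psi (x k) - (j k)%:~R * pi).
    by rewrite -cosE subrK.
  have e2 : cos (Psi (x k.+1)) = (-1) ^+ `|j k|%N * cos (Psi (x k.+1) - (j k)%:~R * pi).
    by rewrite -cosE subrK.
  rewrite e1 e2; set s : R := (-1) ^+ _.
  have ss : s * s = 1 by rewrite -exprD addnn -mul2n exprM sqrrN expr1n expr1n.
  have a1 := A0 _ (xlo _ (ltnW kn)) (xhi _ (ltnW kn)).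
  have a2 := A0 _ (xlo _ kn) (xhi _ kn).
  have -> : forall A1 A2 c1 c2 : R, A1 * (s * c1) * (A2 * (s * c2)) = (s * s) * ((A1 * A2) * (c1 * c2)).
    by move=> *; ring.
  by rewrite ss mul1r ltNge !mulr_ge0// ltW.
have jn k : (k <= n)%N -> (j 0%N + k%:Z <= j k)%R.
  elim: k => [|k IH] kn; first by rewrite addr0.
  have := jmono k kn; have := IH (ltnW kn); lia.
have jn2 : ((j 0%N)%:~R + n%:R <= (j n)%:~R :> R).
  by have := jn n (leqnn _); rewrite -(ler_int R) intrD.
have [_ b1] := jk 0%N; have [b2 _] := jk n.
have m1 : Psi lo <= Psi (x 0%N).
  by apply: mono => //; [exact: xhi].
have m2 : Psi (x n) <= Psi hi by apply: mono => //; exact: xlo.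
rewrite -lerBlDr ler_pdivlMr//.
have : ((j 0%N)%:~R + n%:R) * pi <= (j n)%:~R * pi :> R by rewrite ler_wpM2r// ltW.
lra.
Qed.

End Alternation.

(** * Moving frequencies within [0, d] under the weighted error *)

Section PolePushing.
Context {R : realType}.
Implicit Types (p q P : {poly R[i]}) (z : R[i]) (s t l eta : R) (E F : R[i] -> R[i]).

Definition expi (s : R) z : R[i] := expC ((0 +i* s) * z).

Lemma expiD s t z : expi (s + t) z = expi s z * expi t z.
Proof.
have E : 0 +i* (s + t) = (0 +i* s) + (0 +i* t) :> R[i].
  by apply/eqP; rewrite eq_complex /= addr0 !eqxx.
by rewrite /expi E mulrDl expCD.
Qed.

Lemma expi_0 s : expi s 0 = 1.
Proof. by rewrite /expi mulr0 expC0. Qed.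

Lemma expi0 z : expi 0 z = 1.
Proof.
rewrite /expi; have -> : 0 +i* 0 = 0 :> R[i] by apply/eqP; rewrite eq_complex /= !eqxx.
by rewrite mul0r expC0.
Qed.

Lemma nc_expi s z : normc (expi s z) = expR (- s * complex.Im z).
Proof. by rewrite nc_expC cReM /= mul0r sub0r mulNr. Qed.

Lemma nc_i (s : R) : normc (0 +i* s) = `|s|.
Proof. by rewrite /= expr0n /= add0r sqrtr_sqr. Qed.

(** Each factor z is absorbed by |z| <= (2 / l) e^{l |z| / 2}, so the induction on the degree halves
    the exponent left for the remaining polynomial. *)
Lemma poly_growth p (l : R) : 0 < l ->
  exists2 K, 0 < K & forall z, normc p.[z] <= K * expR (l * normc z).
Proof.
elim/poly_ind: p l => [|p c IH] l l0.
  by exists 1 => // z; rewrite horner0 nc0 mul1r expR_ge0.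
have l2 : 0 < l / 2 by rewrite divr_gt0.
have [K K0 HK] := IH _ l2; have c0 := nc_ge0 c.
have li : 0 < 2 / l by rewrite divr_gt0.
exists (K * (2 / l) + normc c + 1) => [|z].
  by rewrite ltr_pwDr// addr_ge0// mulr_ge0// ltW.
rewrite hornerMXaddC; apply: (le_trans (ncD _ _)); rewrite ncM.
have z0 := nc_ge0 z.
have -> : l * normc z = l / 2 * normc z + l / 2 * normc z by field.
have e1 : 1 + l / 2 * normc z <= expR (l / 2 * normc z) := expR_ge1Dx _.
have le0 : 0 <= l / 2 * normc z by rewrite mulr_ge0// ltW.
rewrite expRD; have {HK} := HK z; move: e1.
set e' := expR (l / 2 * normc z) => e1 HK.
have ez : normc z <= 2 / l * e'.
  have -> : normc z = 2 / l * (l / 2 * normc z) by field; rewrite gt_eqF.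
  by rewrite ler_wpM2l//; lra.
have H : normc p.[z] * normc z <= (K * e') * (2 / l * e') by rewrite ler_pM ?nc_ge0.
have ee1 : 1 <= e' by lra.
have ee : 1 <= e' * e' by nra.
have H2 : normc c * 1 <= normc c * (e' * e') by rewrite ler_wpM2l.
rewrite mulr1 in H2.
have -> : (K * (2 / l) + normc c + 1) * (e' * e') = (K * e') * (2 / l * e')
  + normc c * (e' * e') + e' * e' by ring.
lra.
Qed.

Variable d : R.
Hypothesis d0 : 0 < d.

Definition lower_im z : R := Num.max 0 (- complex.Im z).

Lemma lower_im_ge0 z : 0 <= lower_im z.
Proof. by rewrite le_max lexx. Qed.

Lemma lower_im_le z : lower_im z <= normc z.
Proof.
rewrite ge_max nc_ge0 /=; apply: le_trans (Im_le_nc z).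
by rewrite -normrN ler_norm.
Qed.

Lemma nc_expi_le s z : 0 <= s -> s <= d -> normc (expi s z) <= expR (d * lower_im z).
Proof.
move=> s0 sd; rewrite nc_expi ler_expR mulNr -mulrN.
have h1 : - complex.Im z <= lower_im z by rewrite le_max lexx orbT.
have := lower_im_ge0 z => h0.
by apply: (@le_trans _ _ (s * lower_im z)); [rewrite ler_wpM2l|rewrite ler_wpM2r].
Qed.

(* The weight in the lower half-plane is what confines the spectrum to [0, d]. *)
Definition approx E F (l eta : R) :=
  forall z, normc (E z - F z) <= eta * expR (l * normc z + d * lower_im z).

Lemma approx_trans E F G l e1 e2 : approx E F l e1 -> approx F G l e2 -> approx E G l (e1 + e2).
Proof.
move=> H1 H2 z; apply: (le_trans (le_nc_distD (F z) _ _)).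
by rewrite mulrDl lerD.
Qed.

Lemma approx_add E F E' F' l e1 e2 : approx E F l e1 -> approx E' F' l e2 ->
  approx (fun z => E z + E' z) (fun z => F z + F' z) l (e1 + e2).
Proof.
move=> H1 H2 z; rewrite opprD addrACA; apply: (le_trans (ncD _ _)).
by rewrite mulrDl lerD.
Qed.

Lemma approx_scale E F c l e1 e2 : normc c * e1 <= e2 -> approx E F l e1 ->
  approx (fun z => c * E z) (fun z => c * F z) l e2.
Proof.
move=> ce H z; rewrite -mulrBr ncM; apply: (@le_trans _ _ (normc c * (e1 * expR (l * normc z + d * lower_im z)))).
  by rewrite ler_wpM2l ?nc_ge0.
by rewrite mulrA ler_wpM2r ?expR_ge0.
Qed.

Lemma approx_refl E l eta : 0 <= eta -> approx E E l eta.
Proof. by move=> e0 z; rewrite subrr nc0 mulr_ge0 ?expR_ge0. Qed.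

(** The error is a polynomial times e^{|w - w'| |z|} over M. As |w - w'| < l, the exponent l - |w -
    w'| remains to absorb the polynomial, and the common factor e^{i w' z} is bounded by the weight
    because w' lies in [0, d]. *)
Lemma shift_freq_small (w w' : R) l eta P : 0 <= w' -> w' <= d -> `|w - w'| < l -> 0 < eta ->
  exists2 P', P'.[0] = P.[0] &
    approx (fun z => expi w z * P.[z]) (fun z => expi w' z * P'.[z]) l eta.
Proof.
move=> w0 wd wl eta0; set e := w - w' in wl.
have l0 : 0 < l - `|e| by lra.
have [K K0 HK] := poly_growth ((3 * `|e| ^+ 2)%:C *: 'X^2 * P) l0.
have [M M0 HM] := exists_nat_div K eta0.
exists (P * (1 + ((0 +i* e) / M%:R)%:P * 'X) ^+ M) => [|z].
  by rewrite !hornerE expr1n mulr1.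
have -> : expi w z = expi w' z * expi e z by rewrite -expiD /e addrC subrK.
have -> : (P * (1 + ((0 +i* e) / M%:R)%:P * 'X) ^+ M).[z]
   = P.[z] * (1 + ((0 +i* e) * z) / M%:R) ^+ M.
  by rewrite !hornerE; congr (_ * _ ^+ _); rewrite mulrAC.
have -> : forall a b x y : R[i], a * x * b - a * (b * y) = a * b * (x - y) by move=> *; ring.
rewrite ncM (ncM (expi w' z)).
have H := expC_pow_approx ((0 +i* e) * z) M0.
rewrite -/(expi e z) in H; rewrite !ncM nc_i in H.
have HKz : 3 * `|e| ^+ 2 * normc z ^+ 2 * normc P.[z] <= K * expR ((l - `|e|) * normc z).
  apply: le_trans (HK z); rewrite hornerM hornerZ hornerXn ncM ncM ncX nc_real (ger0_norm (_ : 0 <= 3 * `|e| ^+ 2))//.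
have A := nc_expi_le z w0 wd.
have -> : l * normc z + d * lower_im z = (l - `|e|) * normc z + `|e| * normc z + d * lower_im z by ring.
rewrite !expRD.
set x1 := expR (`|e| * normc z) in H *; set x2 := expR (d * lower_im z) in A *.
set x3 := expR _ in HKz *.
have x10 : 0 <= x1 := expR_ge0 _; have x20 : 0 <= x2 := expR_ge0 _.
have x30 : 0 <= x3 := expR_ge0 _.
have Mi : 0 <= M%:R^-1 :> R by rewrite invr_ge0.
apply: (@le_trans _ _ (x2 * normc P.[z] * (3 * (`|e| * normc z) ^+ 2 / M%:R * x1))).
  by apply: ler_pM => //; rewrite ?mulr_ge0 ?nc_ge0// ler_wpM2r ?nc_ge0.
have -> : x2 * normc P.[z] * (3 * (`|e| * normc z) ^+ 2 / M%:R * x1)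
  = (3 * `|e| ^+ 2 * normc z ^+ 2 * normc P.[z]) * (M%:R^-1 * (x1 * x2)) by ring.
apply: (@le_trans _ _ ((K * x3) * (M%:R^-1 * (x1 * x2)))).
  by rewrite ler_wpM2r// !mulr_ge0.
have -> : K * x3 * (M%:R^-1 * (x1 * x2)) = (K / M%:R) * (x3 * x1 * x2) by ring.
by rewrite ler_wpM2r// !mulr_ge0.
Qed.

(** The path from w to w' is cut into equal steps of length at most l / 2. The polynomial changes at
    every step, so each error is requested afresh, with half of the allowance going to the current
    step. *)
Lemma shift_freq_iter n (w w' : R) l eta P : 0 < l -> 0 <= w -> w <= d -> 0 <= w' -> w' <= d ->
  `|w - w'| <= n%:R * (l / 2) -> 0 < eta ->
  exists2 P', P'.[0] = P.[0] &
    approx (fun z => expi w z * P.[z]) (fun z => expi w' z * P'.[z]) l eta.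
Proof.
move=> l0; elim: n w eta P => [|n IH] w eta P w0 wd w0' wd' wl eta0.
  move: wl; rewrite mul0r normr_le0 subr_eq0 => /eqP ->.
  by exists P => //; apply: approx_refl; exact: ltW.
(* The next frequency is a convex combination of w and w', hence stays in [0, d]. *)
pose v := w + (w' - w) / n.+1%:R.
have n0 : 0 < n.+1%:R :> R by [].
have nE : n.+1%:R = n%:R + 1 :> R by rewrite -natr1.
have vE : v = (n%:R * w + w') / n.+1%:R by rewrite /v nE; field; rewrite -nE gt_eqF.
have v0 : 0 <= v by rewrite vE divr_ge0 ?addr_ge0 ?mulr_ge0// ltW.
have vd : v <= d.
  rewrite vE ler_pdivrMr// nE mulrDr mulr1 lerD// mulrC ler_wpM2r//.
have wv : `|w - v| < l.
  have -> : w - v = (w - w') / n.+1%:R by rewrite /v nE; field; rewrite -nE gt_eqF.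
  rewrite normrM [`|n.+1%:R^-1|]ger0_norm ?invr_ge0 ?ltW// ltr_pdivrMr//.
  by apply: (le_lt_trans wl); rewrite mulrC ltr_pM2r// ltr_pdivrMr//; lra.
have vw' : `|v - w'| <= n%:R * (l / 2).
  have -> : v - w' = (w - w') / n.+1%:R * n%:R by rewrite vE nE; field; rewrite -nE gt_eqF.
  rewrite !normrM [`|n.+1%:R^-1|]ger0_norm ?invr_ge0// [`|n%:R|]ger0_norm//.
  rewrite [leRHS]mulrC; apply: ler_wpM2r => //.
  by rewrite ler_pdivrMr// mulrC.
have eta2 : 0 < eta / 2 by rewrite divr_gt0.
have [P1 P10 A1] := shift_freq_small P v0 vd wv eta2.
have [P2 P20 A2] := IH v (eta / 2) P1 v0 vd w0' wd' vw' eta2.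
exists P2; first by rewrite P20.
have -> : eta = eta / 2 + eta / 2 by field.
exact: approx_trans A1 A2.
Qed.

Lemma shift_freq (w w' : R) l eta P : 0 < l -> 0 <= w -> w <= d -> 0 <= w' -> w' <= d -> 0 < eta ->
  exists2 P', P'.[0] = P.[0] &
    approx (fun z => expi w z * P.[z]) (fun z => expi w' z * P'.[z]) l eta.
Proof.
move=> l0 w0 wd w0' wd' eta0.
have l2 : 0 < l / 2 by rewrite divr_gt0.
have [n n0 Hn] := exists_nat_div `|w - w'| l2.
by apply: (@shift_freq_iter n) => //; rewrite mulrC -ler_pdivrMr// ltr0n.
Qed.

Lemma shift_freq_sum n (c : nat -> R[i]) (w : nat -> R) l eta p : 0 < l -> 0 < eta ->
  (forall i, (i < n)%N -> 0 <= w i <= d) ->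
  exists2 P, P.[0] = \sum_(i < n) c i * p.[0] &
    approx (fun z => \sum_(i < n) c i * (expi (w i) z * p.[z])) (fun z => P.[z]) l eta.
Proof.
move=> l0; elim: n eta => [|n IH] eta eta0 wd.
  exists 0; rewrite ?big_ord0 ?horner0// => z.
  by rewrite big_ord0 horner0 subrr nc0 mulr_ge0 ?expR_ge0// ltW.
have e2 : 0 < eta / 2 by rewrite divr_gt0.
have [P P0 A] := IH _ e2 (fun i ni => wd i (ltnW ni)).
have c0 := nc_ge0 (c n).
have e3 : 0 < eta / 2 / (normc (c n) + 1) by rewrite divr_gt0//; lra.
have /andP[w0 wd'] := wd n (ltnSn n).
have [Q Q0 B] := shift_freq p l0 w0 wd' (lexx 0) (ltW d0) e3.
exists (P + c n *: Q).
  by rewrite big_ord_recr /= hornerD hornerZ P0 Q0.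
have B' : approx (fun z => c n * (expi (w n) z * p.[z])) (fun z => c n * (expi 0 z * Q.[z])) l (eta / 2).
  apply: approx_scale B; rewrite mulrA ler_pdivrMr; last by lra.
  by rewrite mulrC ler_wpM2l ?(ltW e2)//; lra.
have := approx_add A B'; have -> : eta / 2 + eta / 2 = eta by field.
move=> H z; have := H z; rewrite big_ord_recr /= hornerD hornerZ expi0 mul1r; exact.
Qed.

Variables beta : R.
Hypotheses (b0 : 0 <= beta) (b1 : beta <= 1).

(** The characteristic function of a Bernoulli variable equal to d with probability beta and to 0
    otherwise. Then circ(z/N)^N is that of the mean of N independent copies, which has values in
    [0, d] and concentrates at beta d. *)
Definition circ z : R[i] := (1 - beta)%:C + beta%:C * expi d z.

Lemma circ_0 : circ 0 = 1.
Proof. by rewrite /circ expi_0 mulr1 -rmorphD /= subrK. Qed.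

Lemma nc_circ_le z : normc (circ z) <= expR (d * lower_im z).
Proof.
apply: (le_trans (ncD _ _)); rewrite ncM !nc_real !ger0_norm ?subr_ge0//.
have := nc_expi_le z (ltW d0) (lexx d); have : 1 <= expR (d * lower_im z).
  by rewrite -expR0 ler_expR mulr_ge0 ?lower_im_ge0// ltW.
move=> h1 h2; have h3 := ler_wpM2l b0 h2.
have h4 : 0 <= (1 - beta) * (expR (d * lower_im z) - 1) by apply: mulr_ge0; rewrite subr_ge0.
lra.
Qed.

Lemma lower_im_div z (N : nat) : lower_im (z / N%:R) = lower_im z / N%:R.
Proof.
suff E : complex.Im (z / N%:R) = complex.Im z / N%:R.
  by rewrite /lower_im E -mulNr maxr_pMl ?mul0r.
by rewrite -(rmorph_nat (real_complex R)) -fmorphV cImM /= mulr0 add0r.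
Qed.

(** The weak law of large numbers in analytic form: [circ] and e^{i beta d v} agree to first order
    at 0, so with v = z/N one factor is off by O(|v|^2), and N factors by O(|z|^2 / N). Each of the
    other N - 1 factors is at most e^{d lower_im(v)}, and together they cost no more than the weight
    at z. *)
Lemma circ_conv p l eta : 0 < l -> 0 < eta -> exists N0 : nat, forall N : nat,
  (N0 <= N)%N -> (0 < N)%N ->
  approx (fun z => expi (beta * d) z * p.[z]) (fun z => circ (z / N%:R) ^+ N * p.[z]) l eta.
Proof.
move=> l0 eta0; have l2 : 0 < l / 2 by rewrite divr_gt0.
have [K K0 HK] := poly_growth ((6 * d ^+ 2)%:C *: 'X^2 * p) l2.
have [N1 N10 HN1] := exists_nat_div K eta0.
have [N2 N20 HN2] := exists_nat_div d l2.
exists (maxn N1 N2) => N; rewrite geq_max => /andP[N1N N2N] N0 z.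
have N0' : 0 < N%:R :> R by rewrite ltr0n.
have Ni : 0 <= N%:R^-1 :> R by rewrite invr_ge0 ltW.
have KN : K / N%:R <= eta.
  apply: le_trans HN1; rewrite ler_wpM2l ?(ltW K0)// lef_pV2 ?posrE ?ltr0n// ler_nat//.
have dN : d / N%:R <= l / 2.
  apply: le_trans HN2; rewrite ler_wpM2l ?(ltW d0)// lef_pV2 ?posrE ?ltr0n// ler_nat//.
have [v vE] : exists v, v = z / N%:R by exists (z / N%:R).
have nv : normc v = normc z / N%:R by rewrite vE ncM ncV nc_nat.
rewrite -vE.
have Nn : N%:R != 0 :> R[i] by rewrite pnatr_eq0 -lt0n.
have EN : expi (beta * d) z = expi (beta * d) v ^+ N.
  rewrite /expi -expCMn; congr expC; rewrite vE.
  by rewrite mulrCA; congr (_ * _); rewrite mulrCA divff// mulr1.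
have v0 := nc_ge0 v.
have bd0 : 0 <= beta * d by rewrite mulr_ge0// ltW.
have bdd : beta * d <= d by rewrite -[leRHS]mul1r ler_wpM2r// ltW.
have A1 : normc (expi (beta * d) v) <= expR (d * lower_im v) by exact: nc_expi_le.
have A2 : normc (circ v) <= expR (d * lower_im v) by exact: nc_circ_le.
have A3 : normc (expi (beta * d) v - circ v) <= 6 * d ^+ 2 * normc v ^+ 2 * expR (d * normc v).
  have -> : expi (beta * d) v - circ v = (expC ((0 +i* (beta * d)) * v) - 1 - (0 +i* (beta * d)) * v)
     - beta%:C * (expC ((0 +i* d) * v) - 1 - (0 +i* d) * v).
    rewrite /circ /expi; set x := expC _; set y := expC _.
    have -> : 0 +i* (beta * d) = beta%:C * (0 +i* d) :> R[i].
      by apply/eqP; rewrite eq_complex /=; apply/andP; split; apply/eqP; ring.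
    by rewrite rmorphB rmorph1; ring.
  have B1 := expC_sub1D_le ((0 +i* (beta * d)) * v).
  have B2 := expC_sub1D_le ((0 +i* d) * v).
  move: B1 B2; rewrite !ncM !nc_i (ger0_norm bd0) (gtr0_norm d0) => B1 B2.
  apply: (le_trans (ncB _ _)); rewrite ncM nc_real (ger0_norm b0).
  set X := 3 * (d * normc v) ^+ 2 * expR (d * normc v) in B2.
  have X0 : 0 <= X by rewrite mulr_ge0 ?expR_ge0// mulr_ge0 ?sqr_ge0.
  have {}B1 : normc (expC ((0 +i* (beta * d)) * v) - 1 - (0 +i* (beta * d)) * v) <= X.
    have bv : beta * d * normc v <= d * normc v by rewrite ler_wpM2r.
    apply: (le_trans B1); rewrite /X; apply: ler_pM.
    - by apply: mulr_ge0; rewrite ?sqr_ge0.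
    - exact: expR_ge0.
    - have p1 : 0 <= beta * d * normc v by apply: mulr_ge0.
      have p2 : 0 <= d * normc v by exact: le_trans bv.
      by rewrite ler_wpM2l// ler_pXn2r.
    - by rewrite ler_expR.
  have {}B2 : beta * normc (expC ((0 +i* d) * v) - 1 - (0 +i* d) * v) <= X.
    by apply: le_trans B2; rewrite ler_piMl ?nc_ge0.
  have -> : 6 * d ^+ 2 * normc v ^+ 2 * expR (d * normc v) = X + X by rewrite /X; ring.
  exact: lerD.
have m1 : 1 <= expR (d * lower_im v) by rewrite -expR0 ler_expR mulr_ge0 ?lower_im_ge0// ltW.
rewrite EN -mulrBl ncM.
have H : normc (expi (beta * d) v ^+ N - circ v ^+ N)
  <= 6 * d ^+ 2 * normc z ^+ 2 / N%:R * expR (l / 2 * normc z) * expR (d * lower_im z).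
  apply: (le_trans (exprB_nc_le N A1 A2)).
  have mN : expR (d * lower_im v) ^+ N.-1 <= expR (d * lower_im z).
    have -> : expR (d * lower_im z) = expR (d * lower_im v) ^+ N.
      by rewrite -expRM_natl vE lower_im_div mulrCA (mulrCA N%:R) divff ?mulr1// gt_eqF.
    by rewrite ler_weXn2l// leq_pred.
  apply: ler_pM => //; rewrite ?mulr_ge0 ?nc_ge0 ?exprn_ge0 ?expR_ge0//.
  apply: (@le_trans _ _ (N%:R * (6 * d ^+ 2 * normc v ^+ 2 * expR (d * normc v)))).
    by rewrite ler_wpM2l.
  have e1 : expR (d * normc v) <= expR (l / 2 * normc z).
    rewrite ler_expR nv; have -> : d * (normc z / N%:R) = d / N%:R * normc z by ring.
    by rewrite ler_wpM2r ?nc_ge0.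
  have -> : N%:R * (6 * d ^+ 2 * normc v ^+ 2 * expR (d * normc v))
     = 6 * d ^+ 2 * normc z ^+ 2 / N%:R * expR (d * normc v).
    by rewrite nv; field; rewrite gt_eqF.
  apply: ler_wpM2l => //; apply: mulr_ge0 => //; apply: mulr_ge0; last exact: sqr_ge0.
  by apply: mulr_ge0; rewrite ?sqr_ge0.
have HKz : 6 * d ^+ 2 * normc z ^+ 2 * normc p.[z] <= K * expR (l / 2 * normc z).
  apply: le_trans (HK z); rewrite hornerM hornerZ hornerXn ncM ncM ncX nc_real (ger0_norm (_ : 0 <= 6 * d ^+ 2))//.
  by rewrite mulr_ge0 ?sqr_ge0.
have -> : l * normc z + d * lower_im z = l / 2 * normc z + l / 2 * normc z + d * lower_im z by field.
rewrite !expRD; move: H HKz.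
set x1 := expR (l / 2 * normc z); set x2 := expR (d * lower_im z) => H HKz.
have x10 : 0 <= x1 := expR_ge0 _; have x20 : 0 <= x2 := expR_ge0 _.
apply: (@le_trans _ _ (6 * d ^+ 2 * normc z ^+ 2 / N%:R * x1 * x2 * normc p.[z])).
  by rewrite ler_wpM2r ?nc_ge0.
have -> : 6 * d ^+ 2 * normc z ^+ 2 / N%:R * x1 * x2 * normc p.[z]
  = 6 * d ^+ 2 * normc z ^+ 2 * normc p.[z] * (N%:R^-1 * (x1 * x2)) by ring.
apply: (@le_trans _ _ (K * x1 * (N%:R^-1 * (x1 * x2)))).
  by rewrite ler_wpM2r// !mulr_ge0.
have -> : K * x1 * (N%:R^-1 * (x1 * x2)) = K / N%:R * (x1 * x1 * x2) by ring.
by rewrite ler_wpM2r// !mulr_ge0.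
Qed.

Lemma circ_pow_expand N z : (0 < N)%N -> circ (z / N%:R) ^+ N =
  \sum_(i < N.+1) ('C(N, i)%:R * (1 - beta)%:C ^+ (N - i) * beta%:C ^+ i) * expi (d * i%:R / N%:R) z.
Proof.
move=> N0; rewrite /circ exprDn; apply: eq_bigr => i _.
have -> : expi (d * i%:R / N%:R) z = expi d (z / N%:R) ^+ i; last first.
  rewrite exprMn -mulr_natl; set x := expi _ _ ^+ _; ring.
rewrite /expi -expCMn; congr expC.
have -> : 0 +i* (d * i%:R / N%:R) = i%:R * (0 +i* d) / N%:R :> R[i].
  rewrite -!(rmorph_nat (real_complex R)) -fmorphV.
  by apply/eqP; rewrite eq_complex /=; apply/andP; split; apply/eqP; ring.
by rewrite !mulrA mulrAC.
Qed.

(** The binomial expansion has the frequencies d i / N, all in [0, d]. The value at 0 is preserved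
    because the binomial weights sum to circ(0)^N = 1. *)
Lemma circ_down p N l eta : 0 < l -> 0 < eta -> (0 < N)%N ->
  exists2 P, P.[0] = p.[0] &
    approx (fun z => circ (z / N%:R) ^+ N * p.[z]) (fun z => P.[z]) l eta.
Proof.
move=> l0 eta0 N0.
pose c i : R[i] := 'C(N, i)%:R * (1 - beta)%:C ^+ (N - i) * beta%:C ^+ i.
have [|P P0 A] := @shift_freq_sum N.+1 c (fun i => d * i%:R / N%:R) l eta p l0 eta0.
  move=> i iN; rewrite divr_ge0 ?mulr_ge0 ?(ltW d0)//=.
  by rewrite ler_pdivrMr ?ltr0n// ler_wpM2l ?(ltW d0)// ler_nat.
exists P.
  rewrite P0 -mulr_suml; have := circ_pow_expand 0 N0.
  rewrite mul0r circ_0 expr1n => E.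
  rewrite (eq_bigr (fun i : 'I_N.+1 => c i * expi (d * i%:R / N%:R) 0)).
    by rewrite -E mul1r.
  by move=> i _; rewrite expi_0 mulr1.
move=> z; have := A z; rewrite circ_pow_expand// mulr_suml.
by under eq_bigr do rewrite mulrA.
Qed.

End PolePushing.

(** * Arguments of complex numbers and their Lipschitz bounds *)

Section Phase.
Context {R : realType}.
Implicit Types (p q : {poly R[i]}) (z w : R[i]) (E F : R[i] -> R[i]).

Definition cis (t : R) : R[i] := expC (0 +i* t).

Lemma cisRE t : cis t = cos t +i* sin t.
Proof. by rewrite /cis /expC /= expR0; exact: mul1r. Qed.

Lemma cisRD s t : cis (s + t) = cis s * cis t.
Proof.
rewrite /cis -expCD; congr expC; apply/eqP.
by rewrite eq_complex /= addr0 !eqxx.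
Qed.

Lemma cis_natM n t : cis (n%:R * t) = cis t ^+ n.
Proof.
rewrite /cis -expCMn; congr expC; rewrite -(rmorph_nat (real_complex R)).
by apply/eqP; rewrite eq_complex /=; apply/andP; split; apply/eqP; ring.
Qed.

(** The principal argument in the right half-plane. Every factor whose argument has to vary
    continuously stays within 1/4 of 1, so this branch suffices. *)
Definition phase z : R := atan (complex.Im z / complex.Re z).

Lemma polar_phase z : 0 < complex.Re z -> z = (normc z)%:C * cis (phase z).
Proof.
case: z => x y /= x0; rewrite cisRE /phase /=.
set t := atan (y / x).
have c0 : 0 < cos t.
  by apply: cos_gt0_pihalf; rewrite atan_gtNpi2 atan_ltpi2.
have st : sin t = cos t * (y / x).
  have := atanK (y / x); rewrite -/t /tan => <-.
  by rewrite mulrCA divff ?mulr1// gt_eqF.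
have E := cos2Dsin2 t; rewrite st in E.
have N : Num.sqrt (x ^+ 2 + y ^+ 2) = x / cos t.
  apply/eqP; rewrite -(eqrXn2 (n := 2))// ?sqrtr_ge0 ?divr_ge0 ?(ltW x0) ?(ltW c0)//.
  rewrite sqr_sqrtr ?addr_ge0 ?sqr_ge0// expr_div_n.
  have -> : x ^+ 2 + y ^+ 2 = x ^+ 2 * (cos t ^+ 2 + (cos t * (y / x)) ^+ 2) / cos t ^+ 2.
    by field; rewrite !gt_eqF.
  by rewrite E mulr1.
rewrite N st; apply/eqP; rewrite eq_complex /=; apply/andP; split; apply/eqP; field; rewrite !gt_eqF//.
Qed.

(** Multiplication by -1 or by plus or minus i brings z into the right half-plane. It serves for the
    leading coefficient, a constant, where any choice of argument will do. *)
Lemma polar_ex z : z != 0 -> exists g, z = (normc z)%:C * cis g.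
Proof.
move=> z0; have aux (w : R[i]) s : 0 < complex.Re w -> z = w * cis s ->
    exists g, z = (normc z)%:C * cis g.
  move=> w0 zw; exists (phase w + s).
  have nzw : normc z = normc w by rewrite zw (ncM w) nc_expC /= expR0 mulr1.
  by rewrite nzw {1}zw {1}(polar_phase w0) cisRD -(mulrA (normc w)%:C).
have cis_pi : cis pi = -1.
  by rewrite cisRE cospi sinpi; apply/eqP; rewrite eq_complex /= oppr0 !eqxx.
have cis_pi2 : cis (pi / 2) = 0 +i* 1 by rewrite cisRE cos_pihalf sin_pihalf.
have cis_Npi2 : cis (- (pi / 2)) = 0 -i* 1 by rewrite cisRE cosN sinN cos_pihalf sin_pihalf.
have [x0|x0|x0] := ltgtP (complex.Re z) 0.
- by apply: (aux (- z) pi); [rewrite cReN oppr_gt0|rewrite cis_pi; ring].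
- apply: (aux z 0) => //.
  by rewrite cisRE cos0 sin0; exact: (esym (mulr1 z)).
have [y0|y0|y0] := ltgtP (complex.Im z) 0.
- apply: (aux ((0 +i* 1) * z) (- (pi / 2))).
    by rewrite cReM /= mul0r mul1r sub0r oppr_gt0.
  by rewrite cis_Npi2; case: z {z0 aux x0 y0} => x y; apply/eqP; rewrite eq_complex /=;
    apply/andP; split; apply/eqP; ring.
- apply: (aux ((0 -i* 1) * z) (pi / 2)).
    by rewrite cReM /= mul0r mulN1r sub0r opprK.
  by rewrite cis_pi2; case: z {z0 aux x0 y0} => x y; apply/eqP; rewrite eq_complex /=;
    apply/andP; split; apply/eqP; ring.
by case/eqP: z0; rewrite (complexE z) x0 y0.
Qed.

Lemma ratio_lip (A1 A2 B1 B2 e : R) : 3 / 4 <= A1 -> 3 / 4 <= A2 -> `|B2| <= 1 / 4 ->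
  `|A1 - A2| <= e -> `|B1 - B2| <= e -> `|B1 / A1 - B2 / A2| <= 2 * e.
Proof.
move=> a1 a2 b2 ea eb.
have e0 : 0 <= e by exact: le_trans ea.
have a12 : 9 / 16 <= A1 * A2.
  have : 3 / 4 * (3 / 4) <= A1 * A2 by apply: ler_pM => //; lra.
  lra.
have -> : B1 / A1 - B2 / A2 = ((B1 - B2) - B2 / A2 * (A1 - A2)) / A1.
  by field; apply/andP; split; apply: lt0r_neq0; lra.
have q : `|B2 / A2| <= 1 / 3.
  rewrite normrM normfV (ger0_norm (_ : 0 <= A2)); last by lra.
  by rewrite ler_pdivrMr; lra.
rewrite normrM normfV (ger0_norm (_ : 0 <= A1)); last by lra.
rewrite ler_pdivrMr; last by lra.
apply: (le_trans (ler_normB _ _)); rewrite normrM.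
have : `|B2 / A2| * `|A1 - A2| <= 1 / 3 * e by apply: ler_pM.
have : 2 * e * (3 / 4) <= 2 * e * A1 by rewrite ler_wpM2l//; lra.
lra.
Qed.

Lemma phase_lip z w e : normc (z - 1) <= 1 / 4 -> normc (w - 1) <= 1 / 4 ->
  normc (z - w) <= e -> `|phase z - phase w| <= 2 * e.
Proof.
move=> z1 w1 zw; apply: (le_trans (atan_lip _ _)); apply: ratio_lip.
- have := le_trans (Re_le_nc _) z1; rewrite cReB ler_norml /= => /andP[]; lra.
- have := le_trans (Re_le_nc _) w1; rewrite cReB ler_norml /= => /andP[]; lra.
- by have := le_trans (Im_le_nc _) w1; rewrite cImB subr0.
- by rewrite -cReB; apply: le_trans (Re_le_nc _) zw.
- by rewrite -cImB; apply: le_trans (Im_le_nc _) zw.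
Qed.

(** The quotient T(x) is q(1/x) for the reversed polynomial q divided by the leading coefficient,
    and q(0) = 1. A Lipschitz constant L of q on [0, 1] gives |T(x) - 1| <= L / x and |T(x) - T(y)|
    <= L |x - y| / (x y), both small once rho >= L / k. *)
Lemma poly_at_infinity p (k : R) : p != 0 -> 0 < k -> exists2 rho, 1 <= rho &
  let T (x : R) := p.[x%:C] / (lead_coef p * x%:C ^+ (size p).-1) in
  forall x y : R, rho <= x -> rho <= y ->
    normc (T x - 1) <= k /\ normc (T x - T y) <= k * `|x - y|.
Proof.
move=> p0 k0; set m := (size p).-1; set c := lead_coef p.
have c0 : c != 0 by rewrite lead_coef_eq0.
have szp : size p = m.+1 by rewrite prednK// lt0n size_poly_eq0.
pose q : {poly R[i]} := \poly_(i < m.+1) (p`_(m - i) / c).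
pose L := 4 / 2 * pnorm 2 q.
have L0 : 0 <= L by rewrite mulr_ge0 ?pnorm_ge0.
have qT x : x != 0 -> p.[x%:C] / (c * x%:C ^+ m) = q.[(x^-1)%:C].
  move=> x0; have xC0 : x%:C != 0 :> R[i] by rewrite fmorph_eq0.
  rewrite horner_coef szp horner_poly mulr_suml (reindex_inj rev_ord_inj) /=.
  apply: eq_bigr => i _; rewrite subSS fmorphV.
  have im : (i <= m)%N by rewrite -ltnS.
  have -> : x%:C ^+ m = x%:C ^+ (m - i) * x%:C ^+ i :> R[i] by rewrite -exprD subnK.
  by rewrite exprVn; field; rewrite c0 !expf_neq0.
have q0 : q.[0] = 1.
  rewrite horner_coef0 coef_poly /= subn0 -/(lead_coef _) divff//.
have qlip (s t : R) : 0 <= s -> s <= 1 -> 0 <= t -> t <= 1 -> normc (q.[s%:C] - q.[t%:C]) <= L * `|s - t|.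
  move=> s0 s1 t0 t1; have := @poly_lip R 2 q s%:C t%:C.
  rewrite -rmorphB !nc_real divff// ?(ger0_norm s0) ?(ger0_norm t0); exact.
exists (Num.max 1 (L / k)) => [|T x y]; first by rewrite le_max lexx.
rewrite !ge_max => /andP[x1 xL] /andP[y1 yL].
have x0 : 0 < x by lra. have y0 : 0 < y by lra.
have LX : L / x <= k by rewrite ler_pdivrMr// mulrC -ler_pdivrMr.
have ix1 : x^-1 <= 1 by rewrite invf_le1.
have iy1 : y^-1 <= 1 by rewrite invf_le1.
have ix0 : 0 <= x^-1 by rewrite invr_ge0 ltW.
have iy0 : 0 <= y^-1 by rewrite invr_ge0 ltW.
rewrite /T !qT ?gt_eqF//; split.
  rewrite -q0 -(rmorph0 (real_complex R)); apply: (le_trans (qlip _ _ _ _ _ _)) => //.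
  by rewrite subr0 ger0_norm.
apply: (le_trans (qlip _ _ _ _ _ _)) => //.
have -> : x^-1 - y^-1 = x^-1 * y^-1 * (y - x) by field; rewrite !gt_eqF.
rewrite normrM ger0_norm ?mulr_ge0// distrC !mulrA ler_wpM2r//.
apply: (@le_trans _ _ (L / x)) => //.
by rewrite ler_piMr// mulr_ge0.
Qed.

Definition bdlip (f : R -> R[i]) lo hi := exists2 L, 0 <= L & forall x y,
  lo <= x -> x <= hi -> lo <= y -> y <= hi ->
  normc (f x) <= L /\ normc (f x - f y) <= L * `|x - y|.

Lemma locpoly_bdlip E lo hi : locpoly E -> bdlip (fun x => E x%:C) lo hi.
Proof.
move=> LE; pose r := `|lo| + `|hi| + 1.
have r0 : 0 < r by rewrite ltr_pwDr// addr_ge0.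
have [S [S0 HS]] := locpoly_bounded (2 * (2 * r)) LE.
exists (S + 8 / (2 * r) * S) => [|x y x1 x2 y1 y2].
  by rewrite addr_ge0 ?mulr_ge0 ?invr_ge0 ?mulr_ge0 ?(ltW S0) ?(ltW r0).
have bnd (t : R) : lo <= t -> t <= hi -> normc t%:C <= r.
  move=> t1 t2; rewrite nc_real ler_norml /r; have := ler_norm hi; have := ler_norm (- lo).
  rewrite normrN; have := normr_ge0 lo; have := normr_ge0 hi => *; apply/andP; split; lra.
have c0 : 0 <= 8 / (2 * r) * S by rewrite ?mulr_ge0 ?invr_ge0 ?mulr_ge0 ?(ltW S0) ?(ltW r0).
split.
  have := HS x%:C; have := bnd x x1 x2 => bx H.
  apply: (@le_trans _ _ S); [apply: H; lra|lra].
have r20 : 0 < 2 * r by lra.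
have rE : r = 2 * r / 2 by field.
have := @locpoly_lip R E (2 * r) S x%:C y%:C LE r20 HS; rewrite -rE.
move=> /(_ (bnd x x1 x2) (bnd y y1 y2)); rewrite -rmorphB nc_real => H.
by apply: (le_trans H); rewrite ler_wpM2r//; lra.
Qed.

Lemma bdlip_inv (f : R -> R[i]) lo hi (mu : R) : 0 < mu ->
  (forall x, lo <= x -> x <= hi -> mu <= normc (f x)) ->
  bdlip f lo hi -> bdlip (fun x => (f x)^-1) lo hi.
Proof.
move=> mu0 fmu [L L0 H]; exists (mu^-1 + L / mu ^+ 2) => [|x y x1 x2 y1 y2].
  by rewrite addr_ge0 ?invr_ge0 ?divr_ge0 ?sqr_ge0 ?(ltW mu0).
have fx := fmu x x1 x2; have fy := fmu y y1 y2.
have fx0 : f x != 0 by apply/eqP => E; move: fx; rewrite E nc0; lra.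
have fy0 : f y != 0 by apply/eqP => E; move: fy; rewrite E nc0; lra.
have nfx : (normc (f x))^-1 <= mu^-1 by rewrite lef_pV2 ?posrE//; lra.
have nfy : (normc (f y))^-1 <= mu^-1 by rewrite lef_pV2 ?posrE//; lra.
have mi0 : 0 <= mu^-1 by rewrite invr_ge0 ltW.
have [_ H2] := H x y x1 x2 y1 y2.
split; rewrite ?ncV.
  by apply: (le_trans nfx); rewrite lerDl divr_ge0 ?sqr_ge0.
have -> : (f x)^-1 - (f y)^-1 = (f x)^-1 * (f y)^-1 * - (f x - f y).
  by field; rewrite fx0 fy0.
rewrite !ncM ncN !ncV.
apply: (@le_trans _ _ (mu^-1 * mu^-1 * (L * `|x - y|))).
  apply: ler_pM => //; rewrite ?mulr_ge0 ?invr_ge0 ?nc_ge0//.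
  by apply: ler_pM => //; rewrite invr_ge0 nc_ge0.
have -> : mu^-1 * mu^-1 * (L * `|x - y|) = L / mu ^+ 2 * `|x - y| by field; rewrite gt_eqF.
by rewrite ler_wpM2r// lerDr.
Qed.

End Phase.

(** * Sign changes beyond the range of the polynomial *)

Section CountTail.
Context {R : realType}.
Implicit Types (p q : {poly R[i]}) (z w : R[i]) (E F : R[i] -> R[i]).

Lemma alternates_ext (f g : R -> R) lo hi n :
  (forall x, lo <= x -> x <= hi -> f x = g x) -> alternates f lo hi n -> alternates g lo hi n.
Proof.
move=> fg [x [x0 xn xk]]; exists x; split => //.
have xm k m : (k + m <= n)%N -> x k <= x (k + m)%N.
  elim: m => [|m IH]; first by rewrite addn0.
  rewrite addnS => km; apply: le_trans (IH (ltnW km)) _.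
  by apply: ltW; case: (xk (k + m)%N).
have xlo k : (k <= n)%N -> lo <= x k.
  by move=> kn; apply: (le_trans x0); have := xm 0%N k kn; rewrite add0n.
have xhi k : (k <= n)%N -> x k <= hi.
  by move=> kn; apply: le_trans xn; have := xm k (n - k)%N; rewrite subnKC// => /(_ (leqnn _)).
move=> k kn; have [xx ff] := xk k kn; split => //.
have kn' := ltnW kn.
by rewrite -(fg (x k) (xlo k kn') (xhi k kn')) -(fg (x k.+1) (xlo _ kn) (xhi _ kn)).
Qed.

Lemma cis_lip (s t : R) : normc (cis s - cis t) <= 2 * `|s - t|.
Proof.
apply: (le_trans (nc_leD _)); rewrite !cisRE cReB cImB /=.
have := cos_lip s t; have := sin_lip s t; lra.
Qed.

Lemma expi_real (a x : R) : expi a x%:C = cis (a * x).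
Proof.
rewrite /expi /cis; congr expC; apply/eqP.
by rewrite eq_complex /=; apply/andP; split; apply/eqP; ring.
Qed.

Lemma nc_cis (t : R) : normc (cis t) = 1.
Proof. by rewrite nc_expC /= expR0. Qed.

Lemma ReM_real (A : R) z : complex.Re (A%:C * z) = A * complex.Re z.
Proof. by rewrite cReM /= mul0r subr0. Qed.

Variables a d beta : R.
Hypotheses (a0 : 0 < a) (d0 : 0 < d) (b0 : 0 < beta) (b8 : beta <= 1 / 8)
  (bda : 8 * beta * d <= a).

Local Notation ps := (circ d beta).

Let b1 : beta <= 1.
Proof. by apply: (le_trans b8); lra. Qed.

Lemma circ_real (x : R) : ps x%:C = (1 - beta)%:C + beta%:C * cis (d * x).
Proof. by rewrite /circ expi_real. Qed.

Lemma circ_lip (x y : R) : normc (ps x%:C - ps y%:C) <= 2 * beta * d * `|x - y|.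
Proof.
rewrite !circ_real; set u := cis _; set v := cis _.
have -> : (1 - beta)%:C + beta%:C * u - ((1 - beta)%:C + beta%:C * v) = beta%:C * (u - v) by ring.
rewrite ncM nc_real (gtr0_norm b0).
have -> : 2 * beta * d * `|x - y| = beta * (2 * (d * `|x - y|)) by ring.
rewrite ler_wpM2l ?(ltW b0)//; apply: (le_trans (cis_lip _ _)).
by rewrite -mulrBr normrM (gtr0_norm d0).
Qed.

Lemma circ_sub1 (x : R) : normc (ps x%:C - 1) <= 1 / 4.
Proof.
rewrite circ_real; set u := cis _.
have -> : (1 - beta)%:C + beta%:C * u - 1 = beta%:C * (u - 1).
  by rewrite rmorphB rmorph1; ring.
rewrite ncM nc_real (gtr0_norm b0).
have : normc (u - 1) <= 2 by apply: (le_trans (ncB _ _)); rewrite nc1 nc_cis.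
move=> /(ler_wpM2l (ltW b0)) H; apply: (le_trans H); have := b8; lra.
Qed.

Lemma circ_ge (x : R) : 3 / 4 <= normc (ps x%:C).
Proof.
have := circ_sub1 x; set P := ps x%:C; have := ncDl 1 (P - 1).
have -> : 1 + (P - 1) = P by ring.
rewrite nc1; lra.
Qed.

Lemma circ_Re_gt0 (x : R) : 0 < complex.Re (ps x%:C).
Proof.
have := le_trans (Re_le_nc _) (circ_sub1 x).
by rewrite cReB /= ler_norml => /andP[]; lra.
Qed.

(** The curve has Lipschitz constant at most 2 beta d and the argument doubles it; 4 beta d <= a / 2
    is exactly the hypothesis [bda]. At least half of the slope of a x is thus left. *)
Lemma phase_circ_lip (x y : R) :
  `|phase (ps x%:C) - phase (ps y%:C)| <= a / 2 * `|x - y|.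
Proof.
apply: (le_trans (phase_lip (circ_sub1 x) (circ_sub1 y) (circ_lip x y))).
by rewrite mulrA ler_wpM2r//; have := bda; lra.
Qed.

Lemma ang1 : phase (1 : R[i]) = 0.
Proof. by rewrite /phase /= mul0r atan0. Qed.

(** Minus the argument of 1 - beta - i beta. *)
Definition gain : R := atan (beta / (1 - beta)).

Lemma gain_gt0 : 0 < gain.
Proof.
rewrite /gain -atan0; apply: lt_atan; rewrite divr_gt0// subr_gt0.
by apply: (le_lt_trans b8); lra.
Qed.

Definition scale : R := 3 * pi / (2 * d).

Lemma scale_gt0 : 0 < scale.
Proof. by rewrite divr_gt0 ?mulr_gt0// pi_gt0. Qed.

(* At d x = 3 pi / 2 the curve 1 - beta + beta e^{i d x} is on its way back from
   the lower half-plane: this is where the phase is behind its mean value. *)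
Lemma phase_circ_scale : phase (ps scale%:C) = - gain.
Proof.
rewrite circ_real; have -> : d * scale = pi / 2 + pi.
  by rewrite /scale; field; rewrite gt_eqF.
rewrite cisRE cosDpi sinDpi cos_pihalf sin_pihalf oppr0 /phase /= !(mul0r, mulr0, addr0, subr0, add0r).
by rewrite mulrN1 mulNr atanN.
Qed.

Lemma locpoly_circ (N : nat) : locpoly (fun z => ps (z / N%:R)).
Proof.
have -> : (fun z => ps (z / N%:R)) =
    (fun z => ((1 - beta)%:C%:P : {poly R[i]}).[z] + (beta%:C%:P : {poly R[i]}).[z] * expC ((0 +i* d) / N%:R * z)).
  apply/funext => z; rewrite !hornerC /circ /expi.
  by have -> : (0 +i* d) * (z / N%:R) = (0 +i* d) / N%:R * z by ring.
by apply: locpoly_add; [exact: locpoly_poly|apply: locpoly_mul; [exact: locpoly_poly|exact: locpoly_expC]].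
Qed.

(** On [rho, r], E(x) = c x^m circ(x/N)^N S(x), where S is the product of the two errors, that of p
    against its leading term and that of E against the model, and stays near 1. The total phase has
    slope at least a - a/2 - a/4 > 0, so its increment bounds the count. The radius rho depends on p
    alone, while tau may depend on N. *)
Lemma count_tail p : p.[0] = 1 -> exists2 rho, 1 <= rho & forall N : nat, (0 < N)%N ->
  rho <= scale * N%:R -> exists2 tau, 0 < tau & forall E, locpoly E ->
    (forall z, normc z <= 4 * (scale * N%:R) ->
       normc (E z - ps (z / N%:R) ^+ N * p.[z]) <= tau) ->
  forall n, alternates (fun x => complex.Re (expi a x%:C * E x%:C)) rho (scale * N%:R) n ->
  n%:R <= (a * (scale * N%:R) - N%:R * gain) / pi + 2.
Proof.
move=> p0.
have aux_mono (g x y P1 P2 S1 S2 : R) : 0 <= a * (y - x) ->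
    - (a / 2 * (y - x)) <= P2 - P1 -> - (a / 4 * (y - x)) <= S2 - S1 ->
    g + a * x + P1 + S1 <= g + a * y + P2 + S2 by lra.
have aux_k (k : R) : k <= a / 16 -> 2 * 2 * k <= a / 4 by lra.
have aux_pi (u q : R) : 0 < q -> u / q + 2 = (u + q) / q + 1.
  by move=> q0; field; rewrite gt_eqF.
have pn0 : p != 0 by apply/eqP => E; move: p0; rewrite E horner0 => /esym/eqP; rewrite oner_eq0.
(* S will lie within 2 k of 1 with Lipschitz constant 2 k: k <= 1/16 keeps it in the disc where
   [phase_lip] applies, and k <= a/16 gives its phase a slope of at most 4 k <= a/4. *)
pose k : R := Num.min (1 / 16) (a / 16).
have a0' := a0.
have k0 : 0 < k by rewrite lt_min; apply/andP; split; lra.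
have k1 : k <= 1 / 16 by rewrite ge_min lexx.
have ka : k <= a / 16 by rewrite ge_min lexx orbT.
clearbody k.
have [rho rho1 HT] := poly_at_infinity pn0 k0.
exists rho => // N N0; set r := scale * N%:R => rr.
have rE : r = scale * N%:R by [].
clearbody r.
have r1 : 1 <= r by exact: le_trans rr.
set m := (size p).-1 in HT; set c := lead_coef p in HT.
have c0 : c != 0 by rewrite lead_coef_eq0.
clearbody m c.
have nc : 0 < normc c by apply: nc_gt0.
have N0' : 0 < N%:R :> R by rewrite ltr0n.
have xN (x : R) : x%:C / N%:R = (x / N%:R)%:C.
  by rewrite -(rmorph_nat (real_complex R)) -fmorphV -rmorphM.
pose G z : R[i] := c * z ^+ m * ps (z / N%:R) ^+ N.
have LG : locpoly G.
  apply: locpoly_mul; last by apply: locpoly_exprn; exact: locpoly_circ.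
  have -> : (fun z => c * z ^+ m) = (fun z => (c%:P * 'X^m).[z]).
    by apply/funext => z; rewrite hornerM hornerC hornerXn.
  exact: locpoly_poly.
pose mu := normc c * (3 / 4) ^+ N.
have mu0 : 0 < mu by rewrite mulr_gt0// exprn_gt0// divr_gt0.
have Gmu x : rho <= x -> x <= r -> mu <= normc (G x%:C).
  move=> x1 _; rewrite /G (ncM (c * _)) (ncM c) !ncX nc_real xN.
  have x0 : 1 <= x by exact: le_trans x1.
  rewrite ger0_norm; last by lra.
  apply: ler_pM; rewrite ?(ltW nc)//.
  - by rewrite ler_peMr ?(ltW nc)// exprn_ege1.
  - by rewrite lerXn2r ?nnegrE ?circ_ge ?nc_ge0// divr_ge0.
have [L L0 HL] := bdlip_inv mu0 Gmu (locpoly_bdlip rho r LG).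
(* L bounds both 1/G and its Lipschitz constant. Cauchy's estimate gives the error e a Lipschitz
   constant of 4 tau, so e / G has one of at most tau L + 4 tau L = 5 tau L. *)
pose tau := k / (5 * L + 1).
have tau0 : 0 < tau by rewrite divr_gt0//; lra.
have tauL : tau * (5 * L + 1) = k by rewrite /tau divfK// gt_eqF//; lra.
clearbody tau mu.
exists tau => // E LE HE n.
pose e z := E z - ps (z / N%:R) ^+ N * p.[z].
have Le : locpoly e.
  apply: locpoly_add => //; apply: locpoly_opp; apply: locpoly_mul; last exact: locpoly_poly.
  by apply: locpoly_exprn; exact: locpoly_circ.
have e_small (x : R) : rho <= x -> x <= r -> normc (e x%:C) <= tau.
  by move=> x1 x2; apply: HE; rewrite nc_real ger0_norm; lra.
have e_lip (x y : R) : rho <= x -> x <= r -> rho <= y -> y <= r ->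
    normc (e x%:C - e y%:C) <= 4 * tau * `|x - y|.
  move=> x1 x2 y1 y2; have r2 : 0 < 2 * r by lra.
  have HE2 z : normc z <= 2 * (2 * r) -> normc (e z) <= tau by move=> zr; apply: HE; lra.
  have := @locpoly_lip R e (2 * r) tau x%:C y%:C Le r2 HE2.
  have x0 : 0 <= x by lra.
  have y0 : 0 <= y by lra.
  rewrite -rmorphB !nc_real (ger0_norm x0) (ger0_norm y0).
  have xr : x <= 2 * r / 2 by lra.
  have yr : y <= 2 * r / 2 by lra.
  move=> /(_ xr yr) H; apply: (le_trans H); rewrite ler_wpM2r// ler_wpM2r ?(ltW tau0)//.
  by rewrite ler_pdivrMr//; lra.
pose T (x : R) := p.[x%:C] / (c * x%:C ^+ m).
pose K (x : R) := (G x%:C)^-1.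
pose S (x : R) := E x%:C * K x.
have psi0 (x : R) : ps (x%:C / N%:R) != 0.
  by rewrite xN; apply/eqP => H; have := circ_ge (x / N%:R); rewrite H nc0; lra.
have SE (x : R) : rho <= x -> S x = T x + e x%:C * K x.
  move=> x1; have xC0 : x%:C != 0 :> R[i] by rewrite fmorph_eq0 gt_eqF//; lra.
  rewrite /S /e /T /K /G; set P := ps _ ^+ N; set X := x%:C ^+ m.
  have P0 : P != 0 by rewrite expf_neq0.
  have X0 : X != 0 by rewrite expf_neq0.
  by field; rewrite P0 c0 X0.
have ES (x : R) : rho <= x -> x <= r -> E x%:C = G x%:C * S x.
  move=> x1 x2; rewrite /S /K mulrCA mulfV ?mulr1//.
  by apply/eqP => H; have := Gmu x x1 x2; rewrite H nc0; lra.
have {}HL : forall x y, rho <= x -> x <= r -> rho <= y -> y <= r ->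
  normc (K x) <= L /\ normc (K x - K y) <= L * `|x - y| := HL.
have idK : forall u v s t : R[i], u * s - v * t = u * (s - t) + (u - v) * t.
  by move=> *; ring.
clearbody e K S.
have eK x y : rho <= x -> x <= r -> rho <= y -> y <= r ->
    normc (e x%:C * K x) <= k /\ normc (e x%:C * K x - e y%:C * K y) <= k * `|x - y|.
  move=> x1 x2 y1 y2; have [KL KK] := HL x y x1 x2 y1 y2.
  have [KyL _] := HL y y y1 y2 y1 y2.
  have ex := e_small x x1 x2; have ee := e_lip x y x1 x2 y1 y2.
  split.
    rewrite (ncM (e _)); apply: (@le_trans _ _ (tau * L)); first by apply: ler_pM; rewrite ?nc_ge0.
    by rewrite -tauL ler_wpM2l ?(ltW tau0)//; lra.
  rewrite idK; apply: (le_trans (ncD _ _)); rewrite (ncM (e _)) (ncM (e _ - e _)).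
  have h1 : normc (e x%:C) * normc (K x - K y) <= tau * (L * `|x - y|).
    by apply: ler_pM; rewrite ?nc_ge0.
  have h2 : normc (e x%:C - e y%:C) * normc (K y) <= 4 * tau * `|x - y| * L.
    by apply: ler_pM; rewrite ?nc_ge0.
  have h3 : 0 <= tau * `|x - y| by rewrite mulr_ge0// ltW.
  have h4 : k * `|x - y| = 5 * (tau * `|x - y| * L) + tau * `|x - y| by rewrite -tauL; ring.
  rewrite h4; apply: (le_trans (lerD h1 h2)).
  have -> : tau * (L * `|x - y|) + 4 * tau * `|x - y| * L = 5 * (tau * `|x - y| * L) by ring.
  by rewrite lerDl.
have S1 x : rho <= x -> x <= r -> normc (S x - 1) <= 2 * k.
  move=> x1 x2; rewrite SE//; have [h1 _] := eK x x x1 x2 x1 x2.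
  have [h2 _] := HT x x x1 x1; rewrite -/(T x) in h2.
  rewrite addrAC; apply: (le_trans (ncD _ _)); lra.
have S2 x y : rho <= x -> x <= r -> rho <= y -> y <= r -> normc (S x - S y) <= 2 * k * `|x - y|.
  move=> x1 x2 y1 y2; rewrite !SE//; have [_ h1] := eK x y x1 x2 y1 y2.
  have [_ h2] := HT x y x1 y1; rewrite -/(T x) -/(T y) in h2.
  rewrite opprD addrACA; apply: (le_trans (ncD _ _)); lra.
have S4 x : rho <= x -> x <= r -> normc (S x - 1) <= 1 / 4.
  by move=> x1 x2; have := S1 x x1 x2; lra.
have [g cg] := polar_ex c0.
pose Psi (x : R) := g + a * x + N%:R * phase (ps (x / N%:R)%:C) + phase (S x).
pose A (x : R) := normc c * x ^+ m * normc (ps (x / N%:R)%:C) ^+ N * normc (S x).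
have SRe x : rho <= x -> x <= r -> 0 < complex.Re (S x).
  move=> x1 x2; have := le_trans (Re_le_nc _) (S4 x x1 x2).
  by rewrite cReB /= ler_norml => /andP[]; lra.
have fE (x : R) : rho <= x -> x <= r ->
    complex.Re (expi a x%:C * E x%:C) = A x * cos (Psi x).
  move=> x1 x2; rewrite ES// expi_real /G xN.
  rewrite (polar_phase (SRe x x1 x2)) {1}cg {1}(polar_phase (circ_Re_gt0 (x / N%:R))).
  have -> : Psi x = a * x + (g + (N%:R * phase (ps (x / N%:R)%:C) + phase (S x))) by rewrite /Psi; ring.
  set C1 := cis (a * x); set u := phase (ps _); set v := phase (S x).
  have -> : cos (a * x + (g + (N%:R * u + v))) = complex.Re (C1 * (cis g * (cis u ^+ N * cis v))).
    by rewrite /C1 -cis_natM -!cisRD cisRE.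
  rewrite -ReM_real; congr (complex.Re _).
  set C2 := cis g; set C3 := cis u; set C4 := cis v.
  have -> : (A x)%:C = (normc c)%:C * x%:C ^+ m * (normc (ps (x / N%:R)%:C))%:C ^+ N * (normc (S x))%:C.
    by rewrite /A !rmorphM !rmorphXn.
  by rewrite (exprMn _ _ C3); ring.
move=> /(alternates_ext fE) Hn.
have A0 x : rho <= x -> x <= r -> 0 < A x.
  move=> x1 x2; have x0 : 0 < x by lra.
  rewrite /A !mulr_gt0 ?exprn_gt0//.
    by apply: lt_le_trans (circ_ge _); lra.
  by apply: lt_le_trans (SRe x x1 x2) _; apply: le_trans (Re_le_nc _); exact: ler_norm.
have uN (x y : R) : `|N%:R * phase (ps (x / N%:R)%:C) - N%:R * phase (ps (y / N%:R)%:C)| <= a / 2 * `|x - y|.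
  rewrite -mulrBr normrM (gtr0_norm N0').
  apply: (le_trans (ler_wpM2l (ltW N0') (phase_circ_lip _ _))).
  rewrite -mulrBl normrM [`|_^-1|]ger0_norm ?invr_ge0 ?(ltW N0')//.
  by rewrite le_eqVlt; apply/orP; left; apply/eqP; field; rewrite gt_eqF.
have mono x y : rho <= x -> x <= y -> y <= r -> Psi x <= Psi y.
  move=> x1 xy y2; have x2 : x <= r by exact: le_trans y2.
  have y1 : rho <= y by exact: le_trans xy.
  have h1 := uN y x; have h2 := phase_lip (S4 y y1 y2) (S4 x x1 x2) (S2 y x y1 y2 x1 x2).
  have yx : `|y - x| = y - x by rewrite ger0_norm// subr_ge0.
  rewrite yx in h1 h2.
  have h3 : 2 * (2 * k * (y - x)) <= a / 4 * (y - x).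
    by rewrite !mulrA; apply: ler_wpM2r; [rewrite subr_ge0|exact: aux_k].
  have h4 : 0 <= a * (y - x) by rewrite mulr_ge0 ?(ltW a0)// subr_ge0.
  move: h1; rewrite ler_norml => /andP[h1 _].
  move: (le_trans h2 h3); rewrite ler_norml => /andP[{}h2 _].
  exact: aux_mono.
have := alternates_cos A0 mono Hn => H; apply: (le_trans H).
have p0' := pi_gt0 R.
have -> : (a * r - N%:R * gain) / pi + 2 = (a * r - N%:R * gain + pi) / pi + 1.
  exact: aux_pi.
rewrite lerD2r ler_wpM2r ?invr_ge0 ?(ltW p0')//.
have rhor : rho <= rho := lexx rho.
have q0 : phase (ps 0%:C) = 0.
  by rewrite circ_real mulr0 cisRE cos0 sin0 (_ : 1 +i* 0 = 1 :> R[i])// mulr1 -rmorphD /= subrK ang1.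
have h1 : `|N%:R * phase (ps (rho / N%:R)%:C)| <= a / 2 * rho.
  by have := uN rho 0; rewrite mul0r q0 mulr0 !subr0 [`|rho|]ger0_norm; lra.
have h2 : phase (ps (r / N%:R)%:C) = - gain.
  by rewrite rE mulfK ?gt_eqF// phase_circ_scale.
(* The phase of S is at most 1/2 in absolute value at either end, in total at most 1 <= pi, which
   turns the + 1 of [alternates_cos] into + 2. At rho the phase of the power is at least - a rho /
   2, which the term a rho outweighs. *)
have one4 : normc ((1 : R[i]) - 1) <= 1 / 4 by rewrite subrr nc0; lra.
have h3 := phase_lip (S4 r rr (lexx r)) one4 (S4 r rr (lexx r)).
have h4 := phase_lip (S4 rho rhor rr) one4 (S4 rho rhor rr).
rewrite ang1 !subr0 in h3 h4.
have pi1 : 1 <= pi :> R by have := pi_ge2 R; lra.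
move: h1 h3 h4; rewrite !ler_norml => /andP[h11 h12] /andP[h31 h32] /andP[h41 h42].
rewrite /Psi h2.
have h5 : 0 <= a * rho by rewrite mulr_ge0 ?(ltW a0)//; lra.
lra.
Qed.

End CountTail.

(** * The inductive step and the limit function *)

Section Construction.
Context {R : realType}.
Implicit Types (p q h : {poly R[i]}) (z w : R[i]) (E F : R[i] -> R[i]).

Variables a d beta : R.
Hypotheses (a0 : 0 < a) (d0 : 0 < d) (b0 : 0 < beta) (b8 : beta <= 1 / 8)
  (bda : 8 * beta * d <= a).

Local Notation ps := (circ d beta).

(* On [0, scale * N] the argument of e^{i a x} circ(x / N)^N increases from 0 to
   a * scale * N - N * gain; half of the resulting gain absorbs bounded errors. *)
Definition rate : R := (a - gain beta / (2 * scale d)) / pi.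

Definition good_radius E r := forall n,
  alternates (fun x => complex.Re (expi a x%:C * E x%:C)) 0 r n -> n%:R <= rate * r.

(** The order of the choices is what matters: p fixes rho and the count B on [0, rho]; then N is
    chosen so large that half of the lag absorbs all constants; N fixes r and tau; the last errors
    are taken small against tau. The conclusion about r is for every E near h', so that it can be
    applied to a limit that is not yet known. *)
Lemma next_polynomial (k : nat) h (ka : R) : 0 < ka -> h.[0] = 1 ->
  exists h' ka', [/\ h'.[0] = 1, 0 < ka' <= ka / 2,
    approx d (fun z => h.[z]) (fun z => h'.[z]) k.+1%:R^-1 ka &
    exists r, [/\ k%:R <= r, 0 < r & forall E, locpoly E -> E 0 = 1 ->
      (forall z, normc (E z - h'.[z]) <= 2 * ka' * expR ((1 + d) * normc z)) ->
      (forall z, normc (E z) <= 1 + expR ((1 + d) * normc z)) -> good_radius E r]].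
Proof.
move=> ka0 h0.
have aux_rate (u v s x q : R) : 0 < s -> 0 < q ->
    (u - v / (2 * s)) / q * (s * x) = (u * (s * x) - x * v / 2) / q.
  by move=> s0 q0; field; rewrite !gt_eqF.
have aux_X (u v q : R) : 0 < q -> (u - v / 2) / q = (u - v) / q + v / (2 * q).
  by move=> q0; field; rewrite gt_eqF.
set l := k.+1%:R^-1 : R.
have l0 : 0 < l by rewrite invr_gt0.
have l1 : l <= 1 by rewrite invf_le1// ler1n.
have b1 : beta <= 1 by apply: (le_trans b8); lra.
have bd0 : 0 <= beta * d by rewrite mulr_ge0 ?(ltW b0) ?(ltW d0).
have bdd : beta * d <= d by rewrite ler_piMl ?(ltW d0).
have k3 : 0 < ka / 3 by rewrite divr_gt0.
have [p p0 Hp] := shift_freq h l0 (lexx 0) (ltW d0) bd0 bdd k3.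
rewrite h0 in p0.
have [rho rho1 Hrho] := count_tail a0 d0 b0 b8 bda p0.
have [N0 HN0] := circ_conv d0 (ltW b0) b1 p l0 k3.
(* S bounds e^{iaz} E(z) on |z| <= 6 rho from the crude growth of E alone, hence independently of N;
   then n <= 2^n <= 4 (S + 1) = B by [alternates_bound]. *)
pose S := expR (a * (6 * rho)) * (1 + expR ((1 + d) * (6 * rho))).
pose B := 4 * (S + 1).
have sc0 := scale_gt0 d0; have g0 := gain_gt0 b0 b8; have pi0 := pi_gt0 R.
set s := scale d in sc0 Hrho *; set g := gain beta in g0 Hrho *.
have S0 : 0 <= S by rewrite mulr_ge0 ?expR_ge0// addr_ge0 ?expR_ge0.
have B0 : 0 <= B by rewrite /B; lra.
(* The three terms force rho <= r, k <= r and B + 3 <= N g / (2 pi). Here 3 is the 2 of [count_tail]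
   plus the 1 lost when the interval is split at rho. *)
pose M := rho / s + k%:R / s + (B + 3) * (2 * pi) / g.
have m1 : 0 <= rho / s by rewrite divr_ge0 ?(ltW sc0)//; lra.
have m2 : 0 <= k%:R / s by rewrite divr_ge0 ?(ltW sc0).
have m3 : 0 <= (B + 3) * (2 * pi) / g.
  by rewrite divr_ge0 ?(ltW g0)// mulr_ge0 ?mulr_ge0 ?(ltW pi0)//; lra.
pose N := maxn N0 (Num.truncn M).+1.
have NN0 : (N0 <= N)%N by rewrite leq_maxl.
have Npos : (0 < N)%N by rewrite leq_max orbT.
have MN : M <= N%:R.
  apply: (le_trans (ltW (truncnS_gt M))); rewrite ler_nat; exact: leq_maxr.
have Nr : rho <= s * N%:R by rewrite mulrC -ler_pdivrMr//; apply: le_trans MN; rewrite /M; lra.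
have Nk : k%:R <= s * N%:R by rewrite mulrC -ler_pdivrMr//; apply: le_trans MN; rewrite /M; lra.
have NB : (B + 3) * (2 * pi) <= N%:R * g by rewrite -ler_pdivrMr//; apply: le_trans MN; rewrite /M; lra.
set r := s * N%:R in Nr Nk *.
have r1 : 1 <= r by exact: le_trans Nr.
have [tau tau0 Htau] := Hrho N Npos Nr.
have Hconv := HN0 N NN0 Npos.
(* W bounds all weights on the disc |z| <= 4 r of [count_tail]. The two errors, from the model to h'
   and from h' to E, then get tau / 2 each. *)
pose W := expR ((1 + d) * (4 * r)).
have W0 : 0 < W := expR_gt0 _.
pose eta := Num.min (ka / 3) (tau / (2 * W)).
have eta0 : 0 < eta by rewrite lt_min k3 divr_gt0// mulr_gt0.
have [h' h'0 Hh'] := circ_down d0 beta p l0 eta0 Npos.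
pose ka' := Num.min (ka / 2) (tau / (4 * W)).
have ka'0 : 0 < ka' by rewrite lt_min !divr_gt0// mulr_gt0.
exists h', ka'; split.
- by rewrite h'0.
- by rewrite ka'0 ge_min lexx.
- have e1 : eta <= ka / 3 by rewrite ge_min lexx.
  have A1 := approx_trans (approx_trans Hp Hconv) Hh'.
  move=> z; have := A1 z; rewrite expi0 mul1r => H; apply: (le_trans H).
  by rewrite ler_wpM2r ?expR_ge0//; lra.
exists r; split => //; first by lra.
move=> E LE E0 Eh ES n altE.
have rho0 : 0 <= rho by lra.
have [n1 [n2 [n12 alt1 alt2]]] := alternates_split rho0 Nr altE.
have Wz z : normc z <= 4 * r -> expR ((1 + d) * normc z) <= W.
  by move=> zr; rewrite ler_expR ler_wpM2l//; have := d0; lra.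
have n2b : n2%:R <= (a * r - N%:R * g) / pi + 2.
  apply: (Htau E) => // z zr.
  have A1 := Hh' z; have A2 := Eh z; have A3 := Wz z zr.
  have A4 : expR (l * normc z + d * lower_im z) <= W.
    apply: le_trans A3; rewrite ler_expR mulrDl mul1r lerD//.
      by rewrite ler_piMl ?nc_ge0.
    by rewrite ler_wpM2l ?(ltW d0)// lower_im_le.
  have A5 : eta * expR (l * normc z + d * lower_im z) <= tau / 2.
    apply: (@le_trans _ _ (tau / (2 * W) * W)).
      apply: ler_pM => //; rewrite ?(ltW eta0) ?expR_ge0//.
      by rewrite ge_min lexx orbT.
    by rewrite le_eqVlt; apply/orP; left; apply/eqP; field; rewrite gt_eqF.
  have A6 : 2 * ka' * expR ((1 + d) * normc z) <= tau / 2.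
    apply: (@le_trans _ _ (2 * (tau / (4 * W)) * W)).
      apply: ler_pM => //; rewrite ?mulr_ge0 ?(ltW ka'0) ?expR_ge0//.
      by rewrite ler_wpM2l// ge_min lexx orbT.
    by rewrite le_eqVlt; apply/orP; left; apply/eqP; field; rewrite gt_eqF.
  rewrite ncBC in A1.
  by apply: (le_trans (le_nc_distD h'.[z] _ _)); lra.
have n1b : n1%:R <= B.
  pose F z := expi a z * E z.
  have LF : locpoly F by apply: locpoly_mul => //; exact: locpoly_expC.
  have F0 : F 0 = 1 by rewrite /F expi_0 E0 mulr1.
  have FS z : normc z <= 6 * rho -> normc (F z) <= S.
    move=> zr; rewrite (ncM (expi a z) (E z)) /S.
    apply: ler_pM; rewrite ?nc_ge0//.
      rewrite nc_expi ler_expR mulNr -mulrN; apply: ler_wpM2l; first exact: ltW.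
      apply: le_trans zr; apply: le_trans (Im_le_nc z); rewrite -normrN; exact: ler_norm.
    apply: (le_trans (ES z)); rewrite lerD2l ler_expR ler_wpM2l//.
    by have := d0; lra.
  have := alternates_bound LF (lt_le_trans ltr01 rho1) F0 FS alt1.
  apply: le_trans; rewrite -natrX ler_nat; apply: ltnW; exact: ltn_expl.
have rE : rate * r = (a * r - N%:R * g / 2) / pi.
  exact: aux_rate.
have nn : n%:R <= n1%:R + n2%:R + 1 :> R by rewrite -!natrD -[1]/(1%:R) -natrD ler_nat.
apply: (le_trans nn).
rewrite rE.
have X : (a * r - N%:R * g / 2) / pi = (a * r - N%:R * g) / pi + N%:R * g / (2 * pi).
  exact: aux_X.
rewrite X.
have Y : B + 3 <= N%:R * g / (2 * pi) by rewrite ler_pdivlMr// mulr_gt0.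
lra.
Qed.

(** Each state carries a polynomial and an error allowance. Since the allowances at least halve, all
    errors after stage k sum to at most twice the k-th one, which is the distance to h' allowed in
    [next_polynomial]; so the limit inherits every radius. *)
Lemma construction : exists (h : R[i] -> R[i]) (hp : nat -> {poly R[i]}),
  [/\ forall k z, normc (h z - (hp k).[z]) <=
        1 / 4 * 2^-1 ^+ k * expR (k.+1%:R^-1 * normc z + d * lower_im z),
      locpoly h, h 0 = 1, hp 0%N = 1 &
      forall k : nat, exists r, [/\ k%:R <= r, 0 < r & good_radius h r]].
Proof.
pose state := {s : {poly R[i]} * R | (0 < s.2) && (s.1.[0] == 1)}.
pose rel (k : nat) (s s' : state) :=
  [/\ (val s').2 <= (val s).2 / 2,
    approx d (fun z => (val s).1.[z]) (fun z => (val s').1.[z]) k.+1%:R^-1 (val s).2 &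
    exists r, [/\ k%:R <= r, 0 < r & forall E, locpoly E -> E 0 = 1 ->
      (forall z, normc (E z - (val s').1.[z]) <= 2 * (val s').2 * expR ((1 + d) * normc z)) ->
      (forall z, normc (E z) <= 1 + expR ((1 + d) * normc z)) -> good_radius E r]].
have ex k s : exists s', rel k s s'.
  case: s => -[h ka] /= hka; have /andP[ka0 /eqP h0] := hka.
  have [h' [ka' [h'0 /andP[ka'0 ka'k] A B]]] := next_polynomial k ka0 h0.
  have P : (0 < (h', ka').2) && ((h', ka').1.[0] == 1) by rewrite /= ka'0 h'0 eqxx.
  by exists (exist _ (h', ka') P).
pose f k s := projT1 (cid (ex k s)).
have Hf k s : rel k s (f k s) := projT2 (cid (ex k s)).
have P0 : (0 < ((1 : {poly R[i]}), (1 / 8 : R)).2) && (((1 : {poly R[i]}), (1 / 8 : R)).1.[0] == 1).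
  by rewrite /= hornerC eqxx andbT divr_gt0.
pose st := fix st (k : nat) : state := if k is k'.+1 then f k' (st k') else exist _ (1, 1 / 8) P0.
pose hp k := (val (st k)).1; pose ka k := (val (st k)).2.
have H k : rel k (st k) (st k.+1) by exact: Hf.
have hp0 k : (hp k).[0] = 1 by have /andP[_ /eqP] := valP (st k).
have ka0 k : 0 < ka k by have /andP[] := valP (st k).
have kaS k : ka k.+1 <= ka k / 2 by case: (H k).
have ka_le k : ka k <= 1 / 8 * 2^-1 ^+ k.
  elim: k => [|k IH]; first by rewrite expr0 mulr1.
  by apply: (le_trans (kaS k)); rewrite exprS; move: IH; set q := _ ^+ k; lra.
have apxS k : approx d (fun z => (hp k).[z]) (fun z => (hp k.+1).[z]) k.+1%:R^-1 (ka k).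
  by case: (H k).
pose X (k : nat) z : R := expR (k.+1%:R^-1 * normc z + d * lower_im z).
have Xmono k m z : X (k + m)%N z <= X k z.
  rewrite ler_expR lerD2r ler_wpM2r ?nc_ge0// lef_pV2 ?posrE//.
  by rewrite ler_nat ltnS leq_addr.
have X0 k z : 0 <= X k z := expR_ge0 _.
have ym0 z := lower_im_ge0 z; have z0 (z : R[i]) := nc_ge0 z.
(* The telescoping form of the bound: halving gives ka j <= 2 ka j - 2 ka (j+1), and the weights
   decrease with the index. *)
have far k m z : normc ((hp (k + m)%N).[z] - (hp k).[z]) <= (2 * ka k - 2 * ka (k + m)%N) * X k z.
  elim: m => [|m IH]; first by rewrite addn0 !subrr nc0 mul0r.
  rewrite addnS; apply: (le_trans (le_nc_distD (hp (k + m)%N).[z] _ _)).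
  have A := apxS (k + m)%N z; rewrite ncBC in A; rewrite -/(X _ z) in A.
  have A2 : ka (k + m)%N * X (k + m)%N z <= ka (k + m)%N * X k z.
    by rewrite ler_wpM2l ?(ltW (ka0 _))// Xmono.
  have A3 : 2 * ka (k + m).+1 * X k z <= ka (k + m)%N * X k z.
    by rewrite ler_wpM2r// ; have := kaS (k + m)%N; lra.
  lra.
have lim z : exists l, forall n, normc ((hp n).[z] - l) <= 4 * (1 / 8 * X 0%N z) * 2^-1 ^+ n.
  apply: complex_geo_lim => n; rewrite ncBC; apply: (le_trans (apxS n z)).
  rewrite -/(X n z) mulrAC; apply: ler_pM; rewrite ?(ltW (ka0 _))//.
  by have := Xmono 0%N n z; rewrite add0n.
pose h z := projT1 (cid (lim z)).
have Hh z n : normc ((hp n).[z] - h z) <= 4 * (1 / 8 * X 0%N z) * 2^-1 ^+ n := projT2 (cid (lim z)) n.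
have near k z : normc (h z - (hp k).[z]) <= 2 * ka k * X k z.
  apply: (@ler_small _ _ _ 1) => // e e0 _.
  have [m Hm] := exists_half_pow (4 * (1 / 8 * X 0%N z)) e0.
  have C1 := Hh z (k + m)%N; rewrite ncBC in C1.
  have C2 : 4 * (1 / 8 * X 0%N z) * 2^-1 ^+ (k + m)%N <= e.
    apply: le_trans Hm; rewrite ler_wpM2l ?mulr_ge0// exprD ler_piMl ?exprn_ge0//.
    by rewrite exprn_ile1// invf_le1// ler1n.
  have C3 := far k m z.
  have C4 : (2 * ka k - 2 * ka (k + m)%N) * X k z <= 2 * ka k * X k z.
    by rewrite ler_wpM2r//; have := ka0 (k + m)%N; lra.
  apply: (le_trans (le_nc_distD (hp (k + m)%N).[z] _ _)); lra.
have near2 k z : normc (h z - (hp k).[z]) <= 1 / 4 * 2^-1 ^+ k * X k z.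
  by apply: (le_trans (near k z)); rewrite ler_wpM2r//; have := ka_le k; lra.
have Xd k z : X k z <= expR ((1 + d) * normc z).
  rewrite ler_expR mulrDl; apply: lerD.
    by rewrite ler_wpM2r// invf_le1// ler1n.
  by rewrite ler_wpM2l ?(ltW d0)// lower_im_le.
have h0 : h 0 = 1.
  apply/eqP; rewrite -subr_eq0; apply/eqP/nc_eq0/eqP; rewrite eq_le nc_ge0 andbT.
  apply: (@ler_small _ _ _ 1) => // e e0 _.
  have [m Hm] := exists_half_pow (1 / 4 * X 0%N 0) e0.
  rewrite -(hp0 m); apply: (le_trans (near2 m 0)).
  have -> : 0 + 1 * e = e by ring.
  apply: le_trans Hm; rewrite mulrAC ler_wpM2r ?exprn_ge0// ler_wpM2l//.
  by have := Xmono 0%N m 0; rewrite add0n.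
have Lh : locpoly h.
  apply: locpoly_lim => r e e0; pose Y := expR ((1 + d) * r).
  have [m Hm] := exists_half_pow (1 / 4 * Y) e0.
  exists (fun z => (hp m).[z]); split; first exact: locpoly_poly.
  move=> z zr; apply: (le_trans (near2 m z)); apply: le_trans Hm.
  rewrite mulrAC ler_wpM2r ?exprn_ge0// ler_wpM2l//.
  apply: (le_trans (Xd m z)); rewrite ler_expR ler_wpM2l//.
  by rewrite addr_ge0// ltW.
exists h, hp; split => //.
move=> k; have [_ _ [r [kr r0 Hr]]] := H k.
exists r; split => //; apply: Hr => // z.
  apply: (le_trans (near k.+1 z)); apply: ler_wpM2l => //.
  by rewrite mulr_ge0// ltW.
have := near2 0%N z; rewrite expr0 mulr1 => N0.
have -> : h z = 1 + (h z - (hp 0%N).[z]) by rewrite /hp /= hornerC addrC subrK.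
apply: (le_trans (ncD _ _)); rewrite nc1 lerD2l; apply: (le_trans N0).
by apply: le_trans (Xd 0%N z); have := X0 0%N z; lra.
Qed.

End Construction.

(** * Integrals over half-lines of exponentially decaying functions *)

Section RealIntegrals.
Import measurable_realfun.
Context {R : realType}.
Implicit Types (f g Phi : R -> R) (K k : R).

Local Notation mu := (@lebesgue_measure R).

Lemma expR_decay_cvg0 k K : 0 < k -> K * expR (- (k * s)) @[s --> +oo] --> (0 : R).
Proof.
move=> k0; rewrite -[X in _ --> X](mulr0 K); apply: cvgMr.
apply/cvgrPdist_le => e e0; near=> s.
have s0 : 0 < s by near: s; exact: nbhs_pinfty_gt.
rewrite sub0r normrN ger0_norm ?expR_ge0// expRN.
have h : 1 + k * s <= expR (k * s) := expR_ge1Dx _.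
have ks : 0 < k * s by rewrite mulr_gt0.
rewrite -(invrK e) lef_pV2 ?posrE ?invr_gt0 ?expR_gt0//.
apply: le_trans h; apply: (@le_trans _ _ (k * s)); last by rewrite lerDr.
rewrite mulrC -ler_pdivrMr//.
Unshelve. all: by end_near. Qed.

Lemma expR_decay_continuous k K : continuous (fun s : R => K * expR (- (k * s))).
Proof.
move=> s; apply: cvgMr; apply: continuous_comp; last exact: continuous_expR.
apply: cvgN; apply: cvgMr; exact: cvg_id.
Qed.

Lemma expR_decay_is_derive k K (s : R) : 0 < k ->
  is_derive s 1 (fun s : R => - (K / k) * expR (- (k * s))) (K * expR (- (k * s))).
Proof.
move=> k0.
have H1 : is_derive s 1 (fun s : R => - (k * s)) (- (k * 1)).
  by apply: is_deriveN; apply: is_deriveZ.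
have H2 := @is_derive1_comp R expR (fun s => - (k * s)) s _ _ (is_derive_expR _) H1.
have H3 : is_derive s 1 (fun s : R => - (K / k) * expR (- (k * s)))
    (- (K / k) * (expR (- (k * s)) * - (k * 1))) by exact: is_deriveZ.
by apply: is_derive_eq; field; rewrite gt_eqF.
Qed.

Lemma is_derive_continuous f (df : R -> R) :
  (forall s, is_derive (s : R) 1 f (df s)) -> continuous f.
Proof.
move=> H s; apply: differentiable_continuous; apply/derivable1_diffP.
exact: (@ex_derive _ _ _ _ _ _ _ (H s)).
Qed.

Lemma ge0_FTCy f Phi (l : R) :
  (forall s, 0 <= s -> 0 <= f s) -> continuous f ->
  (forall s, is_derive (s : R) 1 Phi (f s)) ->
  Phi s @[s --> +oo] --> l ->
  (\int[mu]_(x in `[0%R, +oo[) (f x)%:E = (l - Phi 0)%:E)%E.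
Proof.
move=> f0 cf dP Pl; rewrite EFinB; apply: ge0_continuous_FTC2y => //.
- exact: continuous_subspaceT.
- by apply: cvg_at_right_filter; exact: (is_derive_continuous dP).
- by move=> s _; rewrite derive1E; case: (dP s).
Qed.

Lemma integral_expR_decay k K : 0 < k -> 0 <= K ->
  (\int[mu]_(x in `[0%R, +oo[) (K * expR (- (k * x)))%:E = (K / k)%:E)%E.
Proof.
move=> k0 K0.
have -> : K / k = 0 - - (K / k) * expR (- (k * 0)).
  by rewrite mulr0 oppr0 expR0 mulr1 sub0r opprK.
apply: (@ge0_FTCy _ (fun s => - (K / k) * expR (- (k * s)))).
- by move=> s _; rewrite mulr_ge0 ?expR_ge0.
- exact: expR_decay_continuous.
- by move=> s; exact: expR_decay_is_derive.
- exact: expR_decay_cvg0.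
Qed.

Lemma mitv (i : interval R) : measurable ([set` i] : set (measurableTypeR R)).
Proof. exact: measurable_itv. Qed.

Lemma continuous_mfun f (D : set R) : measurable D -> continuous f ->
  measurable_fun D (EFin \o f).
Proof.
move=> mD cf; apply/measurable_EFinP.
apply: (measurable_funS measurableT) => //.
exact: continuous_measurable_fun.
Qed.

Lemma integrable_expR_decay k K : 0 < k -> 0 <= K ->
  mu.-integrable `[0%R, +oo[ (EFin \o (fun x => K * expR (- (k * x)))).
Proof.
move=> k0 K0; apply/integrableP; split.
  by apply: continuous_mfun => //; exact: expR_decay_continuous.
under eq_integral => x _ do rewrite /= ger0_norm ?mulr_ge0 ?expR_ge0//.
by rewrite integral_expR_decay// ltry.
Qed.

Lemma integrable_decay f k K : continuous f -> 0 < k ->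
  (forall s, 0 <= s -> `|f s| <= K * expR (- (k * s))) ->
  mu.-integrable `[0%R, +oo[ (EFin \o f).
Proof.
move=> cf k0 fK.
have K0 : 0 <= K.
  by have := le_trans (normr_ge0 _) (fK 0 (lexx 0)); rewrite mulr0 oppr0 expR0 mulr1.
apply: le_integrable (integrable_expR_decay k0 K0) => //.
  exact: continuous_mfun.
move=> s /=; rewrite in_itv /= andbT => s0; rewrite lee_fin.
by apply: (le_trans (fK s s0)); exact: ler_norm.
Qed.

Lemma Rintegral_expR_decay k K : 0 < k -> 0 <= K ->
  \int[mu]_(x in `[0%R, +oo[) (K * expR (- (k * x))) = K / k.
Proof. by move=> k0 K0; rewrite /Rintegral integral_expR_decay. Qed.

Lemma Rintegral_decay_le f k K : continuous f -> 0 < k ->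
  (forall s, 0 <= s -> `|f s| <= K * expR (- (k * s))) ->
  `|\int[mu]_(x in `[0%R, +oo[) f x| <= K / k.
Proof.
move=> cf k0 fK.
have K0 : 0 <= K.
  by have := le_trans (normr_ge0 _) (fK 0 (lexx 0)); rewrite mulr0 oppr0 expR0 mulr1.
have If := integrable_decay cf k0 fK.
apply: (le_trans (le_normr_Rintegral (mitv _) If)).
rewrite -(Rintegral_expR_decay k0 K0); apply: le_Rintegral => //.
- exact: integrable_norm.
- exact: integrable_expR_decay.
- by move=> s; rewrite /= in_itv /= andbT; exact: fK.
Qed.

(* Adding K e^{-k s} reduces the signed integrals to nonnegative ones. *)
Lemma FTC_decay f Phi k K : continuous f -> 0 < k ->
  (forall s, 0 <= s -> `|f s| <= K * expR (- (k * s))) ->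
  (forall s, is_derive (s : R) 1 Phi (f s)) ->
  Phi s @[s --> +oo] --> (0 : R) ->
  \int[mu]_(x in `[0%R, +oo[) f x = - Phi 0.
Proof.
move=> cf k0 fK dP P0.
have K0 : 0 <= K.
  by have := le_trans (normr_ge0 _) (fK 0 (lexx 0)); rewrite mulr0 oppr0 expR0 mulr1.
have If := integrable_decay cf k0 fK.
have Ie := integrable_expR_decay k0 K0.
have := RintegralD (mitv _) If Ie; rewrite Rintegral_expR_decay// => H.
suff E : \int[mu]_(x in `[0%R, +oo[) (f x + K * expR (- (k * x))) = - Phi 0 + K / k.
  by move: H; rewrite E => /addIr.
pose F s := Phi s + - (K / k) * expR (- (k * s)).
have dF s : is_derive (s : R) 1 F (f s + K * expR (- (k * s))).
  by apply: is_deriveD; exact: expR_decay_is_derive.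
have F0 : F s @[s --> +oo] --> (0 : R).
  by rewrite -[X in _ --> X](addr0 0); apply: cvgD => //; exact: expR_decay_cvg0.
have cfe : continuous (fun s : R => f s + K * expR (- (k * s))).
  by move=> s; apply: cvgD; [exact: cf|exact: expR_decay_continuous].
have fe0 s : 0 <= s -> 0 <= f s + K * expR (- (k * s)).
  by move=> s0; have := fK s s0; rewrite ler_norml => /andP[]; lra.
rewrite /Rintegral (ge0_FTCy fe0 cfe dF F0) /= /F.
by rewrite mulr0 oppr0 expR0 mulr1; ring.
Qed.

Lemma ge0_reflect f : continuous f -> (forall s, s <= 0 -> 0 <= f s) ->
  (\int[mu]_(x in `]-oo, 0%R]) (f x)%:E = \int[mu]_(x in `[0%R, +oo[) (f (- x))%:E)%E.
Proof.
move=> cf f0; have := @ge0_integration_by_substitutionNy R f 0.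
rewrite oppr0; apply; first exact: continuous_subspaceT.
by move=> s; rewrite in_itv /= => s0; apply: f0; exact: ltW.
Qed.

Lemma integrable_decayN f k K : continuous f -> 0 < k ->
  (forall s, s <= 0 -> `|f s| <= K * expR (- (k * - s))) ->
  mu.-integrable `]-oo, 0%R] (EFin \o f).
Proof.
move=> cf k0 fK.
have K0 : 0 <= K.
  by have := le_trans (normr_ge0 _) (fK 0 (lexx 0)); rewrite oppr0 mulr0 oppr0 expR0 mulr1.
have cE : continuous (fun s : R => K * expR (- (k * - s))).
  move=> s; apply: (@continuous_comp _ _ _ (fun x : R => - x) (fun s : R => K * expR (- (k * s)))).
    by apply: cvgN; exact: cvg_id.
  exact: expR_decay_continuous.
have IE : mu.-integrable `]-oo, 0%R] (EFin \o (fun s => K * expR (- (k * - s)))).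
  apply/integrableP; split; first by apply: continuous_mfun.
  under eq_integral => x _ do rewrite /= ger0_norm ?mulr_ge0 ?expR_ge0//.
  rewrite ge0_reflect//; last by move=> s _; rewrite mulr_ge0 ?expR_ge0.
  under eq_integral do rewrite opprK.
  by rewrite integral_expR_decay// ltry.
apply: le_integrable IE => //.
  exact: continuous_mfun.
move=> s /=; rewrite in_itv /= => s0; rewrite lee_fin.
by apply: (le_trans (fK s s0)); exact: ler_norm.
Qed.

(** Adding the exponential majorant e makes both integrands nonnegative, where [ge0_reflect]
    applies; the integrals of e itself agree by the same lemma and cancel. *)
Lemma Rintegral_reflect f k K : continuous f -> 0 < k ->
  (forall s, s <= 0 -> `|f s| <= K * expR (- (k * - s))) ->
  \int[mu]_(x in `]-oo, 0%R]) f x = \int[mu]_(x in `[0%R, +oo[) f (- x).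
Proof.
move=> cf k0 fK.
have K0 : 0 <= K.
  by have := le_trans (normr_ge0 _) (fK 0 (lexx 0)); rewrite oppr0 mulr0 oppr0 expR0 mulr1.
pose e s := K * expR (- (k * - s)).
have e0 s : 0 <= e s by rewrite mulr_ge0 ?expR_ge0.
have ce : continuous e.
  move=> s; apply: (@continuous_comp _ _ _ (fun x : R => - x) (fun s : R => K * expR (- (k * s)))).
    by apply: cvgN; exact: cvg_id.
  exact: expR_decay_continuous.
have cfN : continuous (fun s => f (- s)).
  by move=> s; apply: (@continuous_comp _ _ _ (fun x : R => - x) f); [apply: cvgN; exact: cvg_id|exact: cf].
have If := integrable_decayN cf k0 fK.
have Ie : mu.-integrable `]-oo, 0%R] (EFin \o e).
  by apply: (@integrable_decayN e k K) => // s _; rewrite ger0_norm.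
have fK' s : 0 <= s -> `|f (- s)| <= K * expR (- (k * s)).
  by move=> s0; have := fK (- s); rewrite opprK oppr_le0; apply.
have If' := integrable_decay cfN k0 fK'.
have Ie' : mu.-integrable `[0%R, +oo[ (EFin \o (fun s => e (- s))).
  have -> : (fun s => e (- s)) = (fun s => K * expR (- (k * s))).
    by apply/funext => s; rewrite /e opprK.
  exact: integrable_expR_decay.
have H1 := RintegralD (mitv _) If Ie; have H2 := RintegralD (mitv _) If' Ie'.
have E1 : \int[mu]_(x in `]-oo, 0%R]) e x = \int[mu]_(x in `[0%R, +oo[) e (- x).
  by rewrite /Rintegral ge0_reflect.
have E2 : \int[mu]_(x in `]-oo, 0%R]) (f x + e x) = \int[mu]_(x in `[0%R, +oo[) (f (- x) + e (- x)).
  rewrite /Rintegral (@ge0_reflect (fun x => f x + e x))//.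
    by move=> s; apply: cvgD; [exact: cf|exact: ce].
  by move=> s s0; rewrite -lerBlDr sub0r; have := fK s s0; rewrite ler_norml => /andP[].
by move: H1; rewrite E2 H2 E1 => /addIr.
Qed.

End RealIntegrals.

(** * Calculus of derivatives with quadratic remainder *)

Section SecondOrderDerivative.
Context {R : realType}.
Implicit Types (E F : R[i] -> R[i]) (w v d e c : R[i]).

Lemma qderiv_unique E w d e : qderiv E w d -> qderiv E w e -> d = e.
Proof.
move=> [K [r [r0 K0 H]]] [L [s [s0 L0 G]]].
apply/eqP; rewrite -subr_eq0; apply/eqP/nc_eq0/eqP; rewrite eq_le nc_ge0 andbT.
have KL : 0 <= K + L by rewrite addr_ge0.
apply: (ler_small (mulr_ge0 KL (ltW (lt_le_trans ltr01 (_ : 1 <= 1 + r + s))))).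
  by rewrite -addrA lerDl addr_ge0// ltW.
move=> t t0 t1; rewrite add0r.
pose m := Num.min t (Num.min r s).
have m0 : 0 < m by rewrite !lt_min t0 r0 s0.
have mt : m <= t by rewrite ge_min lexx.
have mr : m <= r by rewrite !ge_min lexx !orbT.
have ms : m <= s by rewrite !ge_min lexx !orbT.
have nm : normc (m%:C : R[i]) = m by rewrite nc_real gtr0_norm.
have := H m%:C; have := G m%:C; rewrite nm => /(_ ms) B /(_ mr) A.
have : normc (m%:C * (d - e)) <= (K + L) * m ^+ 2.
  have -> : m%:C * (d - e) = (E (w + m%:C) - E w - m%:C * e) - (E (w + m%:C) - E w - m%:C * d) by ring.
  by apply: (le_trans (ncB _ _)); rewrite mulrDl addrC lerD.
rewrite ncM nm expr2 mulrCA ler_pM2l// => C; apply: (le_trans C).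
rewrite -mulrA ler_wpM2l//; apply: (le_trans mt); rewrite ler_peMl ?(ltW t0)//.
by rewrite -addrA lerDl addr_ge0// ltW.
Qed.

Lemma qderiv_ext E F w d (r : R) : 0 < r -> (forall v, normc v <= r -> E (w + v) = F (w + v)) ->
  qderiv E w d -> qderiv F w d.
Proof.
move=> r0 EF [K [s [s0 K0 H]]]; exists K, (Num.min r s); split => //.
  by rewrite lt_min r0.
move=> v; rewrite le_min => /andP[vr vs].
have Ew : E w = F w by have := EF 0; rewrite addr0; apply; rewrite nc0 ltW.
by rewrite -EF// -Ew; exact: H.
Qed.

Lemma qderiv_cst c w : qderiv (fun=> c) w 0.
Proof.
by exists 0, 1; split => // v _; rewrite subrr mulr0 subrr nc0 mul0r.
Qed.

Lemma qderiv_id w : qderiv (fun z => z) w 1.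
Proof.
exists 0, 1; split => // v _.
have -> : w + v - w - v * 1 = 0 by ring.
by rewrite nc0 mul0r.
Qed.

Lemma qderiv_mul E F w d e : qderiv E w d -> qderiv F w e ->
  qderiv (fun z => E z * F z) w (d * F w + E w * e).
Proof.
move=> [K [r [r0 K0 H]]] [L [s [s0 L0 G]]].
pose m := Num.min 1 (Num.min r s).
have m0 : 0 < m by rewrite !lt_min ltr01 r0 s0.
have e0 := nc_ge0 e; have d0 := nc_ge0 d; have E0 := nc_ge0 (E w); have F0 := nc_ge0 (F w).
pose B := normc (F w) + normc e + L.
have B0 : 0 <= B by rewrite /B !addr_ge0.
exists (K * B + normc d * (normc e + L) + normc (E w) * L), m; split => //.
  by rewrite !addr_ge0 ?mulr_ge0 ?addr_ge0.
move=> v; rewrite !le_min => /and3P[v1 vr vs].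
have v0 := nc_ge0 v; have Hv := H v vr; have Gv := G v vs.
have v2 : normc v ^+ 2 <= normc v by rewrite expr2 ler_piMl.
have F1 : normc (F (w + v) - F w) <= (normc e + L) * normc v.
  have -> : F (w + v) - F w = (F (w + v) - F w - v * e) + v * e by rewrite subrK.
  apply: (le_trans (ncD _ _)); rewrite ncM mulrDl.
  have : L * normc v ^+ 2 <= L * normc v by rewrite ler_wpM2l.
  lra.
have F2 : normc (F (w + v)) <= B.
  have -> : F (w + v) = F w + (F (w + v) - F w) by ring.
  apply: (le_trans (ncD _ _)); rewrite /B -addrA lerD2l; apply: (le_trans F1).
  by rewrite ler_piMr// addr_ge0.
have -> : E (w + v) * F (w + v) - E w * F w - v * (d * F w + E w * e) =
  (E (w + v) - E w - v * d) * F (w + v) + v * d * (F (w + v) - F w)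
   + E w * (F (w + v) - F w - v * e) by ring.
have h1 : normc ((E (w + v) - E w - v * d) * F (w + v)) <= K * normc v ^+ 2 * B.
  by rewrite ncM ler_pM ?nc_ge0.
have h2 : normc (v * d * (F (w + v) - F w)) <= normc v * normc d * ((normc e + L) * normc v).
  by rewrite (ncM (v * d)) (ncM v) ler_wpM2l// mulr_ge0.
have h3 : normc (E w * (F (w + v) - F w - v * e)) <= normc (E w) * (L * normc v ^+ 2).
  by rewrite (ncM (E w)) ler_wpM2l.
apply: (le_trans (ncD _ _)); apply: (le_trans (lerD (ncD _ _) (lexx _))).
apply: (le_trans (lerD (lerD h1 h2) h3)).
rewrite le_eqVlt; apply/orP; left; apply/eqP; ring.
Qed.

Lemma qderiv_affine E c e w d : qderiv E (c * w + e) d -> qderiv (fun z => E (c * z + e)) w (c * d).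
Proof.
move=> [K [r [r0 K0 H]]]; have c0 := nc_ge0 c.
exists (K * normc c ^+ 2), (r / (normc c + 1)); split.
- by rewrite divr_gt0//; lra.
- by rewrite mulr_ge0// sqr_ge0.
move=> v; rewrite ler_pdivlMr; last by lra.
move=> vr; have v0 := nc_ge0 v.
have cv : normc (c * v) <= r by rewrite ncM; nra.
have := H (c * v) cv.
have -> : c * (w + v) + e = c * w + e + c * v by ring.
have -> : v * (c * d) = c * v * d by ring.
by rewrite (ncM c v) exprMn mulrA.
Qed.

Lemma qderiv_scale E c w d : qderiv E w d -> qderiv (fun z => c * E z) w (c * d).
Proof.
move=> H; have := qderiv_mul (qderiv_cst c w) H.
by rewrite mul0r add0r.
Qed.

Lemma qderiv_pow n w : qderiv (fun z => z ^+ n) w (n%:R * w ^+ n.-1).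
Proof.
elim: n => [|n IH].
  have -> : (fun z => z ^+ 0) = (fun=> 1 : R[i]) by apply/funext => z; rewrite expr0.
  by rewrite mul0r; exact: qderiv_cst.
have -> : (fun z => z ^+ n.+1) = (fun z : R[i] => z * z ^+ n) by apply/funext => z; rewrite exprS.
have := qderiv_mul (qderiv_id w) IH.
have -> : 1 * w ^+ n + w * (n%:R * w ^+ n.-1) = n.+1%:R * w ^+ n.+1.-1 => //.
case: n {IH} => [|n]; first by rewrite mul0r mulr0 addr0 expr0.
by rewrite /= -[in RHS]natr1 exprS; ring.
Qed.

Lemma C_derivable_qderiv E w d : qderiv E w d -> C_derivable E w.
Proof.
move=> [K [r [r0 K0 H]]].
rewrite /C_derivable /derivable; apply/cvg_ex; exists (d : R[i]^o).
apply/(@cvgrPdist_le _ R[i]^o) => eps; rewrite ltcE /= => /andP[/eqP eI e0].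
(* The tolerance is an element of R[i]; being positive forces it to be real. *)
have eE : eps = (complex.Re eps)%:C.
  by apply/eqP; rewrite eq_complex /= eqxx -eI eqxx.
pose m := Num.min r (complex.Re eps / (K + 1)).
have m0 : 0 < m by rewrite lt_min r0 divr_gt0//; lra.
have mC : 0 < (m%:C : R[i]) by rewrite ltcR.
near=> t.
have t0 : t != 0 by near: t; exact: withinT.
have tm : normc t < m.
  have : `|t| < (m%:C : R[i]) by near: t; exact: (@dnbhs0_lt R[i] R[i]^o _ mC).
  by rewrite normc_def ltcR; case: (t).
have tr : normc t <= r by apply: (le_trans (ltW tm)); rewrite ge_min lexx.
have := H t tr => Ht.
have nE (z : R[i]) : `|z| = (normc z)%:C by rewrite normc_def; case: (z).
rewrite eE nE lecR.
change (normc (d - t^-1 * (E (t * 1 + w) - E w)) <= complex.Re eps).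
rewrite mulr1 addrC [t + w]addrC addrC.
have -> : d - t^-1 * (E (w + t) - E w) = - (t^-1 * (E (w + t) - E w - t * d)).
  by field.
rewrite ncN ncM ncV.
have n0 : 0 < normc t by exact: nc_gt0.
rewrite mulrC ler_pdivrMr//; apply: (le_trans Ht).
rewrite expr2 mulrA ler_wpM2r ?nc_ge0//.
have : normc t <= complex.Re eps / (K + 1) by apply: (le_trans (ltW tm)); rewrite ge_min lexx orbT.
rewrite ler_pdivlMr; last by lra.
nra.
Unshelve. all: by end_near. Qed.

End SecondOrderDerivative.

(** * Laplace transforms and their differentiability *)

Section Laplace.
Import measurable_realfun.
Context {R : realType}.
Implicit Types (q f g : R -> R[i]) (K k : R) (w z c u : R[i]).

Local Notation mu := (@lebesgue_measure R).

Definition ccont q := continuous (fun s : R => complex.Re (q s)) /\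
                      continuous (fun s : R => complex.Im (q s)).

Lemma ccont_add f g : ccont f -> ccont g -> ccont (fun s => f s + g s).
Proof.
move=> [f1 f2] [g1 g2]; split => s.
- have -> : (fun s => complex.Re (f s + g s)) = (fun s => complex.Re (f s) + complex.Re (g s)).
    by apply/funext => t; rewrite cReD.
  by apply: cvgD; [exact: f1|exact: g1].
- have -> : (fun s => complex.Im (f s + g s)) = (fun s => complex.Im (f s) + complex.Im (g s)).
    by apply/funext => t; rewrite cImD.
  by apply: cvgD; [exact: f2|exact: g2].
Qed.

Lemma ccont_mul f g : ccont f -> ccont g -> ccont (fun s => f s * g s).
Proof.
move=> [f1 f2] [g1 g2]; split => s.
- have -> : (fun s => complex.Re (f s * g s)) =
      (fun s => complex.Re (f s) * complex.Re (g s) - complex.Im (f s) * complex.Im (g s)).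
    by apply/funext => t; rewrite cReM.
  by apply: cvgB; apply: cvgM; [exact: f1|exact: g1|exact: f2|exact: g2].
- have -> : (fun s => complex.Im (f s * g s)) =
      (fun s => complex.Re (f s) * complex.Im (g s) + complex.Im (f s) * complex.Re (g s)).
    by apply/funext => t; rewrite cImM.
  by apply: cvgD; apply: cvgM; [exact: f1|exact: g2|exact: f2|exact: g1].
Qed.

Lemma ccont_cst c : ccont (fun=> c).
Proof. by split => s; exact: cvg_cst. Qed.

Lemma ccont_real : ccont (fun s => s%:C).
Proof. by split => s; [exact: cvg_id|exact: cvg_cst]. Qed.

Lemma expC_negE (s : R) w : expC (- (s%:C * w)) =
  (expR (- (complex.Re w * s)))%:C * (cos (complex.Im w * s) -i* sin (complex.Im w * s)).
Proof.
case: w => x y; rewrite /expC /=.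
have -> : - (s * x - 0 * y) = - (x * s) by ring.
have -> : - (s * y + 0 * x) = - (y * s) by ring.
by rewrite cosN sinN.
Qed.

Lemma ccont_exp w : ccont (fun s => expC (- (s%:C * w))).
Proof.
have -> : (fun s => expC (- (s%:C * w))) = (fun s =>
  (expR (- (complex.Re w * s)))%:C * (cos (complex.Im w * s) -i* sin (complex.Im w * s))).
  by apply/funext => s; rewrite expC_negE.
have cm (y : R) : continuous (fun s : R => y * s).
  by move=> s; apply: cvgMr; exact: cvg_id.
apply: ccont_mul; split => s /=.
- have := @expR_decay_continuous R (complex.Re w) 1 s.
  have -> : (fun s : R => 1 * expR (- (complex.Re w * s))) = (fun s => expR (- (complex.Re w * s))).
    by apply/funext => t; rewrite mul1r.
  exact.
- exact: cvg_cst.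
- by apply: (@continuous_comp _ _ _ (fun s : R => complex.Im w * s) cos); [exact: cm|exact: continuous_cos].
- apply: cvgN; apply: (@continuous_comp _ _ _ (fun s : R => complex.Im w * s) sin); [exact: cm|exact: continuous_sin].
Qed.

Lemma nc_exp_neg (s : R) w : normc (expC (- (s%:C * w))) = expR (- (complex.Re w * s)).
Proof. by rewrite nc_expC cReN cReM /= mul0r subr0 mulrC. Qed.

Definition decaying q := ccont q /\ exists K, exists k, 0 < k /\
  forall s, 0 <= s -> normc (q s) <= K * expR (- (k * s)).

Definition halfint q : R[i] := C_integral `[0%R, +oo[ q.

Lemma decaying_Re q : decaying q -> mu.-integrable `[0%R, +oo[ (EFin \o (fun s => complex.Re (q s))).
Proof.
move=> [[c1 _] [K [k [k0 H]]]]; apply: (integrable_decay c1 k0) => s s0.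
exact: le_trans (Re_le_nc _) (H s s0).
Qed.

Lemma decaying_Im q : decaying q -> mu.-integrable `[0%R, +oo[ (EFin \o (fun s => complex.Im (q s))).
Proof.
move=> [[_ c1] [K [k [k0 H]]]]; apply: (integrable_decay c1 k0) => s s0.
exact: le_trans (Im_le_nc _) (H s s0).
Qed.

Lemma halfint_add f g : decaying f -> decaying g ->
  halfint (fun s => f s + g s) = halfint f + halfint g.
Proof.
move=> df dg; rewrite /halfint /C_integral.
have E1 := RintegralD (mitv _) (decaying_Re df) (decaying_Re dg).
have E2 := RintegralD (mitv _) (decaying_Im df) (decaying_Im dg).
under [X in X +i* _]eq_Rintegral do rewrite cReD.
under [X in _ +i* X]eq_Rintegral do rewrite cImD.
by rewrite E1 E2.
Qed.

Lemma halfint_scale c f : decaying f -> halfint (fun s => c * f s) = c * halfint f.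
Proof.
move=> df; rewrite /halfint /C_integral.
have I1 := decaying_Re df; have I2 := decaying_Im df.
have Z (r : R) (F : R -> R) : mu.-integrable `[0%R, +oo[ (EFin \o F) ->
    mu.-integrable `[0%R, +oo[ (EFin \o (fun s => r * F s)).
  by move=> IF; have := integrableZl (mitv _) r IF.
have E1 := RintegralB (mitv _) (Z (complex.Re c) _ I1) (Z (complex.Im c) _ I2).
have E2 := RintegralD (mitv _) (Z (complex.Re c) _ I2) (Z (complex.Im c) _ I1).
under [X in X +i* _]eq_Rintegral do rewrite cReM.
under [X in _ +i* X]eq_Rintegral do rewrite cImM.
rewrite E1 E2 !(RintegralZl _ (mitv _))//.
by apply/eqP; rewrite eq_complex cReM cImM /= !eqxx.
Qed.

Lemma halfint_le f K k : ccont f -> 0 < k ->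
  (forall s, 0 <= s -> normc (f s) <= K * expR (- (k * s))) ->
  normc (halfint f) <= 2 * (K / k).
Proof.
move=> [c1 c2] k0 H; apply: (le_trans (nc_leD _)).
have A := Rintegral_decay_le c1 k0 (fun s s0 => le_trans (Re_le_nc _) (H s s0)).
have B := Rintegral_decay_le c2 k0 (fun s s0 => le_trans (Im_le_nc _) (H s s0)).
rewrite /halfint /C_integral /=; lra.
Qed.

Lemma decaying_add f g : decaying f -> decaying g -> decaying (fun s => f s + g s).
Proof.
move=> [cf [K [k [k0 H]]]] [cg [L [l [l0 G]]]]; split; first exact: ccont_add.
have K0 : 0 <= K.
  by have := le_trans (nc_ge0 _) (H 0 (lexx 0)); rewrite mulr0 oppr0 expR0 mulr1.
have L0 : 0 <= L.
  by have := le_trans (nc_ge0 _) (G 0 (lexx 0)); rewrite mulr0 oppr0 expR0 mulr1.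
exists (K + L), (Num.min k l); split; first by rewrite lt_min k0.
move=> s s0; apply: (le_trans (ncD _ _)); rewrite mulrDl; apply: lerD.
  apply: (le_trans (H s s0)); rewrite ler_wpM2l// ler_expR lerN2 ler_wpM2r//.
  by rewrite ge_min lexx.
apply: (le_trans (G s s0)); rewrite ler_wpM2l// ler_expR lerN2 ler_wpM2r//.
by rewrite ge_min lexx orbT.
Qed.

Lemma decaying_scale c f : decaying f -> decaying (fun s => c * f s).
Proof.
move=> [cf [K [k [k0 H]]]]; split; first by apply: ccont_mul => //; exact: ccont_cst.
exists (normc c * K), k; split => // s s0.
by rewrite (ncM c) -mulrA ler_wpM2l ?nc_ge0 ?H.
Qed.

Definition growth q k := ccont q /\ exists2 K, 0 <= K &
  forall s, 0 <= s -> normc (q s) <= K * expR (k * s).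

Definition Lap q w : R[i] := halfint (fun s => q s * expC (- (s%:C * w))).

Lemma growth_decaying q k w : growth q k -> k < complex.Re w ->
  decaying (fun s => q s * expC (- (s%:C * w))).
Proof.
move=> [cq [K K0 H]] kw; split; first by apply: ccont_mul => //; exact: ccont_exp.
exists K, (complex.Re w - k); split; first by rewrite subr_gt0.
move=> s s0; rewrite (ncM (q s)) nc_exp_neg.
have -> : - ((complex.Re w - k) * s) = k * s + - (complex.Re w * s) by ring.
by rewrite expRD mulrA ler_wpM2r ?expR_ge0 ?H.
Qed.

Lemma Lap_add f g k w : growth f k -> growth g k -> k < complex.Re w ->
  Lap (fun s => f s + g s) w = Lap f w + Lap g w.
Proof.
move=> gf gg kw; rewrite /Lap -(halfint_add (growth_decaying gf kw) (growth_decaying gg kw)).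
by congr halfint; apply/funext => s; rewrite mulrDl.
Qed.

Lemma Lap_scale c f k w : growth f k -> k < complex.Re w ->
  Lap (fun s => c * f s) w = c * Lap f w.
Proof.
move=> gf kw; rewrite /Lap -(halfint_scale c (growth_decaying gf kw)).
by congr halfint; apply/funext => s; rewrite mulrA.
Qed.

Lemma growth_add f g k : growth f k -> growth g k -> growth (fun s => f s + g s) k.
Proof.
move=> [cf [K K0 H]] [cg [L L0 G]]; split; first exact: ccont_add.
exists (K + L); rewrite ?addr_ge0// => s s0.
by apply: (le_trans (ncD _ _)); rewrite mulrDl lerD ?H ?G.
Qed.

Lemma growth_scale c f k : growth f k -> growth (fun s => c * f s) k.
Proof.
move=> [cf [K K0 H]]; split; first by apply: ccont_mul => //; exact: ccont_cst.
exists (normc c * K); rewrite ?mulr_ge0 ?nc_ge0// => s s0.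
by rewrite (ncM c) -mulrA ler_wpM2l ?nc_ge0 ?H.
Qed.

Lemma Lap_dist_le f g k w (e : R) : growth f k -> growth g k -> k < complex.Re w ->
  (forall s, 0 <= s -> normc (f s - g s) <= e * expR (k * s)) ->
  normc (Lap f w - Lap g w) <= 2 * (e / (complex.Re w - k)).
Proof.
move=> gf gg kw H.
have gN : growth (fun s => -1 * g s) k by exact: growth_scale.
have -> : Lap f w - Lap g w = Lap (fun s => f s + -1 * g s) w.
  by rewrite (Lap_add gf gN kw) (Lap_scale (-1) gg kw) mulN1r.
apply: halfint_le; first last.
- move=> s s0; rewrite (ncM (f s + _)) nc_exp_neg mulN1r.
  have -> : - ((complex.Re w - k) * s) = k * s + - (complex.Re w * s) by ring.
  by rewrite expRD mulrA ler_wpM2r ?expR_ge0 ?H.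
- by rewrite subr_gt0.
- by apply: ccont_mul; [case: (growth_add gf gN)|exact: ccont_exp].
Qed.

(** Differentiation under the integral with an explicit remainder: the second-order bound for
    e^{-sv} costs 3 s^2 |v|^2 e^{s |v|}, and the gap between Re w and k pays for it. *)
Lemma Lap_qderiv q k w : growth q k -> k < complex.Re w ->
  qderiv (Lap q) w (Lap (fun s => - s%:C * q s) w).
Proof.
move=> gq kw; have [cq [K K0 H]] := gq; set G := complex.Re w - k.
have G0 : 0 < G by rewrite subr_gt0.
(* The gap is 8 m. The factor s^2 uses 2 m and e^{s |v|} uses m, as |v| <= m; a decay of rate 5 m is
   left. *)
pose m := G / 8; have m0 : 0 < m by rewrite divr_gt0.
have s2 (s : R) : 0 <= s -> s ^+ 2 <= m^-1 ^+ 2 * expR (2 * m * s).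
  move=> s0; have h : m * s <= expR (m * s) by apply: le_trans (expR_ge1Dx _); rewrite lerDr.
  have -> : 2 * m * s = m * s + m * s by ring.
  rewrite expRD; have ms : 0 <= m * s by rewrite mulr_ge0// ltW.
  have hh : (m * s) * (m * s) <= expR (m * s) * expR (m * s) by apply: ler_pM.
  have -> : s ^+ 2 = m^-1 ^+ 2 * ((m * s) * (m * s)) by field; rewrite gt_eqF.
  by rewrite ler_wpM2l ?sqr_ge0.
have s1 (s : R) : 0 <= s -> s <= m^-1 * expR (m * s).
  move=> s0; have h : m * s <= expR (m * s) by apply: le_trans (expR_ge1Dx _); rewrite lerDr.
  by rewrite [leRHS]mulrC ler_pdivlMr// mulrC.
have gq1 : growth (fun s => - s%:C * q s) (k + m).
  split; first by apply: ccont_mul => //; split => s /=; [apply: cvgN; exact: cvg_id|rewrite oppr0; exact: cvg_cst].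
  exists (m^-1 * K) => [|s s0]; first by rewrite mulr_ge0// invr_ge0 ltW.
  rewrite (ncM (- _)) ncN nc_real ger0_norm// mulrDl expRD.
  apply: (le_trans (ler_pM s0 (nc_ge0 _) (s1 s s0) (H s s0))).
  by rewrite le_eqVlt; apply/orP; left; apply/eqP; ring.
have kmw : k + m < complex.Re w by rewrite -ltrBrDl -/G /m; lra.
exists (2 * (K * 3 * m^-1 ^+ 2 / (5 * m))), m; split => //.
  apply: mulr_ge0 => //; apply: divr_ge0; last by rewrite mulr_ge0// ltW.
  by apply: mulr_ge0; [exact: mulr_ge0|exact: sqr_ge0].
move=> v vm; have v0 := nc_ge0 v.
have vkw : k < complex.Re (w + v).
  rewrite cReD; have := le_trans (Re_le_nc v) vm; rewrite ler_norml => /andP[+ _].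
  by move: G0; rewrite /m /G; lra.
have d1 := growth_decaying gq vkw; have d2 := growth_decaying gq kw; have d3 := growth_decaying gq1 kmw.
have -> : Lap q (w + v) - Lap q w - v * Lap (fun s => - s%:C * q s) w =
  halfint (fun s => q s * expC (- (s%:C * (w + v))) + (-1 * (q s * expC (- (s%:C * w)))
    + - v * (- s%:C * q s * expC (- (s%:C * w))))).
  rewrite halfint_add//; last by apply: decaying_add; exact: decaying_scale.
  rewrite halfint_add; [|exact: decaying_scale|exact: decaying_scale].
  by rewrite !halfint_scale// /Lap; ring.
have -> : (fun s => q s * expC (- (s%:C * (w + v))) + (-1 * (q s * expC (- (s%:C * w)))
    + - v * (- s%:C * q s * expC (- (s%:C * w))))) =
  (fun s => q s * expC (- (s%:C * w)) * (expC (- (s%:C * v)) - 1 - - (s%:C * v))).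
  apply/funext => s; have -> : - (s%:C * (w + v)) = - (s%:C * w) + - (s%:C * v) by ring.
  by rewrite expCD; set A := expC _; set B := expC _; ring.
have -> : 2 * (K * 3 * m^-1 ^+ 2 / (5 * m)) * normc v ^+ 2 =
  2 * (K * 3 * m^-1 ^+ 2 * normc v ^+ 2 / (5 * m)) by ring.
apply: halfint_le.
- apply: ccont_mul; first by apply: ccont_mul => //; exact: ccont_exp.
  have -> : (fun s => expC (- (s%:C * v)) - 1 - - (s%:C * v)) =
    (fun s => expC (- (s%:C * v)) + (-1 + s%:C * v)) by apply/funext => s; ring.
  apply: ccont_add; first exact: ccont_exp.
  apply: ccont_add; first exact: ccont_cst.
  by apply: ccont_mul; [exact: ccont_real|exact: ccont_cst].
- by rewrite mulr_gt0.
move=> s s0; rewrite (ncM (q s * _)) (ncM (q s)) nc_exp_neg.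
have B := expC_sub1D_le (- (s%:C * v)).
rewrite ncN (ncM s%:C) nc_real (ger0_norm s0) in B.
have vs : s * normc v <= m * s by rewrite mulrC ler_wpM2r.
have B2 : normc (expC (- (s%:C * v)) - 1 - - (s%:C * v)) <=
   3 * (m^-1 ^+ 2 * expR (2 * m * s) * normc v ^+ 2) * expR (m * s).
  apply: (le_trans B); apply: ler_pM; rewrite ?expR_ge0 ?ler_expR//.
    by rewrite mulr_ge0// sqr_ge0.
  by rewrite exprMn ler_wpM2l// ler_wpM2r ?sqr_ge0// s2.
have A1 : normc (q s) * expR (- (complex.Re w * s)) <= K * expR (k * s) * expR (- (complex.Re w * s)).
  by rewrite ler_wpM2r ?expR_ge0 ?H.
apply: (le_trans (ler_pM _ (nc_ge0 _) A1 B2)); first by rewrite mulr_ge0 ?expR_ge0 ?nc_ge0.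
have -> : - (5 * m * s) = k * s + - (complex.Re w * s) + 2 * m * s + m * s.
  by rewrite /m /G; field.
by rewrite !expRD le_eqVlt; apply/orP; left; apply/eqP; ring.
Qed.

End Laplace.

(** * Laplace transforms of polynomials along rays *)

Section LaplacePolynomials.
Import measurable_realfun.
Context {R : realType}.
Implicit Types (q f g : R -> R[i]) (K k : R) (w z c u : R[i]) (p : {poly R[i]}).

Lemma growth_poly p u k : 0 < k -> normc u = 1 -> growth (fun s => p.[u * s%:C]) k.
Proof.
move=> k0 u1; split.
  elim/poly_ind: p => [|p c IH].
    have -> : (fun s : R => (0 : {poly R[i]}).[u * s%:C]) = (fun=> 0).
      by apply/funext => s; rewrite horner0.
    exact: ccont_cst.
  have -> : (fun s : R => (p * 'X + c%:P).[u * s%:C]) = (fun s => p.[u * s%:C] * (u * s%:C) + c).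
    by apply/funext => s; rewrite hornerMXaddC.
  apply: ccont_add; last exact: ccont_cst.
  by apply: ccont_mul => //; apply: ccont_mul; [exact: ccont_cst|exact: ccont_real].
have [K K0 HK] := poly_growth p k0; exists K; first exact: ltW.
move=> s s0; apply: (le_trans (HK _)).
by rewrite (ncM u) u1 mul1r nc_real ger0_norm.
Qed.

Lemma growth_mono n k : 0 < k -> growth (fun s : R => (s%:C : R[i]) ^+ n) k.
Proof.
move=> k0; have := growth_poly 'X^n k0 (@nc1 R).
have -> // : (fun s : R => ('X^n : {poly R[i]}).[1 * s%:C]) = (fun s => s%:C ^+ n).
by apply/funext => s; rewrite mul1r hornerXn.
Qed.

Lemma is_derive_expR_lin (x s : R) :
  is_derive s 1 (fun s : R => expR (- (x * s))) (- x * expR (- (x * s))).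
Proof.
have H1 : is_derive s 1 (fun s : R => - (x * s)) (- (x * 1)).
  by apply: is_deriveN; apply: is_deriveZ.
have H2 := @is_derive1_comp R expR (fun s => - (x * s)) s _ _ (is_derive_expR _) H1.
by apply: is_derive_eq; ring.
Qed.

Lemma is_derive_cos_lin (y s : R) :
  is_derive s 1 (fun s : R => cos (y * s)) (- y * sin (y * s)).
Proof.
have H1 : is_derive s 1 (fun s : R => y * s) (y * 1) by apply: is_deriveZ.
have H2 := @is_derive1_comp R cos (fun s => y * s) s _ _ (is_derive_cos _) H1.
by apply: is_derive_eq; ring.
Qed.

Lemma is_derive_sin_lin (y s : R) :
  is_derive s 1 (fun s : R => sin (y * s)) (y * cos (y * s)).
Proof.
have H1 : is_derive s 1 (fun s : R => y * s) (y * 1) by apply: is_deriveZ.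
have H2 := @is_derive1_comp R sin (fun s => y * s) s _ _ (is_derive_sin _) H1.
by apply: is_derive_eq; ring.
Qed.

Lemma trig_decay_derive (x y a b n s : R) : is_derive s 1
  (fun s : R => n * (expR (- (x * s)) * (a * cos (y * s) + b * sin (y * s))))
  (n * expR (- (x * s)) * ((b * y - a * x) * cos (y * s) - (b * x + a * y) * sin (y * s))).
Proof.
have H1 := is_derive_expR_lin x s; have H2 := is_derive_cos_lin y s.
have H3 := is_derive_sin_lin y s.
have H4 : is_derive s 1 (fun s : R => a * cos (y * s)) (a * (- y * sin (y * s))).
  exact: is_deriveZ.
have H5 : is_derive s 1 (fun s : R => b * sin (y * s)) (b * (y * cos (y * s))).
  exact: is_deriveZ.
have H6 : is_derive s 1 (fun s : R => a * cos (y * s) + b * sin (y * s))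
   (a * (- y * sin (y * s)) + b * (y * cos (y * s))) by exact: is_deriveD.
have H7 : is_derive s 1 (fun s : R => expR (- (x * s)) * (a * cos (y * s) + b * sin (y * s)))
   (expR (- (x * s)) * (a * (- y * sin (y * s)) + b * (y * cos (y * s))) +
    (a * cos (y * s) + b * sin (y * s)) * (- x * expR (- (x * s)))) by exact: is_deriveM.
have H8 : is_derive s 1 (fun s : R => n * (expR (- (x * s)) * (a * cos (y * s) + b * sin (y * s))))
   (n * (expR (- (x * s)) * (a * (- y * sin (y * s)) + b * (y * cos (y * s))) +
    (a * cos (y * s) + b * sin (y * s)) * (- x * expR (- (x * s))))) by exact: is_deriveZ.
by apply: is_derive_eq; ring.
Qed.

Lemma trig_decay_cvg0 (x y a b n : R) : 0 < x ->
  n * (expR (- (x * s)) * (a * cos (y * s) + b * sin (y * s))) @[s --> +oo] --> (0 : R).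
Proof.
move=> x0; pose K := `|n| * (`|a| + `|b|).
apply: (@squeeze_cvgr _ _ _ _ (fun s => (- K) * expR (- (x * s))) (fun s => K * expR (- (x * s)))).
- near=> s; rewrite mulNr -ler_norml !normrM (ger0_norm (expR_ge0 _)).
  rewrite /K -mulrA ler_wpM2l// mulrC ler_wpM2r ?expR_ge0//.
  apply: (le_trans (ler_normD _ _)); rewrite !normrM; apply: lerD.
    by rewrite ler_piMr// cos_max.
  by rewrite ler_piMr// sin_max.
- exact: expR_decay_cvg0.
- exact: expR_decay_cvg0.
Unshelve. all: by end_near. Qed.

Lemma Lap_one w : 0 < complex.Re w -> Lap (fun s : R => (s%:C : R[i]) ^+ 0) w = w^-1.
Proof.
case: w => x y /= x0; pose n := x ^+ 2 + y ^+ 2.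
have n0 : 0 < n by rewrite ltr_pwDl ?sqr_ge0// exprn_gt0.
have h1 : 0 < x / 2 by rewrite divr_gt0.
have h2 : x / 2 < complex.Re (x +i* y) by rewrite /=; lra.
have [[c1 c2] _] := growth_decaying (growth_mono 0 h1) h2.
rewrite /Lap /halfint /C_integral.
have E s : (s%:C : R[i]) ^+ 0 * expC (- (s%:C * (x +i* y))) =
    expR (- (x * s)) * cos (y * s) +i* (- (expR (- (x * s)) * sin (y * s))).
  rewrite expr0 mul1r expC_negE /=; apply/eqP; rewrite eq_complex /=.
  by apply/andP; split; apply/eqP; ring.
have -> : (x +i* y)^-1 = (x / n) +i* (- y / n).
  by apply/eqP; rewrite eq_complex /= /n; apply/andP; split; apply/eqP; rewrite ?mulNr.
have bC s : 0 <= s -> `|expR (- (x * s)) * cos (y * s)| <= 1 * expR (- (x * s)).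
  by move=> _; rewrite normrM (ger0_norm (expR_ge0 _)) mulrC ler_wpM2r ?expR_ge0 ?cos_max.
have bS s : 0 <= s -> `|- (expR (- (x * s)) * sin (y * s))| <= 1 * expR (- (x * s)).
  by move=> _; rewrite normrN normrM (ger0_norm (expR_ge0 _)) mulrC ler_wpM2r ?expR_ge0 ?sin_max.
under [X in X +i* _]eq_Rintegral do rewrite E.
under [X in _ +i* X]eq_Rintegral do rewrite E.
have cC : continuous (fun s => expR (- (x * s)) * cos (y * s)).
  have -> : (fun s => expR (- (x * s)) * cos (y * s)) =
      (fun s => complex.Re ((s%:C : R[i]) ^+ 0 * expC (- (s%:C * (x +i* y))))).
    by apply/funext => s; rewrite E.
  exact: c1.
have cS : continuous (fun s => - (expR (- (x * s)) * sin (y * s))).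
  have -> : (fun s => - (expR (- (x * s)) * sin (y * s))) =
      (fun s => complex.Im ((s%:C : R[i]) ^+ 0 * expC (- (s%:C * (x +i* y))))).
    by apply/funext => s; rewrite E.
  exact: c2.
(* [PC] and [PS] are the real and imaginary parts of the primitive - e^{-ws} / w, with n = |w|^2. *)
pose PC s := n^-1 * (expR (- (x * s)) * (- x * cos (y * s) + y * sin (y * s))).
pose PS s := n^-1 * (expR (- (x * s)) * (y * cos (y * s) + x * sin (y * s))).
have dC s : is_derive (s : R) 1 PC (expR (- (x * s)) * cos (y * s)).
  have D := trig_decay_derive x y (- x) y n^-1 s.
  by apply: is_derive_eq; rewrite /n; field; rewrite gt_eqF.
have dS s : is_derive (s : R) 1 PS (- (expR (- (x * s)) * sin (y * s))).
  have D := trig_decay_derive x y y x n^-1 s.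
  by apply: is_derive_eq; rewrite /n; field; rewrite gt_eqF.
have lC : PC s @[s --> +oo] --> (0 : R) by exact: trig_decay_cvg0.
have lS : PS s @[s --> +oo] --> (0 : R) by exact: trig_decay_cvg0.
rewrite /= (FTC_decay cC x0 bC dC lC) (FTC_decay cS x0 bS dS lS) /PC /PS.
rewrite !mulr0 oppr0 expR0 cos0 sin0.
by apply/eqP; rewrite eq_complex /=; apply/andP; split; apply/eqP; ring.
Qed.

(** By induction w^(n+1) times the transform of s^n is constant, so its derivative vanishes; the
    product rule then expresses the transform of s^(n+1) through that of s^n. Uniqueness of the
    derivative takes the place of an integration by parts. *)
Lemma Lap_mono n w : 0 < complex.Re w ->
  w ^+ n.+1 * Lap (fun s : R => (s%:C : R[i]) ^+ n) w = n`!%:R.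
Proof.
have w0 (w' : R[i]) : 0 < complex.Re w' -> w' != 0.
  by move=> H; apply/eqP => E; move: H; rewrite E /= ltxx.
elim: n w => [|n IH] w rw; first by rewrite Lap_one// expr1 divff ?w0// fact0.
pose M m z := Lap (fun s : R => (s%:C : R[i]) ^+ m) z.
have r2 : 0 < complex.Re w / 2 by rewrite divr_gt0.
have r2w : complex.Re w / 2 < complex.Re w by lra.
have DM : qderiv (M n) w (- M n.+1 w).
  have := Lap_qderiv (growth_mono n r2) r2w.
  have -> : Lap (fun s => - s%:C * s%:C ^+ n) w = - M n.+1 w.
    have -> : (fun s : R => - s%:C * (s%:C : R[i]) ^+ n) = (fun s => -1 * s%:C ^+ n.+1).
      by apply/funext => s; rewrite exprS mulN1r mulNr.
    by rewrite (Lap_scale _ (growth_mono n.+1 r2) r2w) mulN1r.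
  exact.
have D1 := qderiv_mul (qderiv_pow n.+1 w) DM.
have D2 : qderiv (fun z => z ^+ n.+1 * M n z) w 0.
  apply: (qderiv_ext r2 _ (qderiv_cst n`!%:R w)) => v vr; rewrite IH// cReD.
  have := le_trans (Re_le_nc v) vr; rewrite ler_norml => /andP[]; lra.
have E := qderiv_unique D1 D2; rewrite /= in E.
have E2 : w ^+ n.+1 * M n.+1 w = n.+1%:R * w ^+ n * M n w.
  by apply/eqP; rewrite eq_sym -subr_eq0 -mulrN E.
by rewrite exprS -mulrA -/(M _ _) E2 factS natrM -(IH w rw) -/(M n w) exprS; ring.
Qed.

Lemma Lap_sum n (F : nat -> R -> R[i]) k w : k < complex.Re w ->
  (forall i, growth (F i) k) ->
  growth (fun s => \sum_(i < n) F i s) k /\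
  Lap (fun s => \sum_(i < n) F i s) w = \sum_(i < n) Lap (F i) w.
Proof.
move=> kw gF; elim: n => [|n [IH1 IH2]].
  have E : (fun s => \sum_(i < 0) F i s) = (fun s => 0 * F 0%N s).
    by apply/funext => s; rewrite big_ord0 mul0r.
  rewrite E big_ord0; split; first exact: growth_scale.
  by rewrite (Lap_scale 0 (gF 0%N) kw) mul0r.
have E : (fun s => \sum_(i < n.+1) F i s) = (fun s => \sum_(i < n) F i s + F n s).
  by apply/funext => s; rewrite big_ord_recr.
rewrite E big_ord_recr /=; split; first exact: growth_add.
by rewrite (Lap_add IH1 (gF n) kw) IH2.
Qed.

(** In the i-th term, u^i from the polynomial and u from the prefactor cancel u^(i+1) in the
    denominator. The right-hand side no longer mentions u: for polynomials this replaces the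
    rotation of the contour. *)
Lemma Lap_poly p u w : 0 < complex.Re (u * w) ->
  - u * Lap (fun s => p.[u * s%:C]) (u * w) =
  - \sum_(i < size p) p`_i * i`!%:R / w ^+ i.+1.
Proof.
move=> uw; have uw0 : u * w != 0 by apply/eqP => E; move: uw; rewrite E /= ltxx.
have [u0 w0] : u != 0 /\ w != 0 by apply/andP; rewrite -negb_or -mulf_eq0.
have r2 : 0 < complex.Re (u * w) / 2 by rewrite divr_gt0.
have r2w : complex.Re (u * w) / 2 < complex.Re (u * w) by lra.
pose F (i : nat) (s : R) := (p`_i * u ^+ i) * (s%:C : R[i]) ^+ i.
have -> : (fun s : R => p.[u * s%:C]) = (fun s => \sum_(i < size p) F i s).
  apply/funext => s; rewrite horner_coef; apply: eq_bigr => i _.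
  by rewrite exprMn mulrA.
have gF i : growth (F i) (complex.Re (u * w) / 2) by apply: growth_scale; exact: growth_mono.
have [_ ->] := Lap_sum (size p) r2w gF.
rewrite mulNr mulr_sumr; congr (- _); apply: eq_bigr => i _.
rewrite /F (Lap_scale _ (growth_mono i r2) r2w).
have H := Lap_mono i uw; set L := Lap _ _ in H *.
have -> : L = i`!%:R / (u * w) ^+ i.+1 by rewrite -H mulrAC divff ?mul1r// expf_neq0.
rewrite exprMn exprS; field.
by rewrite ?(w0, u0, expf_neq0).
Qed.

End LaplacePolynomials.

(** * Fourier-Laplace integrals of functions of subexponential growth *)

Section Spectrum.
Import measurable_realfun.
Context {R : realType}.
Implicit Types (f g : R -> R[i]) (E : R[i] -> R[i]) (z : R[i]).

Definition subexp f := ccont f /\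
  forall l : R, 0 < l -> exists2 K, 0 <= K & forall s, normc (f s) <= K * expR (l * `|s|).

Lemma subexp_add f g : subexp f -> subexp g -> subexp (fun s => f s + g s).
Proof.
move=> [cf Hf] [cg Hg]; split; first exact: ccont_add.
move=> l l0; have [K K0 HK] := Hf l l0; have [L L0 HL] := Hg l l0.
exists (K + L) => [|s]; first by rewrite addr_ge0.
by apply: (le_trans (ncD _ _)); rewrite mulrDl lerD.
Qed.

Lemma subexp_growth f (l : R) : subexp f -> 0 < l -> growth f l.
Proof.
move=> [cf Hf] l0; split => //; have [K K0 HK] := Hf l l0; exists K => // s s0.
by have := HK s; rewrite ger0_norm.
Qed.

Lemma subexpN f : subexp f -> subexp (fun s => f (- s)).
Proof.
move=> [[c1 c2] Hf]; have cN : continuous (fun s : R => - s) by move=> s; exact: opp_continuous.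
split; first by split => s; [apply: (continuous_comp (cN s) (c1 _))|apply: (continuous_comp (cN s) (c2 _))].
by move=> l l0; have [K K0 HK] := Hf l l0; exists K => // s; rewrite -normrN.
Qed.

Lemma Fminus_Lap f z : Fminus f z = - Lap f ((0 +i* 1) * z).
Proof.
rewrite /Fminus /Lap /halfint; congr (- C_integral _ _).
by apply/funext => t; congr (_ * expC (- _)); ring.
Qed.

(** The reflection t -> -t carries the integral over the negative half-line to a Laplace integral in
    -iz, whose real part is Im z > 0. *)
Lemma Fplus_Lap f z : subexp f -> 0 < complex.Im z ->
  Fplus f z = Lap (fun s => f (- s)) ((0 -i* 1) * z).
Proof.
move=> [cf Hf] z0; pose l := complex.Im z / 2; have l0 : 0 < l by rewrite divr_gt0.
have [K K0 HK] := Hf l l0.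
pose q t := f t * expC (- (t%:C * ((0 +i* 1) * z))).
have -> : Fplus f z = C_integral `]-oo, 0%R] q.
  by rewrite /Fplus; congr C_integral; apply/funext => t; congr (_ * expC (- _)); ring.
have [c1 c2] : ccont q by apply: ccont_mul => //; exact: ccont_exp.
have bq (t : R) : t <= 0 -> normc (q t) <= K * expR (- (l * - t)).
  move=> t0; rewrite /q (ncM (f _)) nc_exp_neg cReM /= mul0r mul1r sub0r.
  have := HK t; rewrite ler0_norm// => Ht; apply: (le_trans (ler_wpM2r (expR_ge0 _) Ht)).
  rewrite -mulrA -expRD ler_wpM2l// ler_expR /l; lra.
have E1 := Rintegral_reflect c1 l0 (fun s s0 => le_trans (Re_le_nc _) (bq s s0)).
have E2 := Rintegral_reflect c2 l0 (fun s s0 => le_trans (Im_le_nc _) (bq s s0)).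
rewrite /Lap; have -> : (fun s : R => f (- s) * expC (- (s%:C * ((0 -i* 1) * z)))) = (fun s => q (- s)).
  apply/funext => s; rewrite /q; congr (_ * expC (- _)).
  have -> : (0 -i* 1) = - (0 +i* 1) :> R[i] by apply/eqP; rewrite eq_complex /= oppr0 !eqxx.
  by rewrite (rmorphN (real_complex R)); ring.
by rewrite /C_integral E1 E2.
Qed.

Lemma continues_through_add f g V W : subexp f -> subexp g ->
  continues_through f V -> continues_through g W ->
  continues_through (fun x => f x + g x) (V `&` W).
Proof.
move=> sf sg [F [dF Fp Fm]] [G [dG Gp Gm]]; exists (fun z => F z + G z); split.
- move=> z zVW; apply: (@derivableD _ R[i]^o R[i]^o F G).
    by apply: dF; case: zVW => [|[]]; [left|right].
  by apply: dG; case: zVW => [|[]]; [left|right].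
- move=> z z0; have z2 : 0 < complex.Im z / 2 by rewrite divr_gt0.
  rewrite Fp// Gp// !Fplus_Lap//; last exact: subexp_add.
  rewrite (Lap_add (subexp_growth (subexpN sf) z2) (subexp_growth (subexpN sg) z2))//.
  by rewrite cReM /=; lra.
- move=> z z0; have z2 : 0 < - complex.Im z / 2 by rewrite divr_gt0// oppr_gt0.
  rewrite Fm// Gm// !Fminus_Lap (Lap_add (subexp_growth sf z2) (subexp_growth sg z2)) ?opprD//.
  by rewrite cReM /=; lra.
Qed.

Lemma subexp_integrable f (lam : R) : subexp f -> (forall s, complex.Im (f s) = 0) -> 0 < lam ->
  (\int[lebesgue_measure]_x (normc (f x) * expR (- lam * `|x|))%:E < +oo)%E.
Proof.
move=> [[c1 _] Hf] f0 lam0; have l0 : 0 < lam / 2 by rewrite divr_gt0.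
have [K K0 HK] := Hf _ l0.
have nf s : normc (f s) = `|complex.Re (f s)|.
  by case: (f s) (f0 s) => x y /= ->; rewrite expr0n /= addr0 sqrtr_sqr.
have cabs : continuous (fun x : R => `|x|) by move=> x; exact: norm_continuous.
have cexp (k : R) : continuous (fun x : R => expR (k * `|x|)).
  move=> x; apply: continuous_comp; last exact: continuous_expR.
  by apply: cvgMr; exact: cabs.
pose g (x : R) := K * expR (- (lam / 2) * `|x|).
have cg : continuous g by move=> x; apply: cvgMr; exact: cexp.
have g0 x : 0 <= g x by rewrite mulr_ge0.
have le_g x : normc (f x) * expR (- lam * `|x|) <= g x.
  apply: (le_trans (ler_wpM2r (expR_ge0 _) (HK x))).
  rewrite -(mulrA K) -expRD ler_wpM2l// ler_expR; have := normr_ge0 x; lra.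
apply: (@le_lt_trans _ _ (\int[lebesgue_measure]_x (g x)%:E)%E).
  apply: ge0_le_integral => //.
  - by move=> x _; rewrite lee_fin mulr_ge0// nc_ge0.
  - apply: continuous_mfun => // x.
    have -> : (fun x => normc (f x) * expR (- lam * `|x|)) =
      (fun x => `|complex.Re (f x)| * expR (- lam * `|x|)) by apply/funext => s; rewrite nf.
    by apply: cvgM; [exact: (continuous_comp (c1 _) (cabs _))|exact: cexp].
  - exact: continuous_mfun.
  - by move=> x _; rewrite lee_fin.
rewrite (ge0_symfun_integralT g0 cg); last by move=> x; rewrite /= /g normrN.
have -> : [set x : R | 0 <= x] = [set` `[0%R, +oo[] by apply/seteqP; split => x /=; rewrite in_itv /= andbT.
have -> : (\int[lebesgue_measure]_(x in `[0%R, +oo[) (g x)%:E =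
    \int[lebesgue_measure]_(x in `[0%R, +oo[) (K * expR (- (lam / 2 * x)))%:E)%E.
  apply: eq_integral => x; rewrite inE /= in_itv /= andbT => x0.
  by rewrite /g ger0_norm// mulNr.
by rewrite integral_expR_decay// -EFinM ltry.
Qed.

Lemma conj_horner (p : {poly R[i]}) z : (map_poly conjc p).[z] = (p.[z^*%C])^*%C.
Proof. by rewrite -(horner_map conjc) /= conjcK. Qed.

Lemma locpoly_conj E : locpoly E -> locpoly (fun z => (E z^*%C)^*%C).
Proof.
move=> LE r e e0; have [p Hp] := LE r e e0; exists (map_poly conjc p) => z zr.
by rewrite conj_horner -(rmorphB conjc) nc_conj Hp// nc_conj.
Qed.

Lemma expi_conj (s : R) z : (expi s z^*%C)^*%C = expi (- s) z.
Proof.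
rewrite /expi expC_conj; congr expC; case: z => x y.
by apply/eqP; rewrite eq_complex /=; apply/andP; split; apply/eqP; ring.
Qed.

End Spectrum.

(** * Analytic continuation by changing the ray of integration *)

Section Continuation.
Import measurable_realfun.
Context {R : realType}.
Implicit Types (K : R) (k : nat) (z c u : R[i]) (p : {poly R[i]}).

Lemma locally_lip_continuous (f : R -> R) :
  (forall x : R, exists2 L, 0 <= L & forall y, `|y - x| <= 1 -> `|f y - f x| <= L * `|y - x|) ->
  continuous f.
Proof.
move=> H x; have [L L0 HL] := H x.
apply/cvgrPdist_le => e e0.
have m0 : 0 < Num.min 1 (e / (L + 1)) by rewrite lt_min ltr01 divr_gt0//; lra.
near=> y.
have : `|y - x| < Num.min 1 (e / (L + 1)).
  by rewrite distrC; near: y; exact: (nbhsx_ballx x _ m0).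
rewrite lt_min => /andP[y1 y2]; rewrite distrC; apply: (le_trans (HL y (ltW y1))).
move: y2; rewrite ltr_pdivlMr; last by lra.
have := normr_ge0 (y - x); nra.
Unshelve. all: by end_near. Qed.

Lemma locpoly_ccont E u : locpoly E -> ccont (fun s : R => E (u * s%:C)).
Proof.
move=> LE.
have lip (x : R) : exists2 L, 0 <= L & forall y : R, `|y - x| <= 1 ->
    normc (E (u * y%:C) - E (u * x%:C)) <= L * `|y - x|.
  pose r := 2 * (normc u * (`|x| + 1)) + 1; have u0 := nc_ge0 u; have x0 := normr_ge0 x.
  have r0 : 0 < r by rewrite /r ltr_wpDl// mulr_ge0// mulr_ge0//; lra.
  have [S [S0 HS]] := locpoly_bounded (2 * r) LE.
  exists (8 / r * S * normc u) => [|y y1].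
    by rewrite !mulr_ge0 ?invr_ge0 ?(ltW r0) ?(ltW S0).
  have yx : `|y| <= `|x| + 1.
    by have := ler_normD (y - x) x; rewrite subrK; lra.
  have bnd (t : R) : `|t| <= `|x| + 1 -> normc (u * t%:C) <= r / 2.
    move=> t1; rewrite ncM nc_real /r.
    have := ler_wpM2l u0 t1; lra.
  have := locpoly_lip LE r0 HS (bnd y yx) (bnd x _).
  rewrite -mulrBr (ncM u) -rmorphB nc_real mulrA; apply; lra.
split; apply: locally_lip_continuous => x; have [L L0 HL] := lip x; exists L => // y y1.
- by rewrite -cReB; apply: le_trans (Re_le_nc _) (HL y y1).
- by rewrite -cImB; apply: le_trans (Im_le_nc _) (HL y y1).
Qed.

Variables (w0 d1 d2 : R) (h : R[i] -> R[i]) (hp : nat -> {poly R[i]}) (H : R[i] -> R).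
Hypotheses (d10 : 0 <= d1) (d20 : 0 <= d2).
Hypothesis Hb : forall k z, normc (h z - (hp k).[z]) <=
  1 / 4 * 2^-1 ^+ k * expR (k.+1%:R^-1 * normc z + H z).
Hypothesis Hc : forall u, ccont (fun s : R => h (u * s%:C)).

(** The weight [H] is kept abstract so that the section serves both h, whose weight lives in the
    lower half-plane, and its conjugate reflection, whose weight lives in the upper one; du is the
    exponential rate along the ray. *)
Definition ray_weight u (du : R) := [/\ normc u = 1, 0 <= du & forall s : R, 0 <= s -> H (u * s%:C) = du * s].

(** The Laplace variable: for e^{i w0 t} h(t), the kernel e^{-itz} becomes e^{-tw} with w = i (z -
    w0). *)
Definition rotate z : R[i] := (0 +i* 1) * (z - w0%:C).

(* The Laplace integral along the ray of direction u, whose half-plane of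
   convergence depends on u while its value does not. *)
Definition ray_Laplace u z : R[i] := - u * Lap (fun s => h (u * s%:C)) (u * rotate z).

Lemma ray_weight_diff_le u (du : R) k0 (l s : R) : ray_weight u du -> 0 < l -> k0.+1%:R^-1 <= l -> 0 <= s ->
  normc (h (u * s%:C) - (hp k0).[u * s%:C]) <= 1 / 4 * 2^-1 ^+ k0 * expR ((l + du) * s).
Proof.
move=> [u1 du0 Hu] l0 kl s0; apply: (le_trans (Hb k0 _)).
rewrite ler_wpM2l ?mulr_ge0 ?exprn_ge0// ler_expR Hu// mulrDl lerD2r.
by rewrite (ncM u) u1 mul1r nc_real ger0_norm// ler_wpM2r.
Qed.

Lemma ex_inv_le (l : R) : 0 < l -> exists k0 : nat, k0.+1%:R^-1 <= l.
Proof.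
move=> l0; have [n n0 Hn] := exists_nat_div 1 l0; exists n.-1.
by rewrite prednK// -[X in X <= _]mul1r.
Qed.

Lemma growth_hp u (du : R) k (l : R) : ray_weight u du -> 0 < l -> growth (fun s => (hp k).[u * s%:C]) (l + du).
Proof.
move=> [u1 du0 Hu] l0; have [c [K K0 HK]] := growth_poly (hp k) l0 u1; split => //.
exists K => // s s0; apply: (le_trans (HK s s0)).
by rewrite ler_wpM2l// ler_expR ler_wpM2r// lerDl.
Qed.

Lemma growth_h u (du l : R) : ray_weight u du -> 0 < l -> growth (fun s => h (u * s%:C)) (l + du).
Proof.
move=> Du l0; split; first exact: Hc.
have [k0 kl] := ex_inv_le l0.
have [_ [K K0 HK]] := growth_hp k0 Du l0.
exists (1 / 4 * 2^-1 ^+ k0 + K) => [|s s0]; first by rewrite addr_ge0// mulr_ge0 ?exprn_ge0.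
have := ray_weight_diff_le Du l0 kl s0; have := HK s s0.
set p := (hp k0).[_]; set x := h _ => A B.
have -> : x = (x - p) + p by rewrite subrK.
by apply: (le_trans (ncD _ _)); rewrite mulrDl lerD.
Qed.

Lemma ray_Laplace_cvg u du z (e : R) : ray_weight u du -> du < complex.Re (u * rotate z) -> 0 < e ->
  exists k0 : nat, forall k : nat, (k0 <= k)%N ->
    normc (ray_Laplace u z - - u * Lap (fun s => (hp k).[u * s%:C]) (u * rotate z)) <= e.
Proof.
move=> Du duw e0; have [u1 du0 Hu] := Du.
pose l := (complex.Re (u * rotate z) - du) / 2.
have l0 : 0 < l by rewrite divr_gt0// subr_gt0.
have lw : l + du < complex.Re (u * rotate z) by rewrite /l; lra.
have [k1 kl] := ex_inv_le l0.
pose G := complex.Re (u * rotate z) - (l + du).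
have G0 : 0 < G by rewrite subr_gt0.
have [k2 Hk2] := exists_half_pow (2 * (1 / 4 / G)) e0.
exists (maxn k1 k2) => k; rewrite geq_max => /andP[k1k k2k].
rewrite /ray_Laplace -mulrBr (ncM (- u)) ncN u1 mul1r.
have kl' : k.+1%:R^-1 <= l.
  by apply: le_trans kl; rewrite lef_pV2 ?posrE// ler_nat ltnS.
apply: (le_trans (Lap_dist_le (growth_h Du l0) (growth_hp k Du l0) lw (fun s s0 => ray_weight_diff_le Du l0 kl' s0))).
apply: le_trans Hk2; rewrite -/G.
have -> : 2 * (1 / 4 * 2^-1 ^+ k / G) = 2 * (1 / 4 / G) * 2^-1 ^+ k by ring.
rewrite ler_wpM2l ?mulr_ge0 ?invr_ge0 ?(ltW G0)//.
by rewrite ler_wiXn2l// ?invr_ge0// invf_le1// ler1n.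
Qed.

(** For each polynomial hp k both rays give the same sum by [Lap_poly]; an index k large enough for
    both directions makes the two integrals arbitrarily close. *)
Lemma ray_Laplace_eq u du v dv z : ray_weight u du -> ray_weight v dv ->
  du < complex.Re (u * rotate z) -> dv < complex.Re (v * rotate z) -> ray_Laplace u z = ray_Laplace v z.
Proof.
move=> Du Dv hu hv; have [_ du0 _] := Du; have [_ dv0 _] := Dv.
apply/eqP; rewrite -subr_eq0; apply/eqP/nc_eq0/eqP; rewrite eq_le nc_ge0 andbT.
apply: (@ler_small _ _ _ 2) => // e e0 _.
have [k1 H1] := ray_Laplace_cvg Du hu e0; have [k2 H2] := ray_Laplace_cvg Dv hv e0.
have := H1 (maxn k1 k2) (leq_maxl _ _); have := H2 (maxn k1 k2) (leq_maxr _ _).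
rewrite (Lap_poly _ (le_lt_trans du0 hu)) (Lap_poly _ (le_lt_trans dv0 hv)).
set S := \sum_(_ < _) _ => B A.
have := le_nc_distD (- S) (ray_Laplace u z) (ray_Laplace v z); rewrite (ncBC (- S)); lra.
Qed.

Lemma ray_Laplace_qderiv u du z : ray_weight u du -> du < complex.Re (u * rotate z) -> exists d, qderiv (ray_Laplace u) z d.
Proof.
move=> Du duw; pose l := (complex.Re (u * rotate z) - du) / 2.
have l0 : 0 < l by rewrite divr_gt0// subr_gt0.
have lw : l + du < complex.Re (u * rotate z) by rewrite /l; lra.
have D := Lap_qderiv (growth_h Du l0) lw.
have E y : u * rotate y = (u * (0 +i* 1)) * y + - (u * (0 +i* 1) * w0%:C) by rewrite /rotate; ring.
rewrite E in D; have := qderiv_scale (- u) (qderiv_affine D) => D2.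
exists (- u * (u * (0 +i* 1) * Lap (fun s => - s%:C * h (u * s%:C)) (u * (0 +i* 1) * z + - (u * (0 +i* 1) * w0%:C)))).
have -> : ray_Laplace u = (fun y => - u * Lap (fun s => h (u * s%:C)) (u * (0 +i* 1) * y + - (u * (0 +i* 1) * w0%:C))).
  by apply/funext => y; rewrite /ray_Laplace E.
exact: D2.
Qed.

Definition modulated z : R[i] := expi w0 z * h z.

Lemma modulated_exp (t : R) z :
  modulated t%:C * expC (- (t%:C * ((0 +i* 1) * z))) = h t%:C * expC (- (t%:C * rotate z)).
Proof.
have -> : - (t%:C * rotate z) = (0 +i* w0) * t%:C + - (t%:C * ((0 +i* 1) * z)).
  have -> : (0 +i* w0) = (0 +i* 1) * w0%:C :> R[i].
    by apply/eqP; rewrite eq_complex /=; apply/andP; split; apply/eqP; ring.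
  by rewrite /rotate; ring.
by rewrite expCD /modulated /expi (mulrA (h _)) (mulrC (h _)).
Qed.

Hypotheses (D1 : ray_weight 1 0) (DN1 : ray_weight (-1) 0).
Hypotheses (Di : ray_weight (0 +i* 1) d1) (DNi : ray_weight (0 -i* 1) d2).

Lemma subexp_modulated : subexp (fun x : R => modulated x%:C).
Proof.
split.
  apply: ccont_mul; last first.
    by have := Hc 1; congr ccont; apply/funext => s; rewrite mul1r.
  have := ccont_exp (- (0 +i* w0)); congr ccont; apply/funext => s.
  by rewrite mulrN opprK mulrC.
move=> l l0; have [_ [K K0 HK]] := growth_h D1 l0; have [_ [L L0 HL]] := growth_h DN1 l0.
exists (K + L) => [|s]; first by rewrite addr_ge0.
have -> : normc (modulated s%:C) = normc (h s%:C).
  by rewrite /modulated (ncM (expi _ _)) nc_expi /= mulr0 expR0 mul1r.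
rewrite mulrDl; have [s0|s0] := lerP 0 s.
  have := HK s s0; rewrite addr0 mul1r ger0_norm//.
  have : 0 <= L * expR (l * s) by rewrite mulr_ge0.
  lra.
have s0' : 0 <= - s by rewrite oppr_ge0 ltW.
have := HL _ s0'; rewrite addr0 (rmorphN (real_complex R)) mulN1r opprK ltr0_norm//.
have : 0 <= K * expR (l * - s) by rewrite mulr_ge0.
lra.
Qed.

Lemma Fminus_ray_Laplace z : Fminus (fun x : R => modulated x%:C) z = ray_Laplace 1 z.
Proof.
rewrite Fminus_Lap /ray_Laplace /Lap mulN1r mul1r; congr (- halfint _).
by apply/funext => t; rewrite modulated_exp mul1r.
Qed.

Lemma Re_rotate z : complex.Re (rotate z) = - complex.Im z.
Proof. by case: z => x y; rewrite /rotate /=; ring. Qed.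

Lemma Re_iJW z : complex.Re ((0 +i* 1) * rotate z) = w0 - complex.Re z.
Proof. by case: z => x y; rewrite /rotate /=; ring. Qed.

Lemma Re_NiJW z : complex.Re ((0 -i* 1) * rotate z) = complex.Re z - w0.
Proof. by case: z => x y; rewrite /rotate /=; ring. Qed.

Lemma Fplus_ray_Laplace z : 0 < complex.Im z -> Fplus (fun x : R => modulated x%:C) z = ray_Laplace (-1) z.
Proof.
move=> z0; rewrite (Fplus_Lap subexp_modulated z0) /ray_Laplace opprK mul1r /Lap; congr halfint.
apply/funext => s; have E : -1 * s%:C = (- s)%:C :> R[i] by rewrite (rmorphN (real_complex R)) mulN1r.
rewrite E; have -> : s%:C * (-1 * rotate z) = (- s)%:C * rotate z by rewrite -E; ring.
rewrite -modulated_exp; congr (_ * expC (- _)).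
have -> : (0 -i* 1) = - (0 +i* 1) :> R[i] by apply/eqP; rewrite eq_complex /= oppr0 !eqxx.
by rewrite -E; ring.
Qed.

(** The rays -1 and 1 represent F^+ and F^-. The ray i converges where Re z < w0 - d1 and the ray -i
    where Re z > w0 + d2, in both cases across the real axis; where two of the half-planes overlap
    the integrals agree, so the piecewise G is differentiable. *)
Lemma continues_off_interval :
  continues_through (fun x : R => modulated x%:C) (~` `[w0 - d1, w0 + d2]).
Proof.
pose G z := if 0 < complex.Im z then ray_Laplace (-1) z else if complex.Im z < 0 then ray_Laplace 1 z
  else if complex.Re z < w0 then ray_Laplace (0 +i* 1) z else ray_Laplace (0 -i* 1) z.
have m1 z : complex.Re (-1 * rotate z) = complex.Im z by rewrite mulN1r cReN Re_rotate opprK.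
have p1 z : complex.Re (1 * rotate z) = - complex.Im z by rewrite mul1r Re_rotate.
exists G; split.
- move=> z zW.
  suff [d Hd] : exists d, qderiv G z d by exact: C_derivable_qderiv Hd.
  have [y0|y0|y0] := ltgtP (complex.Im z) 0.
  + have [|d Hd] := ray_Laplace_qderiv (z := z) D1; first by rewrite p1 oppr_gt0.
    exists d; have r0 : 0 < - complex.Im z / 2 by rewrite divr_gt0// oppr_gt0.
    apply: (qderiv_ext r0 _ Hd) => v vr.
    have := le_trans (Im_le_nc v) vr; rewrite ler_norml => /andP[v1 v2].
    have zv : complex.Im (z + v) < 0 by rewrite cImD; lra.
    by rewrite /G zv ltNge (ltW zv).
  + have [|d Hd] := ray_Laplace_qderiv (z := z) DN1; first by rewrite m1.
    exists d; have r0 : 0 < complex.Im z / 2 by rewrite divr_gt0.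
    apply: (qderiv_ext r0 _ Hd) => v vr.
    have := le_trans (Im_le_nc v) vr; rewrite ler_norml => /andP[v1 v2].
    have zv : 0 < complex.Im (z + v) by rewrite cImD; lra.
    by rewrite /G zv.
  have {zW} : complex.Re z < w0 - d1 \/ w0 + d2 < complex.Re z.
    case: zW; first by rewrite y0 eqxx.
    rewrite /= in_itv /= => /negP; rewrite negb_and -!ltNge => /orP[]; [by left|by right].
  (* Near a real point the ray u still converges, and there G coincides with its integral on all
     three sides: above, below and on the axis. The middle hypothesis says that u is the branch used
     by G on the axis. *)
  have gen u du : ray_weight u du -> (forall y : R[i], complex.Re (u * rotate y) > du ->
       (complex.Re y < w0 -> u = 0 +i* 1) /\ (~~ (complex.Re y < w0) -> u = 0 -i* 1)) ->
     du < complex.Re (u * rotate z) -> exists d, qderiv G z d.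
    move=> Du Gu zu; have [d Hd] := ray_Laplace_qderiv Du zu; exists d.
    have [u1 du0 _] := Du.
    pose r := (complex.Re (u * rotate z) - du) / 2.
    have r0 : 0 < r by rewrite divr_gt0// subr_gt0.
    apply: (qderiv_ext r0 _ Hd) => v vr.
    have zv : du < complex.Re (u * rotate (z + v)).
      have -> : u * rotate (z + v) = u * rotate z + u * ((0 +i* 1) * v) by rewrite /rotate; ring.
      rewrite cReD; have : `|complex.Re (u * ((0 +i* 1) * v))| <= r.
        apply: (le_trans (Re_le_nc _)); rewrite (ncM u) u1 mul1r (ncM (0 +i* 1)) nc_i.
        by rewrite normr1 mul1r.
      by rewrite ler_norml /r => /andP[]; lra.
    have [g1 g2] := Gu _ zv.
    rewrite /G; case: ifPn => y1.
      by apply: (ray_Laplace_eq Du DN1 zv); rewrite m1.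
    case: ifPn => y2.
      by apply: (ray_Laplace_eq Du D1 zv); rewrite p1 oppr_gt0.
    by case: ifPn => x1; [rewrite -(g1 x1)|rewrite -(g2 x1)].
  move=> [xl|xr].
  + apply: (gen _ _ Di); last by rewrite Re_iJW; lra.
    move=> y; rewrite Re_iJW => H1; split => //.
    by rewrite -leNgt => H2; exfalso; have := d10; lra.
  + apply: (gen _ _ DNi); last by rewrite Re_NiJW; lra.
    move=> y; rewrite Re_NiJW => H1; split => //.
    by move=> H2; exfalso; have := d20; lra.
- by move=> z z0; rewrite /G z0 Fplus_ray_Laplace.
- by move=> z z0; rewrite /G z0 ltNge (ltW z0) /= Fminus_ray_Laplace.
Qed.

End Continuation.

(** * Transfer to the defined notions, and the final function *)

Section Assembly.
Context {R : realType}.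
Implicit Types (E h : R[i] -> R[i]) (z : R[i]).

Lemma limf_einf_pinfty_le (u : R -> \bar R) (c : R) :
  (forall k : nat, exists2 r, k%:R <= r & (u r <= c%:E)%E) ->
  (limf_einf u (pinfty_nbhs R) <= c%:E)%E.
Proof.
move=> H; rewrite limf_einfE; apply: ge_ereal_sup => _ [V [M [_ HV]] <-].
have [r kr ur] := H (Num.truncn M).+1; apply: le_trans ur.
apply: ereal_inf_lbound; exists r => //; apply: HV.
by apply: lt_le_trans kr; exact: truncnS_gt.
Qed.

Lemma sign_changes_le (g : R -> R) (r c : R) : 0 < r ->
  (forall n, alternates g 0 r n -> n%:R <= c * r) ->
  (sign_changes g r * (r^-1)%:E <= c%:E)%E.
Proof.
move=> r0 H; have S : (sign_changes g r <= (c * r)%:E)%E.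
  by apply: ge_ereal_sup => _ [n Hn <-]; rewrite lee_fin H.
apply: (@le_trans _ _ ((c * r)%:E * (r^-1)%:E)%E).
  by apply: lee_wpmul2r; rewrite ?lee_fin ?invr_ge0 ?(ltW r0).
by rewrite -EFinM mulfK// gt_eqF.
Qed.

Lemma locpoly_entire E : locpoly E -> entire E.
Proof. by move=> LE z; have [d Hd] := locpoly_qderivable z LE; exact: (C_derivable_qderiv Hd). Qed.

Lemma ray_weight_lower_im (d x y du : R) : x ^+ 2 + y ^+ 2 = 1 -> 0 <= du -> d * Num.max 0 (- y) = du ->
  ray_weight (fun z => d * lower_im z) (x +i* y) du.
Proof.
move=> xy du0 yd; split => //; first by rewrite /= xy sqrtr1.
move=> s s0; rewrite /lower_im; have -> : complex.Im ((x +i* y) * s%:C) = y * s by rewrite /=; ring.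
by rewrite -yd -mulNr -[X in Num.max X _](mul0r s) -maxr_pMl// mulrA.
Qed.

Lemma ray_weight_lower_im_conj (d x y du : R) : x ^+ 2 + y ^+ 2 = 1 -> 0 <= du -> d * Num.max 0 y = du ->
  ray_weight (fun z => d * lower_im z^*%C) (x +i* y) du.
Proof.
move=> xy du0 yd; have := @ray_weight_lower_im d x (- y) du; rewrite sqrrN opprK => /(_ xy du0 yd) [_ _ Hs].
split => //; first by rewrite /= xy sqrtr1.
move=> s s0; rewrite -(Hs s s0); congr (_ * lower_im _).
by apply/eqP; rewrite eq_complex /=; apply/andP; split; apply/eqP; ring.
Qed.

Lemma alternates_scale (g : R -> R) (c lo hi : R) n : alternates (fun x => c * g x) lo hi n -> alternates g lo hi n.
Proof.
move=> [x [x0 xn xk]]; exists x; split => // k kn; have [H1 H2] := xk k kn; split => //.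
by move: H2; rewrite mulrACA; have := sqr_ge0 c; rewrite expr2; nra.
Qed.

End Assembly.

Unset Implicit Arguments.

Theorem mainTheorem3 (R : realType) (a b : R) (ha : 0 < a) (hab : a < b) :
  exists f : R[i] -> R[i],
    entire f /\ real_on_R f /\ (exists z, f z != 0) /\ exponential_type f /\
    (forall lam : R, 0 < lam ->
       (\int[lebesgue_measure]_x
          (normc (f x%:C) * expR (- lam * `|x|))%:E < +oo)%E) /\
    spectrum (fun x : R => f x%:C) `<=` `[- b, - a] `|` `[a, b] /\
    (limf_einf (fun r : R =>
        sign_changes (fun x : R => complex.Re (f x%:C)) r * (r^-1)%:E)%E
       (pinfty_nbhs R) < (a / pi)%:E)%E.
Proof.
(* With a < b this gives both beta <= 1/8 and 8 beta d = a (b - a) / b <= a. *)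
pose d := b - a; pose beta := a / (8 * b).
have d0 : 0 < d by rewrite subr_gt0.
have b0 : 0 < b := lt_trans ha hab.
have beta0 : 0 < beta by rewrite divr_gt0// mulr_gt0.
have beta8 : beta <= 1 / 8 by rewrite /beta ler_pdivrMr ?mulr_gt0//; lra.
have bda : 8 * beta * d <= a.
  have -> : 8 * beta * d = a * (d / b) by rewrite /beta; field; rewrite gt_eqF.
  by rewrite -[leRHS]mulr1 ler_wpM2l ?(ltW ha)// ler_pdivrMr// mul1r /d; lra.
have [h [hp [Hb Lh h0 hp0 Hr]]] := construction ha d0 beta0 beta8 bda.
(* The reflection moves the weight to the upper half-plane, so the frequencies of [hs] lie in
   [-d, 0]; shifted by -a they fill at most [-b, -a]. *)
pose hs z := (h z^*%C)^*%C; pose hps k := map_poly conjc (hp k).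
have Hbs k z : normc (hs z - (hps k).[z]) <=
    1 / 4 * 2^-1 ^+ k * expR (k.+1%:R^-1 * normc z + d * lower_im z^*%C).
  by rewrite conj_horner -(rmorphB conjc) nc_conj -(nc_conj z).
have Lhs : locpoly hs := locpoly_conj Lh.
have D1 : ray_weight (fun z => d * lower_im z) 1 0 by apply: ray_weight_lower_im => //; rewrite ?oppr0 ?maxxx; ring.
have DN1 : ray_weight (fun z => d * lower_im z) (-1) 0.
  have -> : -1 = (-1) +i* 0 :> R[i] by apply/eqP; rewrite eq_complex /= oppr0 !eqxx.
  by apply: ray_weight_lower_im => //; rewrite ?oppr0 ?maxxx; ring.
have Di : ray_weight (fun z => d * lower_im z) (0 +i* 1) 0.
  by apply: ray_weight_lower_im => //; [ring|rewrite max_l ?mulr0// oppr_le0].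
have DNi : ray_weight (fun z => d * lower_im z) (0 -i* 1) d.
  by apply: ray_weight_lower_im; [ring|exact: ltW|rewrite opprK max_r ?mulr1].
have D1s : ray_weight (fun z => d * lower_im z^*%C) 1 0 by apply: ray_weight_lower_im_conj => //; rewrite ?maxxx; ring.
have DN1s : ray_weight (fun z => d * lower_im z^*%C) (-1) 0.
  have -> : -1 = (-1) +i* 0 :> R[i] by apply/eqP; rewrite eq_complex /= oppr0 !eqxx.
  by apply: ray_weight_lower_im_conj => //; rewrite ?maxxx; ring.
have Dis : ray_weight (fun z => d * lower_im z^*%C) (0 +i* 1) d.
  by apply: ray_weight_lower_im_conj; [ring|exact: ltW|rewrite max_r ?mulr1].
have DNis : ray_weight (fun z => d * lower_im z^*%C) (0 -i* 1) 0.
  by apply: ray_weight_lower_im_conj => //; [ring|rewrite max_l ?mulr0// oppr_le0].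
have C1 := continues_off_interval a (lexx 0) (ltW d0) Hb (fun u => locpoly_ccont u Lh) D1 DN1 Di DNi.
have C2 := continues_off_interval (- a) (ltW d0) (lexx 0) Hbs (fun u => locpoly_ccont u Lhs) D1s DN1s Dis DNis.
have S1 := subexp_modulated a Hb (fun u => locpoly_ccont u Lh) D1 DN1.
have S2 := subexp_modulated (- a) Hbs (fun u => locpoly_ccont u Lhs) D1s DN1s.
pose f z := modulated a h z + modulated (- a) hs z.
have f_conj z : f z = expi a z * h z + (expi a z^*%C * h z^*%C)^*%C.
  by rewrite /f /modulated /hs -(expi_conj a) -(rmorphM conjc).
have f_real (x : R) : f x%:C = (2 * complex.Re (expi a x%:C * h x%:C))%:C.
  rewrite f_conj; have -> : x%:C^*%C = x%:C :> R[i] by apply/eqP; rewrite eq_complex /= oppr0 !eqxx.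
  case: (_ * _) => u v /=.
  by apply/eqP; rewrite eq_complex /=; apply/andP; split; apply/eqP; ring.
exists f; split; [|split; [|split; [|split; [|split; [|split]]]]].
- by apply/locpoly_entire/locpoly_add; apply: locpoly_mul => //; exact: locpoly_expC.
- by move=> x; rewrite f_real.
- exists 0; have := f_real 0; rewrite /= => ->.
  by rewrite expi_0 h0 mulr1 /= mulr1 eq_complex /= pnatr_eq0.
- have hle z : normc (h z) <= 2 * expR ((1 + d) * normc z).
    have := Hb 0%N z; rewrite hp0 hornerC expr0 mulr1 invr1 !mul1r => H0.
    have -> : h z = 1 + (h z - 1) by rewrite addrC subrK.
    apply: (le_trans (ncD _ _)); rewrite nc1.
    have : expR (normc z + d * lower_im z) <= expR ((1 + d) * normc z).
      by rewrite ler_expR (mulrDl 1 d) mul1r lerD2l ler_wpM2l ?lower_im_le// (ltW d0).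
    have : 1 <= expR ((1 + d) * normc z).
      by rewrite -[X in X <= _](expR0 R) ler_expR mulr_ge0 ?nc_ge0// addr_ge0// (ltW d0).
    have := expR_ge0 (normc z + d * lower_im z); lra.
  have gle z : normc (expi a z * h z) <= 2 * expR ((a + (1 + d)) * normc z).
    rewrite (ncM (expi a z)) nc_expi (mulrDl a) expRD mulrCA.
    apply: ler_pM; rewrite ?expR_ge0 ?nc_ge0 ?hle// ler_expR mulNr -mulrN ler_wpM2l ?(ltW ha)//.
    by apply: le_trans (Im_le_nc z); rewrite -normrN ler_norm.
  exists 4, (a + (1 + d)) => z; rewrite f_conj.
  apply: (le_trans (ncD _ _)); rewrite nc_conj; have := gle z^*%C; rewrite nc_conj.
  by have := gle z; lra.
- move=> lam lam0; apply: (@subexp_integrable _ (fun x => f x%:C)) => //; first exact: subexp_add.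
  by move=> s; rewrite f_real.
- move=> x; apply: contra_notP => /= xn.
  (* The zeros are the rates along i for h and along -i for [hs], where the weights vanish. *)
  exists (~` `[a - 0, a + d] `&` ~` `[- a - d, - a + 0]).
    split; last exact: continues_through_add.
    by apply: openI; apply: closed_openC; exact: interval_closed.
  split => /= xi; apply: xn; [right|left]; move: xi; rewrite !in_itv /= /d => /andP[x1 x2].
    by apply/andP; split; lra.
  by apply/andP; split; lra.
(* The rate does not depend on the stage, so the strict inequality survives the lower limit. *)
- have rt : rate a d beta < a / pi.
    rewrite /rate ltr_pM2r ?invr_gt0 ?pi_gt0// ltrBlDr ltrDl divr_gt0 ?gain_gt0//.
    by rewrite mulr_gt0// scale_gt0.
  apply: (@le_lt_trans _ _ (rate a d beta)%:E); last by rewrite lte_fin.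
  apply: limf_einf_pinfty_le => k; have [r [kr r0 Gr]] := Hr k; exists r => //.
  apply: sign_changes_le => // n An; apply: Gr; apply: (@alternates_scale _ _ 2).
  by apply: alternates_ext An => x _ _; rewrite f_real.
Qed.
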